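(* Let $\mathcal{A}$ be a central arrangement of $n=|\mathcal{A}|$ hyperplanes in $\mathbb{C}^{\ell}$ with projectivized complement $U=U(\mathcal{A})$, and let $\mathcal{N}$ be a reduced $3$-multinet on $\mathcal{A}$, with associated admissible map $f_{\mathcal{N}}\colon U\to S=\Sigma_{0,3}$ and associated component $T_{\mathcal{N}}=f_{\mathcal{N}}^*(H^1(S;\mathbb{C}^* ))\subset\mathcal{V}^1_1(U)$. Let $\rho_n\colon\pi_1(U)\to\mathbb{C}^*$ be the diagonal character, and let $\bar\rho_n=\rho_n^{n/3}$ be the reduced diagonal character. Then $\bar\rho_n\in T_{\mathcal{N}}$.
   Context: A central hyperplane arrangement $\mathcal{A}$ in $\mathbb{C}^{\ell}$ is a finite collection of codimension-$1$ linear subspaces; for each $H\in\mathcal{A}$ fix a linear form $f_H$ with $\ker(f_H)=H$. The complement is $M=\mathbb{C}^{\ell}\setminus\bigcup_{H\in\mathcal{A}}H$, and the projectivized complement is $U=U(\mathcal{A})=\mathbb{P}(M)\subset\mathbb{CP}^{\ell-1}$. The group $\pi_1(M)$ is generated by meridional loops $\gamma_H$ about the hyperplanes; $\bar\gamma_H\in\pi_1(U)$ denotes the image of $\gamma_H$ under the projection $M\to U$. The group $H_1(U;\mathbb{Z})\cong\mathbb{Z}^{n-1}$ is generated by the classes $\bar x_H=[\bar\gamma_H]$, subject to the single relation $\sum_{H\in\mathcal{A}}\bar x_H=0$. The diagonal character $\rho_n\colon\pi_1(U)\to\mathbb{C}^*$ sends every $\bar\gamma_H$ to $e^{2\pi\mathrm{i}/n}$.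 If $3\mid n$, the reduced diagonal character is $\bar\rho_n=\rho_n^{n/3}$; it sends every $\bar\gamma_H$ to $e^{2\pi\mathrm{i}/3}$. $L_2(\mathcal{A})$ is the set of codimension-$2$ intersections (flats) of hyperplanes in $\mathcal{A}$. A $k$-multinet on $\mathcal{A}$ is a partition $\mathcal{A}=\mathcal{A}_1\sqcup\cdots\sqcup\mathcal{A}_k$ into $k\ge3$ nonempty classes, together with a multiplicity function $m\colon\mathcal{A}\to\mathbb{Z}_{>0}$, $H\mapsto m_H$, and a subset $\mathcal{X}\subseteq L_2(\mathcal{A})$ (the base locus), such that: (i) $d=\sum_{H\in\mathcal{A}_i}m_H$ is independent of $i$; (ii) for $H\in\mathcal{A}_i$ and $H'\in\mathcal{A}_j$ with $i\ne j$, $H\cap H'\in\mathcal{X}$; (iii) for each $X\in\mathcal{X}$, $n_X=\sum_{H\in\mathcal{A}_i,\,H\supset X}m_H$ is independent of $i$; (iv) within each class $\mathcal{A}_i$, any two hyperplanes can be connected by a chain of hyperplanes in $\mathcal{A}_i$ with consecutive members meeting outside $\mathcal{X}$. It is reduced if all $m_H=1$. For a reduced $3$-multinet, $n=3d$, so $3\mid n$. Given a $3$-multinet $\mathcal{N}$, set $C_i=\prod_{H\in\mathcal{A}_i}f_H^{m_H}$ for $i=1,2,3$. It follows from the multinet axioms that $C_1,C_2,C_3$ span a $2$-dimensional space. The associated map is $f_{\mathcal{N}}=[C_1:C_2]\colon U\to\Sigma_{0,3}$, where $S=\Sigma_{0,3}$ is $\mathbb{CP}^1$ minus the three points corresponding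 to the members $C_1,C_2,C_3$ of the pencil (that is, the values of $[C_1:C_2]$ along which $C_1$, $C_2$, $C_3$, respectively, vanish). A map from $U$ to a smooth connected complex curve $\Sigma$ with $\chi(\Sigma)<0$ is admissible if it is holomorphic and surjective with connected generic fiber; $f_{\mathcal{N}}$ is admissible. For a connected finite-type CW-complex $X$, $H^1(X;\mathbb{C}^* )=\mathrm{Hom}(\pi_1(X),\mathbb{C}^* )$ is the character group of $X$, $\mathcal{V}^1_1(X)=\{\rho\in H^1(X;\mathbb{C}^* ) : \dim H^1(X;\mathbb{C}_\rho)\ge 1\}$, where $\mathbb{C}_\rho$ is the rank-one local system defined by $\rho$, and $f_{\mathcal{N}}^*$ is the homomorphism of character groups given by precomposition with $(f_{\mathcal{N}})_*\colon\pi_1(U)\to\pi_1(S)$. The subtorus $T_{\mathcal{N}}=f_{\mathcal{N}}^*(H^1(S;\mathbb{C}^* ))$ is the component of $\mathcal{V}^1_1(U)$ associated to $\mathcal{N}$. *)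

(* Defs.v *)
From HB Require Import structures.
From mathcomp Require Import all_boot all_order all_algebra generic_quotient.
From mathcomp Require Import all_classical all_reals all_analysis.
From mathcomp Require Import homotopy.
From mathcomp Require Import complex ring lra.
Import numFieldNormedType.Exports.
Set Implicit Arguments. Unset Strict Implicit. Unset Printing Implicit Defensive.
Import Order.TTheory GRing.Theory Num.Theory.
Local Open Scope classical_set_scope.
Local Open Scope quotient_scope.
Local Open Scope ring_scope.

Section unit_interval.
Variable R : realType.

Definition unitI : Type := set_type `[0 : R, 1].
HB.instance Definition _ := Topological.on unitI.

Definition unitI_val (t : unitI) : R := set_val t.

Lemma clamp_subproof (t : R) : Num.max 0 (Num.min 1 t) \in `[0 : R, 1]%classic.
Proof.
by apply/mem_set; rewrite /= in_itv /= le_max lexx /= ge_max ler01 ge_min lexx.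
Qed.

Definition clamp (t : R) : unitI := exist (fun x => x \in `[0 : R, 1]%classic) _ (clamp_subproof t).

Lemma unitI_ge0 t : 0 <= unitI_val t.
Proof. by have := set_mem (valP t); rewrite /= in_itv => /andP[]. Qed.

Lemma unitI_le1 t : unitI_val t <= 1.
Proof. by have := set_mem (valP t); rewrite /= in_itv => /andP[]. Qed.

Lemma unitI_inj : injective unitI_val.
Proof. by move=> x y; exact: val_inj. Qed.

Lemma clampE t : 0 <= t <= 1 -> unitI_val (clamp t) = t.
Proof.
by case/andP=> t0 t1; rewrite /unitI_val set_valE /= min_r // max_r.
Qed.

Lemma clampK t : clamp (unitI_val t) = t.
Proof. by apply: unitI_inj; rewrite clampE // unitI_ge0 unitI_le1. Qed.

Lemma unitI_zero_one_neq : clamp 0 != clamp 1.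
Proof.
by apply/eqP => /(congr1 unitI_val); rewrite !clampE ?lexx ?ler01 // => /eqP;
  rewrite eq_sym oner_eq0.
Qed.

HB.instance Definition _ := isBiPointed.Build unitI unitI_zero_one_neq.

Lemma unitI_val_continuous : continuous unitI_val.
Proof. exact: initial_continuous. Qed.

Lemma clamp_continuous : continuous clamp.
Proof.
apply: continuous_comp_initial.
have -> : set_val \o clamp = (cst 0 \max (cst 1 \min id)) by [].
apply: max_fun_continuous; first exact: cst_continuous.
by apply: min_fun_continuous; [exact: cst_continuous|move=> ?; exact: cvg_id].
Qed.

End unit_interval.

Arguments clamp {R}.
Arguments unitI_val {R}.

Section gluing.
Variables (R : realType) (Z X : topologicalType).

Lemma if_continuous (h : Z -> R) (c : R) (f g : Z -> X) :
  continuous h -> continuous f -> continuous g ->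
  (forall z, h z = c -> f z = g z) ->
  continuous (fun z => if h z <= c then f z else g z).
Proof.
move=> ch cf cg fg; apply/continuous_subspace_setT.
have -> : [set: Z] = h @^-1` [set x | x <= c] `|` h @^-1` [set x | c <= x].
  by apply/seteqP; split=> z //= _; case: (leP (h z) c) => [|/ltW]; [left|right].
apply: withinU_continuous.
- by apply: preimage_closed => // x _; exact: ch.
- by apply: preimage_closed => // x _; exact: ch.
- apply: (subspace_eq_continuous (f := f)).
    by move=> z /set_mem /= zc; rewrite /from_subspace zc.
  exact: continuous_subspaceT.
- apply: (subspace_eq_continuous (f := g)).
    move=> z /set_mem /= cz; rewrite /from_subspace; case: (leP (h z) c) => // zc.
    by rewrite (fg z) //; apply/eqP; rewrite eq_le zc cz.
  exact: continuous_subspaceT.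
Qed.

End gluing.

Section paths.
Variables (R : realType) (X : topologicalType).
Local Notation I := (unitI R).
Local Notation pth x y := {path I from x to y in X}.

Definition homotopic (x y : X) (p q : pth x y) := exists F : I * I -> X,
  [/\ continuous F,
      forall t, F (zero, t) = p t,
      forall t, F (one, t) = q t,
      forall s, F (s, zero) = x &
      forall s, F (s, one) = y].

Definition concat_fun (x y z : X) (p : pth x y) (q : pth y z) (t : I) : X :=
  if unitI_val t <= 2^-1 then p (clamp (2 * unitI_val t))
  else q (clamp (2 * unitI_val t - 1)).

Lemma val0 : unitI_val (zero : I) = 0. Proof. by rewrite clampE ?lexx ?ler01. Qed.
Lemma val1 : unitI_val (one : I) = 1. Proof. by rewrite clampE ?lexx ?ler01. Qed.
Lemma clamp_le0 t : t <= 0 -> clamp t = zero :> I.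
Proof.
move=> t0; apply: unitI_inj; rewrite val0 /unitI_val set_valE /=.
by rewrite min_r ?max_l // (le_trans t0).
Qed.
Lemma clamp_ge1 t : 1 <= t -> clamp t = one :> I.
Proof.
move=> t1; apply: unitI_inj; rewrite val1 /unitI_val set_valE /=.
by rewrite min_l ?max_r.
Qed.

Lemma path_cts x y (p : pth x y) : continuous p.
Proof. exact: cts_fun. Qed.

Lemma cst_cts (Z Y : topologicalType) (y : Y) : continuous (fun _ : Z => y).
Proof. exact: cst_continuous. Qed.
Lemma comp_cts (Z Y W : topologicalType) (g : Y -> W) (f : Z -> Y) :
  continuous g -> continuous f -> continuous (fun z => g (f z)).
Proof. by move=> cg cf z; apply: continuous_comp; [exact: cf|exact: cg]. Qed.
Lemma pair_cts (Z Y W : topologicalType) (g : Z -> W) (f : Z -> Y) :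
  continuous g -> continuous f -> continuous (fun z => (g z, f z)).
Proof. by move=> cg cf z; apply: cvg_pair; [exact: cg|exact: cf]. Qed.
Lemma add_cts (Z : topologicalType) (f g : Z -> R) :
  continuous f -> continuous g -> continuous (fun z => f z + g z).
Proof. by move=> cf cg z; apply: cvgD; [exact: cf|exact: cg]. Qed.
Lemma mul_cts (Z : topologicalType) (f g : Z -> R) :
  continuous f -> continuous g -> continuous (fun z => f z * g z).
Proof. by move=> cf cg z; apply: cvgM; [exact: cf|exact: cg]. Qed.
Lemma sub_cts (Z : topologicalType) (f g : Z -> R) :
  continuous f -> continuous g -> continuous (fun z => f z - g z).
Proof. by move=> cf cg z; apply: cvgB; [exact: cf|exact: cg]. Qed.
Lemma min_cts (Z : topologicalType) (f g : Z -> R) :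
  continuous f -> continuous g -> continuous (fun z => Num.min (f z) (g z)).
Proof. exact: min_fun_continuous. Qed.
Lemma max_cts (Z : topologicalType) (f g : Z -> R) :
  continuous f -> continuous g -> continuous (fun z => Num.max (f z) (g z)).
Proof. exact: max_fun_continuous. Qed.
Lemma fst_cts (Y Z : topologicalType) : continuous (fun z : Y * Z => z.1).
Proof. by move=> z; exact: cvg_fst. Qed.
Lemma snd_cts (Y Z : topologicalType) : continuous (fun z : Y * Z => z.2).
Proof. by move=> z; exact: cvg_snd. Qed.


Ltac cts := repeat first
  [ exact: unitI_val_continuous | exact: clamp_continuous | exact: path_cts
  | exact: fst_cts | exact: snd_cts | exact: cst_cts | assumption
  | apply: sub_cts | apply: add_cts | apply: mul_cts
  | apply: min_cts | apply: max_cts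
  | apply: (comp_cts (g := unitI_val)) | apply: (comp_cts (g := clamp))
  | apply: pair_cts ].

Lemma concat_cts x y z (p : pth x y) (q : pth y z) : continuous (concat_fun p q).
Proof.
apply: if_continuous.
- by cts.
- by apply: comp_cts; cts.
- by apply: comp_cts; cts.
- move=> t ->; rewrite mulfV ?pnatr_eq0 // subrr clamp_ge1 // clamp_le0 //.
  by rewrite path_one path_zero.
Qed.

Lemma concat0 x y z (p : pth x y) (q : pth y z) : concat_fun p q zero = x.
Proof. by rewrite /concat_fun val0 invr_ge0 ler0n mulr0 clamp_le0 // path_zero. Qed.

Lemma concat1 x y z (p : pth x y) (q : pth y z) : concat_fun p q one = z.
Proof.
rewrite /concat_fun val1 ifF; last by apply/negbTE; lra.
by rewrite clamp_ge1 ?path_one //; lra.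
Qed.

Definition concat x y z (p : pth x y) (q : pth y z) : pth x z :=
  mk_path (@concat_cts x y z p q) (concat0 p q) (concat1 p q).

Definition reverse_fun x y (p : pth x y) (t : I) : X :=
  p (clamp (1 - unitI_val t)).

Lemma reverse_cts x y (p : pth x y) : continuous (reverse_fun p).
Proof. by apply: comp_cts; cts. Qed.

Lemma reverse0 x y (p : pth x y) : reverse_fun p zero = y.
Proof. by rewrite /reverse_fun val0 subr0 clamp_ge1 // path_one. Qed.

Lemma reverse1 x y (p : pth x y) : reverse_fun p one = x.
Proof. by rewrite /reverse_fun val1 subrr clamp_le0 // path_zero. Qed.

Definition reverse x y (p : pth x y) : pth y x :=
  mk_path (@reverse_cts x y p) (reverse0 p) (reverse1 p).

Definition const_path (x : X) : pth x x :=
  mk_path (@cst_cts I X x) erefl erefl.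

Lemma homotopic_refl x y (p : pth x y) : homotopic p p.
Proof.
exists (fun st => p st.2); split=> //= [|s|s]; rewrite ?path_zero ?path_one //.
by apply: comp_cts; cts.
Qed.

Lemma homotopic_sym x y (p q : pth x y) : homotopic p q -> homotopic q p.
Proof.
case=> F [cF F0 F1 Fx Fy]; exists (fun st => F (clamp (1 - unitI_val st.1), st.2)).
split=> //= [|t|t]; first by apply: comp_cts; cts.
- by rewrite val0 subr0 clamp_ge1.
- by rewrite val1 subrr clamp_le0.
Qed.

Lemma homotopic_trans x y (p q r : pth x y) :
  homotopic p q -> homotopic q r -> homotopic p r.
Proof.
case=> F [cF F0 F1 Fx Fy] [G [cG G0 G1 Gx Gy]].
exists (fun st => if unitI_val st.1 <= 2^-1
  then F (clamp (2 * unitI_val st.1), st.2)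
  else G (clamp (2 * unitI_val st.1 - 1), st.2)); split=> /= [|t|t|s|s].
- apply: if_continuous; [by cts|by apply: comp_cts; cts|by apply: comp_cts; cts|].
  move=> [s t] /= ->; rewrite mulfV ?pnatr_eq0 // subrr clamp_ge1 // clamp_le0 //.
  by rewrite F1 G0.
- by rewrite val0 invr_ge0 ler0n mulr0 clamp_le0.
- rewrite val1 ifF; last by apply/negbTE; lra.
  by rewrite clamp_ge1 ?G1 //; lra.
- by case: ifP.
- by case: ifP.
Qed.

Lemma concat_homotopic x y z (p p' : pth x y) (q q' : pth y z) :
  homotopic p p' -> homotopic q q' -> homotopic (concat p q) (concat p' q').
Proof.
case=> F [cF F0 F1 Fx Fy] [G [cG G0 G1 Gx Gy]].
exists (fun st => if unitI_val st.2 <= 2^-1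
  then F (st.1, clamp (2 * unitI_val st.2))
  else G (st.1, clamp (2 * unitI_val st.2 - 1))); split=> /= [|t|t|s|s].
- apply: if_continuous; [by cts|by apply: comp_cts; cts|by apply: comp_cts; cts|].
  move=> [s t] /= ->; rewrite mulfV ?pnatr_eq0 // subrr clamp_ge1 // clamp_le0 //.
  by rewrite Fy Gx.
- by rewrite F0 G0.
- by rewrite F1 G1.
- by rewrite val0 invr_ge0 ler0n mulr0 clamp_le0.
- rewrite val1 ifF; last by apply/negbTE; lra.
  by rewrite clamp_ge1 ?Gy //; lra.
Qed.

Lemma reverse_homotopic x y (p p' : pth x y) :
  homotopic p p' -> homotopic (reverse p) (reverse p').
Proof.
case=> F [cF F0 F1 Fx Fy]; exists (fun st => F (st.1, clamp (1 - unitI_val st.2))).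
split=> /= [|t|t|s|s]; first by apply: comp_cts; cts.
- by rewrite F0.
- by rewrite F1.
- by rewrite val0 subr0 clamp_ge1.
- by rewrite val1 subrr clamp_le0.
Qed.

(* Two reparametrisations of the same curve with the same end parameters. *)
Lemma reparam_homotopic x y (p q : pth x y) (g : R -> X) (u v : I -> R) :
  continuous g -> continuous u -> continuous v ->
  (forall t, p t = g (u t)) -> (forall t, q t = g (v t)) ->
  u zero = v zero -> u one = v one -> homotopic p q.
Proof.
move=> cg cu cv pE qE uv0 uv1.
exists (fun st => g (u st.2 + unitI_val st.1 * (v st.2 - u st.2))).
split=> /= [|t|t|s|s].
- apply: comp_cts => //; apply: add_cts; first by apply: comp_cts; cts.
  by apply: mul_cts; [cts|apply: sub_cts; apply: comp_cts; cts].
- by rewrite val0 mul0r addr0 pE.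
- by rewrite val1 mul1r addrC subrK qE.
- by rewrite uv0 subrr mulr0 addr0 -qE path_zero.
- by rewrite uv1 subrr mulr0 addr0 -qE path_one.
Qed.

Lemma concatA x y z w (p : pth x y) (q : pth y z) (r : pth z w) :
  homotopic (concat p (concat q r)) (concat (concat p q) r).
Proof.
apply: (reparam_homotopic
  (g := fun u => if u <= 1 then p (clamp u)
                 else if u <= 2 then q (clamp (u - 1)) else r (clamp (u - 2)))
  (u := fun t => Num.max (2 * unitI_val t) (4 * unitI_val t - 1))
  (v := fun t => Num.min (4 * unitI_val t) (2 * unitI_val t + 1))).
- apply: if_continuous; [by move=> ?; exact: cvg_id|by apply: comp_cts; cts| |].
    apply: if_continuous; [by move=> ?; exact: cvg_id|..].
    + by apply: comp_cts; [cts|apply: comp_cts; [cts|apply: sub_cts; [move=> ?; exact: cvg_id|cts]]].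
    + by apply: comp_cts; [cts|apply: comp_cts; [cts|apply: sub_cts; [move=> ?; exact: cvg_id|cts]]].
    + move=> u ->; rewrite clamp_ge1 ?clamp_le0 ?path_one ?path_zero //; lra.
  move=> u ->; rewrite ifT ?ler1n // subrr clamp_ge1 ?clamp_le0 //.
  by rewrite path_one path_zero.
- by cts.
- by cts.
- move=> t /=; rewrite /mk_path /concat_fun /=.
  have := unitI_ge0 t; have := unitI_le1 t; set s := unitI_val t => s1 s0.
  case: (leP s 2^-1) => h.
    rewrite max_l; last lra.
    by rewrite ifT //; lra.
  rewrite max_r; last lra.
  rewrite [in RHS]ifF; last by apply/negbTE; lra.
  rewrite /mk_path /concat_fun clampE; last by apply/andP; split; lra.
  case: (leP (2 * s - 1) 2^-1) => h2.
    by rewrite ifT; [congr (q (clamp _)); ring|lra].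
  rewrite ifF; last by apply/negbTE; lra.
  by congr (r (clamp _)); ring.
- move=> t /=; rewrite /mk_path /concat_fun /=.
  have := unitI_ge0 t; have := unitI_le1 t; set s := unitI_val t => s1 s0.
  case: (leP s 2^-1) => h.
    rewrite min_l; last lra.
    rewrite /mk_path /concat_fun clampE; last by apply/andP; split; lra.
    case: (leP (2 * s) 2^-1) => h2.
      by rewrite ifT; [congr (p (clamp _)); ring|lra].
    rewrite ifF; last by apply/negbTE; lra.
    by rewrite ifT; [congr (q (clamp _)); ring|lra].
  rewrite min_r; last lra.
  rewrite ifF; last by apply/negbTE; lra.
  rewrite ifF; last by apply/negbTE; lra.
  by congr (r (clamp _)); ring.
- by rewrite val0 max_l ?min_l //; lra.
- by rewrite val1 max_r ?min_r //; lra.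
Qed.

Lemma concat1p x y (p : pth x y) : homotopic (concat (const_path x) p) p.
Proof.
apply: (reparam_homotopic (g := fun u => p (clamp u))
  (u := fun t => Num.max 0 (2 * unitI_val t - 1)) (v := unitI_val)).
- by apply: comp_cts; cts.
- by cts.
- by cts.
- move=> t /=; rewrite /mk_path /concat_fun /=; case: ifPn => h.
    by rewrite max_l ?[in RHS]clamp_le0 ?path_zero //; lra.
  by rewrite max_r //; lra.
- by move=> t; rewrite clampK.
- by rewrite val0 max_l //; lra.
- by rewrite val1 max_r //; lra.
Qed.

Lemma concatp1 x y (p : pth x y) : homotopic (concat p (const_path y)) p.
Proof.
apply: (reparam_homotopic (g := fun u => p (clamp u))
  (u := fun t => Num.min (2 * unitI_val t) 1) (v := unitI_val)).
- by apply: comp_cts; cts.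
- by cts.
- by cts.
- move=> t /=; rewrite /mk_path /concat_fun /=; case: ifPn => h.
    by rewrite min_l //; lra.
  by rewrite min_r ?[in RHS]clamp_ge1 ?path_one //; lra.
- by move=> t; rewrite clampK.
- by rewrite val0 min_l //; lra.
- by rewrite val1 min_r //; lra.
Qed.

Lemma concatpV x y (p : pth x y) :
  homotopic (concat p (reverse p)) (const_path x).
Proof.
apply: (reparam_homotopic (g := fun u => p (clamp u))
  (u := fun t => Num.min (2 * unitI_val t) (2 - 2 * unitI_val t))
  (v := fun=> 0)).
- by apply: comp_cts; cts.
- by cts.
- by cts.
- move=> t /=; rewrite /mk_path /concat_fun /=.
  have := unitI_ge0 t; have := unitI_le1 t; set s := unitI_val t => s1 s0.
  case: (leP s 2^-1) => h; first by rewrite min_l //; lra.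
  rewrite /mk_path /reverse_fun clampE; last by apply/andP; split; lra.
  by rewrite min_r; [congr (p (clamp _)); ring|lra].
- by move=> t; rewrite clamp_le0 // path_zero.
- by rewrite val0 min_l //; lra.
- by rewrite val1 min_r //; lra.
Qed.

Lemma reverseK x y (p : pth x y) : reverse (reverse p) = p.
Proof.
apply/path_eqP => t; rewrite /= /mk_path /reverse_fun /= /mk_path /reverse_fun.
have := unitI_ge0 t; have := unitI_le1 t => t1 t0.
rewrite (@clampE _ (1 - unitI_val t)); last by apply/andP; split; lra.
by rewrite opprB addrC subrK clampK.
Qed.

Lemma concatVp x y (p : pth x y) :
  homotopic (concat (reverse p) p) (const_path y).
Proof. by rewrite -{2}(reverseK p); exact: concatpV. Qed.

End paths.

Section fundamental_group.
Variables (R : realType) (X : topologicalType) (x : X).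
Local Notation loop := {path (unitI R) from x to x in X}.

Definition homotopic_rel (p q : loop) : bool := `[< homotopic p q >].

Lemma homotopic_rel_refl : reflexive homotopic_rel.
Proof. by move=> p; apply/asboolP; exact: homotopic_refl. Qed.

Lemma homotopic_rel_sym : symmetric homotopic_rel.
Proof. by move=> p q; apply/asboolP/asboolP; exact: homotopic_sym. Qed.

Lemma homotopic_rel_trans : transitive homotopic_rel.
Proof.
move=> q p r /asboolP pq /asboolP qr; apply/asboolP.
exact: homotopic_trans pq qr.
Qed.

Canonical homotopic_equiv := EquivRel homotopic_rel
  homotopic_rel_refl homotopic_rel_sym homotopic_rel_trans.

Definition pi1 : Type := {eq_quot homotopic_equiv}.
HB.instance Definition _ := Choice.on pi1.
HB.instance Definition _ := Quotient.on pi1.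

Definition pi1_class (p : loop) : pi1 := \pi p.

Lemma pi1_classP (p q : loop) : pi1_class p = pi1_class q <-> homotopic p q.
Proof. by split=> [/eqmodP/asboolP|pq]; last by apply/eqmodP/asboolP. Qed.

Lemma pi1_reprK (a : pi1) : pi1_class (repr a) = a.
Proof. exact: reprK. Qed.

Definition pi1_mul (a b : pi1) := pi1_class (concat (repr a) (repr b)).
Definition pi1_inv (a : pi1) := pi1_class (reverse (repr a)).
Definition pi1_one := pi1_class (const_path R x).

Lemma pi1_class_mul p q :
  pi1_mul (pi1_class p) (pi1_class q) = pi1_class (concat p q).
Proof.
by apply/pi1_classP/concat_homotopic; apply/pi1_classP; rewrite pi1_reprK.
Qed.

Lemma pi1_class_inv p : pi1_inv (pi1_class p) = pi1_class (reverse p).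
Proof. by apply/pi1_classP/reverse_homotopic/pi1_classP; rewrite pi1_reprK. Qed.

Lemma pi1_mulA : associative pi1_mul.
Proof.
move=> a b c; rewrite -(pi1_reprK a) -(pi1_reprK b) -(pi1_reprK c).
by rewrite !pi1_class_mul; apply/pi1_classP/concatA.
Qed.

Lemma pi1_mul1 : left_id pi1_one pi1_mul.
Proof.
by move=> a; rewrite -(pi1_reprK a) pi1_class_mul; apply/pi1_classP/concat1p.
Qed.

Lemma pi1_mulr1 : right_id pi1_one pi1_mul.
Proof.
by move=> a; rewrite -(pi1_reprK a) pi1_class_mul; apply/pi1_classP/concatp1.
Qed.

Lemma pi1_mulV : left_inverse pi1_one pi1_inv pi1_mul.
Proof.
move=> a; rewrite -(pi1_reprK a) pi1_class_inv pi1_class_mul.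
by apply/pi1_classP/concatVp.
Qed.

Lemma pi1_mulrV : right_inverse pi1_one pi1_inv pi1_mul.
Proof.
move=> a; rewrite -(pi1_reprK a) pi1_class_inv pi1_class_mul.
by apply/pi1_classP/concatpV.
Qed.

HB.instance Definition _ := isGroup.Build pi1
  pi1_mulA pi1_mul1 pi1_mulr1 pi1_mulV pi1_mulrV.

End fundamental_group.
Arguments pi1_class {R X x}.

Section induced_map.
Variables (R : realType) (X Y : topologicalType).
Variables (f : continuousType X Y) (x : X).

Definition pi1_map (a : pi1 R x) : pi1 R (f x) :=
  pi1_class (f \o repr a : {path (unitI R) from f x to f x in Y}).

Lemma pi1_map_class (p : {path (unitI R) from x to x in X}) :
  pi1_map (pi1_class p) =
  pi1_class (f \o p : {path (unitI R) from f x to f x in Y}).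
Proof.
have /pi1_classP[F [cF F0 F1 Fx Fy]] := pi1_reprK (pi1_class p).
apply/pi1_classP; exists (f \o F); split=> //= [|t|t|s|s].
- by move=> z; apply: continuous_comp; [exact: cF|exact: cts_fun].
- by rewrite F0.
- by rewrite F1.
- by rewrite Fx.
- by rewrite Fy.
Qed.

Lemma pi1_mapM : {morph pi1_map : a b / (a * b)%g}.
Proof.
move=> a b; rewrite -(pi1_reprK a) -(pi1_reprK b).
rewrite [(_ * _)%g]pi1_class_mul !pi1_map_class [RHS]pi1_class_mul.
congr pi1_class; apply/path_eqP => t /=.
by rewrite /mk_path /concat_fun /=; case: ifP.
Qed.

End induced_map.

Section characters.
Variable R : realType.

(* Hom(G, C^* ) *)
Record character (G : groupType) := Character {
  character_fun :> G -> R[i];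
  characterM : {morph character_fun : a b / (a * b)%g >-> a * b};
  character_neq0 : forall a, character_fun a != 0
}.

Lemma character_exp_subproofM (G : groupType) (chi : character G) k :
  {morph (fun a => chi a ^+ k) : a b / (a * b)%g >-> a * b}.
Proof. by move=> a b; rewrite /= characterM exprMn. Qed.

Lemma character_exp_subproof0 (G : groupType) (chi : character G) k a :
  chi a ^+ k != 0.
Proof. by rewrite expf_neq0 // character_neq0. Qed.

Definition character_exp (G : groupType) (chi : character G) (k : nat) :
    character G :=
  Character (character_exp_subproofM chi k) (character_exp_subproof0 chi k).

Variables (X Y : topologicalType) (f : continuousType X Y) (x : X).

Lemma pullback_subproofM (chi : character (pi1 R (f x))) :
  {morph (fun a => chi (pi1_map f a)) : a b / (a * b)%g >-> a * b}.
Proof. by move=> a b; rewrite /= pi1_mapM characterM. Qed.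

Definition pullback (chi : character (pi1 R (f x))) : character (pi1 R x) :=
  Character (pullback_subproofM chi) (fun a => character_neq0 chi _).

End characters.

(* R[i] seen as an abstract numClosedFieldType, which is how it acquires the
   topology of numFieldNormedType. *)
Definition CC (R : realType) : numClosedFieldType := R[i].

(* exp(i t) *)
Definition expi (R : realType) (t : R) : CC R := (cos t +i* sin t)%C.

Section projectivization.
Variables (R : realType) (l : nat) (V : set 'rV[CC R]_l).

Definition collinear (x y : V) : bool :=
  `[< exists2 c : CC R, c != 0 & set_val y = c *: set_val x >].

Lemma collinear_refl : reflexive collinear.
Proof. by move=> x; apply/asboolP; exists 1; rewrite ?oner_neq0 ?scale1r. Qed.

Lemma collinear_sym : symmetric collinear.
Proof.
suff H x y : collinear x y -> collinear y x by move=> x y; apply/idP/idP; exact: H.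
case/asboolP=> c c0 yE; apply/asboolP; exists c^-1; first by rewrite invr_neq0.
by rewrite yE scalerK.
Qed.

Lemma collinear_trans : transitive collinear.
Proof.
move=> y x z /asboolP[c c0 yE] /asboolP[d d0 zE]; apply/asboolP.
by exists (d * c); rewrite ?mulf_neq0 // zE yE scalerA.
Qed.

Canonical collinear_equiv :=
  EquivRel collinear collinear_refl collinear_sym collinear_trans.

(* The quotient of [V] by the relation of being nonzero multiples of each
   other; for a conical open [V] not containing 0 this is P(V). *)
Definition Proj : topologicalType :=
  quotient_topology {eq_quot collinear_equiv}.

Definition to_Proj (x : V) : Proj :=
  \pi_(quotient_topology {eq_quot collinear_equiv}) x.

Definition Proj_repr (p : Proj) : V :=
  @repr _ (quotient_topology {eq_quot collinear_equiv}) p.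

(* homogeneous coordinates *)
Definition hcoord (p : Proj) : 'rV[CC R]_l := set_val (Proj_repr p).

Lemma Proj_reprK p : to_Proj (Proj_repr p) = p.
Proof. exact: reprK. Qed.

Lemma projP x y :
  to_Proj x = to_Proj y <-> exists2 c : CC R, c != 0 & set_val y = c *: set_val x.
Proof.
by split=> [/eqmodP/asboolP|xy]; last by apply/eqmodP/asboolP.
Qed.

Lemma to_Proj_continuous : continuous to_Proj.
Proof. exact: pi_continuous. Qed.

HB.instance Definition _ := isContinuous.Build _ _ to_Proj to_Proj_continuous.

End projectivization.

Definition CP1 (R : realType) := Proj [set y : 'rV[CC R]_2 | y != 0].

Section arrangements.
Variables (R : realType) (l n : nat).
Local Notation C := (CC R).

(* A central arrangement of n distinct hyperplanes ker f_H in C^l. *)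
Record arrangement := Arrangement {
  form : 'I_n -> 'Hom('rV[C]_l, C^o);
  form_neq0 : forall H, form H != 0%VF;
  hyperplane_inj : injective (fun H => lker (form H))
}.

Variable A : arrangement.

Definition hyperplane (H : 'I_n) : {vspace 'rV[C]_l} := lker (form A H).

Definition formv (H : 'I_n) (x : 'rV[C]_l) : C := form A H x.

Definition complement : set 'rV[C]_l := [set x | forall H, x \notin hyperplane H].

Definition proj_complement : topologicalType := Proj complement.

Definition flats2 : set {vspace 'rV[C]_l} :=
  [set X | (exists B : {set 'I_n}, X = (\bigcap_(H in B) hyperplane H)%VS) /\
           (\dim X + 2 = l)%N].

(* The elements of pi_1(M, x0) represented by a path from x0 to a point y + v
   near the generic point y of H, followed by the positively oriented circle
   t |-> y + exp(2 i pi t) v in a disc meeting the arrangement only at its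
   centre y on H, and then by the same path backwards. *)
Definition meridian (H : 'I_n) (x0 : complement) : set (pi1 R x0) :=
  [set g | exists (y v : 'rV[C]_l) (b : complement)
      (a : {path (unitI R) from x0 to b in complement})
      (c : {path (unitI R) from b to b in complement}),
    [/\ y \in hyperplane H,
        forall (z : C) (H' : 'I_n), `|z| <= 1 ->
          y + z *: v \in hyperplane H' -> H' = H /\ z = 0,
        forall t : unitI R, set_val (c t) =
          y + expi (2 * pi * unitI_val t) *: v &
        g = pi1_class (concat (concat a c) (reverse a))]].

Definition is_diagonal (x0 : complement)
    (rho : character R (pi1 R (to_Proj x0 : proj_complement))) : Prop :=
  forall H (g : pi1 R x0), meridian H g ->
    rho (pi1_map (@to_Proj R l complement) g) =
      expi (2 * pi / n%:R).

(* The classes are the fibres of mclass, and class_connected is stated with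
   connect for the relation of lying in the class of H and meeting outside the
   base locus. *)
Record multinet (k : nat) := Multinet {
  mclass : 'I_n -> 'I_k;
  mult : 'I_n -> nat;
  base_locus : set {vspace 'rV[C]_l};
  degree : nat;
  multinet_ge3 : (3 <= k)%N;
  class_nonempty : forall i, exists H, mclass H = i;
  mult_gt0 : forall H, (0 < mult H)%N;
  base_locus_sub : base_locus `<=` flats2;
  degreeE : forall i, (\sum_(H | mclass H == i) mult H)%N = degree;
  base_locusI : forall H H', mclass H != mclass H' ->
    base_locus (hyperplane H :&: hyperplane H')%VS;
  base_multE : forall X, base_locus X -> forall i j,
    (\sum_(H | (mclass H == i) && (X <= hyperplane H)%VS) mult H =
     \sum_(H | (mclass H == j) && (X <= hyperplane H)%VS) mult H)%N;
  class_connected : forall H H', mclass H = mclass H' ->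
    connect (fun H1 H2 => [&& mclass H1 == mclass H, mclass H2 == mclass H &
      (hyperplane H1 :&: hyperplane H2)%VS \notin base_locus]) H H'
}.

Definition reduced k (N : multinet k) : Prop := forall H, mult N H = 1%N.

Definition pencil_member k (N : multinet k) (i : 'I_k) (x : 'rV[C]_l) : C :=
  \prod_(H | mclass N H == i) formv H x ^+ mult N H.

Lemma addC_cts (Z : topologicalType) (f g : Z -> C) :
  continuous f -> continuous g -> continuous (fun z => f z + g z).
Proof. by move=> cf cg z; apply: cvgD; [exact: cf|exact: cg]. Qed.

Lemma mulC_cts (Z : topologicalType) (f g : Z -> C) :
  continuous f -> continuous g -> continuous (fun z => f z * g z).
Proof. by move=> cf cg z; apply: cvgM; [exact: cf|exact: cg]. Qed.

Lemma row_cts (Z : topologicalType) m (f : Z -> 'rV[C]_m) :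
  (forall j, continuous (fun z => f z ord0 j)) -> continuous f.
Proof.
move=> cf z U [P zP PU]; rewrite nbhs_simpl /=.
have H : \forall z' \near z, forall j, P ord0 j (f z' ord0 j).
  by apply: filter_forall => j; apply: (cf j z); exact: zP.
by apply: filterS H => z' Hz'; apply: PU => i j; rewrite ord1.
Qed.

Lemma formv_continuous H : continuous (formv H).
Proof.
have -> : formv H = fun x : 'rV[C]_l => \sum_j x ord0 j * formv H (delta_mx 0 j).
  apply/funext => x; rewrite /formv {1}(row_sum_delta x) linear_sum.
  by apply: eq_bigr => j _; rewrite linearZ.
elim: (index_enum _) => [|j s IHs].
  rewrite (_ : (fun _ => _) = cst 0); first exact: cst_continuous.
  by apply/funext => x; rewrite big_nil.
rewrite (_ : (fun _ => _) = fun x : 'rV[C]_l => x ord0 j * formv H (delta_mx 0 j)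
    + \sum_(j <- s) x ord0 j * formv H (delta_mx 0 j)).
  apply: addC_cts; last exact: IHs.
  by apply: mulC_cts; [exact: coord_continuous|exact: cst_cts].
by apply/funext => x; rewrite big_cons.
Qed.

Lemma member_continuous k (N : multinet k) i : continuous (pencil_member N i).
Proof.
rewrite /pencil_member; elim: (index_enum _) => [|H s IHs].
  rewrite (_ : (fun _ => _) = cst 1); first exact: cst_continuous.
  by apply/funext => x; rewrite big_nil.
case: (boolP (mclass N H == i)) => Hi; last first.
  by under [fun _ => _]eq_fun => x do rewrite big_cons (negbTE Hi).
under [fun _ => _]eq_fun => x do rewrite big_cons Hi.
apply: mulC_cts; last exact: IHs.
elim: (mult N H) => [|m IHm]; first exact: cst_cts.
under [fun _ => _]eq_fun => z do rewrite exprS.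
by apply: mulC_cts; [exact: formv_continuous|exact: IHm].
Qed.

Lemma memberZ k (N : multinet k) i (c : C) x :
  pencil_member N i (c *: x) = c ^+ degree N * pencil_member N i x.
Proof.
rewrite -(degreeE N i) expr_sum -big_split; apply: eq_bigr => H _ /=.
by rewrite /formv linearZ exprMn.
Qed.

Lemma member_neq0 k (N : multinet k) i (x : complement) :
  pencil_member N i (set_val x) != 0.
Proof.
apply/prodf_neq0 => H _; rewrite expf_neq0 //.
have /= := set_mem (valP x); rewrite -set_valE => /(_ H).
by rewrite memv_ker.
Qed.

Section pencil.
Variable N : multinet 3.

(* The point [a : b] of the target of [C_1 : C_2] over which the fibre is the
   zero locus of C_i, i.e. such that b C_1 - a C_2 is a nonzero multiple of C_i. *)
Definition member_point (i : 'I_3) : set (CP1 R) :=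
  [set p | exists2 c : C, c != 0 & forall x,
    hcoord p ord0 1 * pencil_member N 0 x
      - hcoord p ord0 0 * pencil_member N 1 x = c * pencil_member N i x].

Definition pencil_target : set (CP1 R) := ~` \bigcup_i member_point i.

Definition pencil_row (x : 'rV[C]_l) : 'rV[C]_2 :=
  \row_j if j == 0 then pencil_member N 0 x else pencil_member N 1 x.

Lemma pencil_row_neq0 (x : complement) :
  pencil_row (set_val x) \in [set y : 'rV[C]_2 | y != 0].
Proof.
apply/mem_set => /=; apply/eqP => /rowP/(_ 0); rewrite !mxE eqxx.
by move/eqP; rewrite (negbTE (member_neq0 _ _ _)).
Qed.

Definition pencil_vec (x : complement) : [set y : 'rV[C]_2 | y != 0] :=
  exist (fun y => y \in [set y : 'rV[C]_2 | y != 0]) _ (pencil_row_neq0 x).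

Lemma pencil_point_target (x : complement) : to_Proj (pencil_vec x) \in pencil_target.
Proof.
apply/mem_set => -[i _ [c c0 /(_ (set_val x)) E]].
have /projP[d d0] := Proj_reprK (to_Proj (pencil_vec x)).
move=> xE; have := member_neq0 N i x.
have E0 : hcoord (to_Proj (pencil_vec x)) = d^-1 *: pencil_row (set_val x).
  have -> : pencil_row (set_val x) = d *: hcoord (to_Proj (pencil_vec x)) by exact: xE.
  by rewrite scalerK.
suff /eqP : c * pencil_member N i (set_val x) = 0 by rewrite mulf_eq0 (negbTE c0) /= => ->.
by rewrite -E E0 !mxE /=; ring.
Qed.

Definition pencil_map_lift (x : complement) : pencil_target :=
  exist (fun p => p \in pencil_target) _ (pencil_point_target x).

Lemma pencil_map_lift_continuous : continuous pencil_map_lift.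
Proof.
apply: continuous_comp_initial.
rewrite (_ : _ \o _ = @to_Proj R 2 [set y | y != 0] \o pencil_vec) //.
move=> x; apply: continuous_comp; last exact: to_Proj_continuous.
move: x; apply: continuous_comp_initial.
apply: row_cts => j.
rewrite (_ : (fun _ => _) =
    pencil_member N (if j == 0 then 0 else 1) \o (set_val : complement -> 'rV[C]_l)).
  move=> x; apply: continuous_comp; last exact: member_continuous.
  exact: initial_continuous.
by apply/funext => x; rewrite /= mxE; case: ifP.
Qed.

Definition pencil_map (u : proj_complement) : pencil_target :=
  pencil_map_lift (Proj_repr u).

Lemma pencil_map_proj (x : complement) :
  pencil_map (to_Proj x) = pencil_map_lift x.
Proof.
apply/val_inj => /=.
have /projP[c c0 xE] := Proj_reprK (to_Proj x : proj_complement).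
apply/projP; exists (c ^+ degree N); first by rewrite expf_neq0.
by apply/rowP => j; rewrite !mxE /= !xE !memberZ; case: ifP.
Qed.

Lemma pencil_map_continuous : continuous pencil_map.
Proof.
apply/quotient_continuous.
rewrite (_ : _ \o _ = pencil_map_lift); first exact: pencil_map_lift_continuous.
by apply/funext => x; exact: pencil_map_proj.
Qed.

HB.instance Definition _ := isContinuous.Build proj_complement pencil_target
  pencil_map pencil_map_continuous.

(* T_N = f_N^*(H^1(S; C^* )) *)
Definition pencil_component (u : proj_complement) : set (character R (pi1 R u)) :=
  range (pullback (f := pencil_map) (x := u)).

End pencil.
End arrangements.
Arguments pencil_component {R l n A} N u.

(* Main.v *)
(* Let M be the complement, C_1, C_2, C_3 the members of the pencil and L_1, L_2,
   L_3 the linear forms on C^2 vanishing at the three points removed from CP^1,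
   so that L_i pulls back to C_i. The function h = L_1 L_2 / L_3^2 has no zeros
   on S, and psi = exp(2 i pi wind(h) / 3) is a character of pi_1(S). On M it
   becomes a character depending on the winding of C_1 C_2 / C_3^2, which is 1 or
   -2 on a meridian; as the multinet is reduced, both give exp(2 i pi / 3), the
   value of rho_n^(n/3). Hence psi pulls back to rho_n^(n/3), given three facts.

   1. The form L_3 exists, i.e. C_3 is a combination of C_1 and C_2. On a
   hyperplane H of the third class, C_1 and C_2 restrict to products of the same
   linear forms, so C_1 = c_H C_2 on H; c_H does not depend on H because the
   class is connected outside the base locus; and C_1 - c C_2, which vanishes on
   the third class, is then a multiple of C_3.

   2. A character of pi_1(M) is determined by its values on meridians. Put
   g_H = f_H / f_H(x0) and cut M along the sets g_H <= 0: what remains is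
   star-shaped about x0, so a character that is trivial on meridians yields a
   multiplicative function of the paths with ends off the cuts, trivial on the
   paths avoiding the cuts. It is trivial on a path crossing a single cut, which
   completes to a meridian in the complex line directed by x0, hence on short
   segments, which can be moved to cross the cuts one at a time, hence on all
   paths, by continuation.

   3. pi_1(M) -> pi_1(U) is onto: x -> x f_H(x0) / f_H(x) defines a section of
   M -> U. *)

Require Import Defs.
From HB Require Import structures.
From mathcomp Require Import all_boot all_order all_algebra generic_quotient.
From mathcomp Require Import all_classical all_reals all_analysis.
From mathcomp Require Import homotopy.
From mathcomp Require Import complex ring lra zify.
Import numFieldNormedType.Exports.
Set Implicit Arguments. Unset Strict Implicit. Unset Printing Implicit Defensive.
Import Order.TTheory GRing.Theory Num.Theory.
Local Open Scope classical_set_scope.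
Local Open Scope quotient_scope.
Local Open Scope ring_scope.

Local Notation Re := (@complex.Re _).
Local Notation Im := (@complex.Im _).

(** * Winding of paths in the punctured plane *)

Section complex_continuity.
Variable R : realType.
Local Notation C := (CC R).
Implicit Types (z w : C) (t : R).

Definition rc t : C := (t%:C)%C.

Lemma rcD : {morph rc : a b / a + b}. Proof. exact: rmorphD. Qed.
Lemma rcB : {morph rc : a b / a - b}. Proof. exact: rmorphB. Qed.
Lemma rc0 : rc 0 = 0. Proof. by []. Qed.
Lemma rc1 : rc 1 = 1. Proof. by []. Qed.

Lemma ReD z w : Re (z + w) = Re z + Re w. Proof. by case: z; case: w. Qed.
Lemma ImD z w : Im (z + w) = Im z + Im w. Proof. by case: z; case: w. Qed.
Lemma ReN z : Re (- z) = - Re z. Proof. by case: z. Qed.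
Lemma ImN z : Im (- z) = - Im z. Proof. by case: z. Qed.
Lemma ReMr t z : Re (rc t * z) = t * Re z.
Proof. by case: z => a b /=; rewrite mul0r subr0. Qed.
Lemma ImMr t z : Im (rc t * z) = t * Im z.
Proof. by case: z => a b /=; rewrite mul0r addr0. Qed.

Lemma eqC z w : Re z = Re w -> Im z = Im w -> z = w.
Proof. by case: z => a b; case: w => c d /= -> ->. Qed.

Lemma gt0_rc (e : C) : 0 < e -> exists2 d : R, 0 < d & e = rc d.
Proof.
by case: e => a b; rewrite ltcE /= => /andP[/eqP -> a0]; exists a.
Qed.

Lemma rc_continuous : continuous rc.
Proof.
move=> x; apply/cvg_ballP => e /gt0_rc[d d0 ->].
apply: (@filterS _ (nbhs x) _ _ _ _ (nbhsx_ballx x d d0)) => y.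
by rewrite /ball /= -rcB normc_def /= expr0n addr0 sqrtr_sqr ltcR.
Qed.

Lemma rc_cts (Z : topologicalType) (f : Z -> R) :
  continuous f -> continuous (fun x => rc (f x)).
Proof. by move=> cf; apply: comp_cts cf; exact: rc_continuous. Qed.

Lemma normc_ge_Im z : rc `|Im z| <= `|z|.
Proof.
by rewrite normc_def lecR -sqrtr_sqr ler_wsqrtr // lerDr sqr_ge0.
Qed.

Lemma Re_continuous : continuous (fun z => Re z).
Proof.
move=> x A /nbhs_ballP[e /= e0 eA]; apply/nbhs_ballP.
exists (rc e); rewrite /= ?ltcR // => y; rewrite /ball /= => xy; apply: eA.
rewrite /ball /= -ltcR; apply: le_lt_trans xy.
by rewrite -ReN -ReD; exact: normc_ge_Re.
Qed.

Lemma Im_continuous : continuous (fun z => Im z).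
Proof.
move=> x A /nbhs_ballP[e /= e0 eA]; apply/nbhs_ballP.
exists (rc e); rewrite /= ?ltcR // => y; rewrite /ball /= => xy; apply: eA.
rewrite /ball /= -ltcR; apply: le_lt_trans xy.
by rewrite -ImN -ImD; exact: normc_ge_Im.
Qed.

Lemma cplx_cts (Z : topologicalType) (f g : Z -> R) :
  continuous f -> continuous g -> continuous (fun x => (f x +i* g x)%C : C).
Proof.
move=> cf cg.
rewrite (_ : (fun _ => _) = fun x => rc (f x) + rc (g x) * 'i%C).
  by apply: addC_cts; [exact: rc_cts|apply: mulC_cts; [exact: rc_cts|exact: cst_cts]].
by apply/funext => x; apply: eqC; rewrite ?ReD ?ImD ?ReMr ?ImMr /= ?mulr0 ?mulr1 ?addr0 ?add0r.
Qed.

Lemma Re_cts (Z : topologicalType) (f : Z -> C) :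
  continuous f -> continuous (fun x => Re (f x)).
Proof. by move=> cf; apply: comp_cts cf; exact: Re_continuous. Qed.

Lemma Im_cts (Z : topologicalType) (f : Z -> C) :
  continuous f -> continuous (fun x => Im (f x)).
Proof. by move=> cf; apply: comp_cts cf; exact: Im_continuous. Qed.

Lemma opp_cts (Z : topologicalType) (f : Z -> R) :
  continuous f -> continuous (fun x => - f x).
Proof. by move=> cf x; apply: cvgN; exact: cf. Qed.

Lemma conj_cts (Z : topologicalType) (f : Z -> C) :
  continuous f -> continuous (fun x => (conjc (f x)) : C).
Proof.
move=> cf; rewrite (_ : (fun _ => _) = fun x => (Re (f x) +i* - Im (f x))%C : C).
  by apply: cplx_cts; [exact: Re_cts|apply: opp_cts; exact: Im_cts].
by apply/funext => x; case: (f x).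
Qed.

Lemma expi_cts (Z : topologicalType) (f : Z -> R) :
  continuous f -> continuous (fun x => expi (f x)).
Proof.
move=> cf; apply: cplx_cts; apply: comp_cts cf => x.
- exact: continuous_cos.
- exact: continuous_sin.
Qed.

Lemma inv_cts (Z : topologicalType) (f : Z -> C) :
  (forall x, f x != 0) -> continuous f -> continuous (fun x => (f x)^-1).
Proof. by move=> f0 cf x; apply: cvgV => //; exact: cf. Qed.

Lemma expiD a b : expi (a + b) = expi a * expi b :> C.
Proof. by apply: eqC => /=; rewrite ?cosD ?sinD // addrC [cos a * sin b]mulrC. Qed.

Lemma expi0 : expi 0 = 1 :> C.
Proof. by apply: eqC; rewrite /= ?cos0 ?sin0. Qed.

Lemma expi_neq0 a : expi a != 0 :> C.
Proof.
apply/eqP => e; have : expi a * expi (- a) = 1 :> C by rewrite -expiD subrr expi0.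
by rewrite e mul0r => /eqP; rewrite eq_sym oner_eq0.
Qed.

Lemma expiN a : expi (- a) = (expi a)^-1 :> C.
Proof.
apply: (mulIf (expi_neq0 a)).
by rewrite mulVf ?expi_neq0 // -expiD addNr expi0.
Qed.

Lemma expiMn a k : expi (a *+ k) = expi a ^+ k :> C.
Proof. by elim: k => [|k IH]; rewrite ?mulr0n ?expi0 // mulrS exprS expiD IH. Qed.

Lemma norm_expi a : `|expi a| = 1 :> C.
Proof. by rewrite normc_def /= cos2Dsin2 sqrtr1. Qed.

Lemma expi_2pi : expi (2 * pi) = 1 :> C.
Proof. by apply: eqC; rewrite /= mulr_natl ?cos2pi ?sin2pi. Qed.

(** Such a function takes values in 2 pi Z. If its end values differed, the intermediate value
    theorem would give a value at distance [d] from [f 0] with 0 < [d] <= pi, where the cosine is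
    less than 1. *)
Lemma expi_eq1_cst (f : R -> R) : continuous f ->
  (forall t, expi (f t) = 1 :> C) -> f 0 = f 1.
Proof.
move=> cf f1; apply/eqP/negPn/negP => f01.
pose d := Num.min (`|f 1 - f 0|) pi.
have d0 : 0 < d by rewrite lt_min normr_gt0 subr_eq0 eq_sym f01 pi_gt0.
have dpi : d <= pi by rewrite ge_min lexx orbT.
have key v : v = f 0 + d \/ v = f 0 - d ->
    Num.min (f 0) (f 1) <= v <= Num.max (f 0) (f 1) -> False.
  move=> vE /(IVT ler01 (continuous_subspaceT cf))[c _ cv].
  have := f1 c; rewrite cv => E.
  have {}E : cos d = 1.
    have E0 := f1 0.
    have : expi (v - f 0) = 1 :> C by rewrite expiD expiN E E0 invr1 mulr1.
    case: vE => ->; rewrite addrAC subrr add0r => /(congr1 Re) //=.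
    by rewrite cosN.
  have : cos d < cos 0 by rewrite ltr_cos // in_itv /= ?lexx ?pi_ge0 // ltW.
  by rewrite E cos0 ltxx.
have dl : d <= `|f 1 - f 0| by rewrite ge_min lexx.
case: (leP (f 0) (f 1)) => h.
- apply: (key (f 0 + d)); first by left.
  rewrite min_l // max_r // lerDl ltW //= -lerBrDl.
  by rewrite ger0_norm ?subr_ge0 in dl.
- apply: (key (f 0 - d)); first by right.
  rewrite min_r ?max_l ?(ltW h) //; rewrite ltr0_norm ?subr_lt0 // in dl.
  by apply/andP; split; lra.
Qed.

End complex_continuity.

(** * Continuous arguments and the total turn of a path *)

Section winding.
Variable R : realType.
Local Notation C := (CC R).
Local Notation I := (unitI R).

Definition dir (z : C) : C := z / `|z|.

Lemma dirM z w : dir (z * w) = dir z * dir w.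
Proof. by rewrite /dir normrM invfM mulrACA. Qed.

Lemma dir_neq0 z : z != 0 -> dir z != 0.
Proof. by move=> z0; rewrite mulf_neq0 // invr_eq0 normr_eq0. Qed.

Lemma dir_pos (z : C) : 0 < z -> dir z = 1.
Proof. by move=> z0; rewrite /dir gtr0_norm // divff // gt_eqF. Qed.

Lemma dir_conj (z : C) : z != 0 -> dir (conjc z) = (dir z)^-1.
Proof.
move=> z0; rewrite /dir normcJ.
have n0 : `|z| != 0 by rewrite normr_eq0.
apply: (mulIf (x := z / `|z|)); first by rewrite mulf_neq0 ?invr_eq0.
rewrite mulVf ?mulf_neq0 ?invr_eq0 //.
rewrite mulrACA [conjc z * z]mulrC -(@sqr_normc R z) expr2.
by rewrite mulrACA divff // mulr1.
Qed.

(** A continuous argument on the half-plane Re > 0, to which its uses are confined. *)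
Definition carg (z : C) : R := atan (Im z / Re z).

Lemma carg_expi (z : C) : 0 < Re z -> dir z = expi (carg z).
Proof.
case: z => a b /= a0; set z := (a +i* b)%C.
have a1 : a != 0 by rewrite gt_eqF.
have n0 : Num.sqrt (a ^+ 2 + b ^+ 2) != 0.
  by rewrite gt_eqF // sqrtr_gt0 ltr_wpDr ?sqr_ge0 // exprn_gt0.
have cE : cos (carg z) = a / Num.sqrt (a ^+ 2 + b ^+ 2).
  rewrite cos_atan /=.
  rewrite (_ : 1 + (b / a) ^+ 2 = (a ^+ 2 + b ^+ 2) * (a^-1) ^+ 2); last first.
    by field.
  rewrite sqrtrM ?addr_ge0 ?sqr_ge0 // sqrtr_sqr ger0_norm ?invr_ge0 ?ltW //.
  by rewrite invfM invrK mulrC.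
have sE : sin (carg z) = b / Num.sqrt (a ^+ 2 + b ^+ 2).
  have c0 : cos (carg z) != 0.
    by rewrite cE mulf_neq0 ?invr_eq0.
  have := atanK (b / a); rewrite -/(carg z) /tan => /(canRL (mulfVK c0)) ->.
  by rewrite cE mulrA divfK.
rewrite /dir /expi cE sE normc_def /=.
set s := Num.sqrt _ in n0 *.
rewrite -[(s%:C)%C]/(rc s) (_ : (rc s)^-1 = rc s^-1); last by rewrite /rc fmorphV.
by rewrite mulrC; apply: eqC; rewrite ?ReMr ?ImMr mulrC.
Qed.

Lemma sum_cts (X : topologicalType) (J : Type) (r : seq J) (f : J -> X -> R) :
  (forall j, continuous (f j)) -> continuous (fun x => \sum_(j <- r) f j x).
Proof.
move=> cf; elim: r => [|j r IH].
  by under eq_fun => x do rewrite big_nil; exact: cst_cts.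
by under eq_fun => x do rewrite big_cons; apply: add_cts; [exact: cf|exact: IH].
Qed.

(** The last coordinate is cut into [N] steps so small, uniformly in [x] by compactness, that the
    quotient of consecutive values of [G] has positive real part. [T] is the sum of the arguments of
    these quotients. Only the change from the initial direction is lifted, so no global logarithm of
    [G] is involved. *)
Lemma angle_lift (X : topologicalType) (G : X * R -> C) :
  compact [set: X] -> continuous G -> (forall u, G u != 0) ->
  exists2 T : X -> R, continuous T &
    forall x, dir (G (x, 1)) = dir (G (x, 0)) * expi (T x).
Proof.
move=> cX cG G0.
pose K := [set: X] `*` `[0 : R, 1]%classic.
have cK : compact K by apply: compact_setX => //; exact: segment_compact.
pose q (u : X * R) (d : R) : C := G (u.1, u.2 + d) / G u.
(* At [d = 0] the quotient is 1; compactness of [K] makes one neighbourhood of 0 serve every [u]. *)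
have near0 : \forall d \near (0 : R), K `<=` (fun u => 0 < Re (q u d)).
  have cov := iffLR (compact_near_coveringP K) cK R (nbhs (0 : R)) (fun d u => 0 < Re (q u d)).
  apply: cov => u _.
  pose h (v : (X * R) * R) := Re (q v.1 v.2).
  have ch : continuous h.
    apply: Re_cts; apply: mulC_cts.
      apply: comp_cts => //; apply: pair_cts.
        by apply: comp_cts; [exact: fst_cts|exact: fst_cts].
      apply: add_cts; last exact: snd_cts.
      by apply: comp_cts; [exact: snd_cts|exact: fst_cts].
    by apply: inv_cts => //; apply: comp_cts => //; exact: fst_cts.
  have h0 : h (u, 0) \in [set x : R | 0 < x].
    by apply/mem_set; rewrite /h /q /= addr0 -surjective_pairing divff //= ltr01.
  have /ch : nbhs (h (u, 0)) [set x : R | 0 < x].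
    by apply: open_nbhs_nbhs; split; [exact: open_gt|exact/set_mem].
  by [].
have [N N0 HN] : exists2 N : nat, (0 < N)%N & K `<=` (fun u => 0 < Re (q u N%:R^-1)).
  move: near0 => /nbhs_ballP[e /= e0 He].
  exists (Num.bound e^-1).+1 => //; apply: He.
  rewrite /ball /= sub0r normrN gtr0_norm ?invr_gt0 //.
  rewrite invf_plt ?posrE // (lt_le_trans (archi_boundP _)) ?invr_ge0 ?ltW //.
  by rewrite ltr_nat.
have N0' : N%:R != 0 :> R by rewrite pnatr_eq0 -lt0n.
pose T x := \sum_(k < N) carg (q (x, k%:R / N%:R) N%:R^-1).
have kK x (k : nat) : (k < N)%N -> K (x, k%:R / N%:R).
  move=> kN; split => //=; rewrite in_itv /= divr_ge0 //=.
  by rewrite ler_pdivrMr ?ltr0n // mul1r ler_nat ltnW.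
exists T.
  apply: sum_cts => k x.
  have k0 : Re (q (x, k%:R / N%:R) N%:R^-1) != 0 by rewrite gt_eqF // HN //; exact: kK.
  have cq : continuous (fun y => q (y, k%:R / N%:R) N%:R^-1).
    rewrite /q /=; apply: mulC_cts; last apply: inv_cts => //.
      by apply: comp_cts => //; apply: pair_cts; [move=> ?; exact: cvg_id|exact: cst_cts].
    by apply: comp_cts => //; apply: pair_cts; [move=> ?; exact: cvg_id|exact: cst_cts].
  apply: (@continuous_comp _ _ _ (fun y => Im (q (y, k%:R / N%:R) N%:R^-1) /
     Re (q (y, k%:R / N%:R) N%:R^-1)) atan); last exact: continuous_atan.
  by apply: cvgM; [exact: (Im_cts cq)|apply: cvgV => //; exact: (Re_cts cq)].
move=> x.
have : forall n, (n <= N)%N -> dir (G (x, n%:R / N%:R)) =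
    dir (G (x, 0)) * expi (\sum_(k < n) carg (q (x, k%:R / N%:R) N%:R^-1)).
  elim=> [|n IH] nN; first by rewrite big_ord0 expi0 mulr1 mul0r.
  rewrite big_ord_recr /= expiD mulrA -IH ?(ltnW nN) // -carg_expi; last first.
    by apply: HN; exact: kK.
  rewrite /q /= -dirM mulrCA divff // mulr1; congr (dir (G (_, _))).
  by rewrite -natr1 mulrDl mul1r.
by move=> /(_ N (leqnn N)); rewrite divff.
Qed.


Lemma clamp_mul1 (t : I) : clamp (1 * unitI_val t) = t.
Proof. by rewrite mul1r clampK. Qed.

Lemma clamp_mul0 (t : I) : clamp (0 * unitI_val t) = zero :> I.
Proof. by rewrite mul0r clamp_le0. Qed.

Lemma unitI_compact : compact [set: I].
Proof.
have -> : [set: I] = [set clamp t | t in `[0 : R, 1]%classic].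
  apply/esym; apply/seteqP; split=> // t _; exists (unitI_val t); last exact: clampK.
  by rewrite /= in_itv /= unitI_ge0 unitI_le1.
apply: continuous_compact; last exact: segment_compact.
by apply: continuous_subspaceT; exact: clamp_continuous.
Qed.

(* The argument of [f] increases by [a]; [u] absorbs the initial direction, so
   that no logarithm has to be chosen. *)
Definition turns (f : I -> C) (a : R) := exists T u,
  [/\ continuous T, forall t, dir (f t) = u * expi (T t) & T one - T zero = a].

Lemma turns_exists (f : I -> C) :
  continuous f -> (forall t, f t != 0) -> exists a, turns f a.
Proof.
move=> cf f0.
have cG : continuous (fun v : I * R => f (clamp (v.2 * unitI_val v.1))).
  apply: comp_cts => //; apply: (comp_cts (g := clamp)); first exact: clamp_continuous.
  apply: mul_cts; first exact: snd_cts.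
  by apply: comp_cts; [exact: unitI_val_continuous|exact: fst_cts].
have [//|T cT TE] := angle_lift unitI_compact cG.
exists (T one - T zero); exists T; exists (dir (f zero)); split=> // t.
by have := TE t; rewrite /= clamp_mul1 clamp_mul0.
Qed.

Lemma cst_of_expi_eq1 (T : I -> R) : continuous T ->
  (forall t, expi (T t) = 1 :> C) -> T zero = T one.
Proof.
move=> cT T1; apply: (@expi_eq1_cst _ (fun t => T (clamp t))) => [|t]; last exact: T1.
by apply: comp_cts => //; exact: clamp_continuous.
Qed.

(** The exponential of the difference of two lifts is the constant [u' / u], so the difference
    itself is constant. *)
Lemma turns_uniq (f : I -> C) a b : (forall t, f t != 0) ->
  turns f a -> turns f b -> a = b.
Proof.
move=> f0 [T [u [cT TE <-]]] [T' [u' [cT' TE' <-]]].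
have := @cst_of_expi_eq1 (fun t => (T t - T' t) - (T zero - T' zero)).
rewrite subrr => H; apply/eqP; rewrite -subr_eq0; apply/eqP.
rewrite [RHS]H; first by ring.
- apply: sub_cts; last exact: cst_cts.
  by apply: sub_cts.
- move=> t; have u0 : u != 0.
    by apply/eqP => u0; have := dir_neq0 (f0 t); rewrite TE u0 mul0r eqxx.
  have u0' : u' != 0.
    by apply/eqP => u0'; have := dir_neq0 (f0 t); rewrite TE' u0' mul0r eqxx.
  have E s : expi (T s - T' s) = u' / u.
    have := TE' s; rewrite TE expiD expiN => /(canRL (mulKf u0)) ->.
    by rewrite mulrA mulfK ?expi_neq0 // mulrC.
  by rewrite expiD expiN !E divff // mulf_neq0 // invr_eq0.
Qed.

Lemma turnsM (f g : I -> C) a b : turns f a -> turns g b ->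
  turns (fun t => f t * g t) (a + b).
Proof.
move=> [T [u [cT TE <-]]] [T' [u' [cT' TE' <-]]].
exists (fun t => T t + T' t), (u * u'); split=> [|t|]; last by ring.
- exact: add_cts.
- by rewrite dirM TE TE' expiD mulrACA.
Qed.

Lemma turns_conj (f : I -> C) a : (forall t, f t != 0) -> turns f a ->
  turns (fun t => conjc (f t) : C) (- a).
Proof.
move=> f0 [T [u [cT TE <-]]].
exists (fun t => - T t), u^-1; split=> [|t|]; last by ring.
- exact: opp_cts.
- by rewrite dir_conj // TE expiN invfM.
Qed.

Lemma turns_pos (f : I -> C) : (forall t, 0 < f t) -> turns f 0.
Proof.
move=> f0; exists (fun=> 0), 1; split=> [|t|]; rewrite ?subrr //.
- exact: cst_cts.
- by rewrite dir_pos // expi0 mulr1.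
Qed.

Lemma turns_cst (c : C) : turns (fun=> c) 0.
Proof.
exists (fun=> 0), (dir c); split=> [|t|]; rewrite ?subrr ?expi0 ?mulr1 //.
exact: cst_cts.
Qed.

Lemma turns_circle (c : C) :
  turns (fun t => expi (2 * pi * unitI_val t) * c) (2 * pi).
Proof.
exists (fun t => 2 * pi * unitI_val t), (dir c); split=> [|t|].
- by apply: mul_cts; [exact: cst_cts|exact: unitI_val_continuous].
- by rewrite dirM /dir norm_expi divr1 mulrC.
- by rewrite Defs.val0 Defs.val1 mulr0 mulr1 subr0.
Qed.

Lemma turns_prod (J : eqType) (r : seq J) (P : pred J) (f : J -> I -> C) (a : J -> R) :
  (forall j, turns (f j) (a j)) ->
  turns (fun t => \prod_(j <- r | P j) f j t) (\sum_(j <- r | P j) a j).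
Proof.
move=> fa; elim: r => [|j r IH].
  by rewrite big_nil; under eq_fun => t do rewrite big_nil; exact: turns_cst.
rewrite big_cons; under eq_fun => t do rewrite big_cons.
by case: (P j) => //; exact: turnsM.
Qed.

(** Lifting over the whole square makes the total turn of the row [s] continuous in [s], while its
    exponential stays equal to [k]; hence it is constant. The factor [k] covers homotopies with
    fixed ends as well as families of loops with a moving base point, for which it is 1. *)
Lemma turns_homotopy (F : I * I -> C) (k : C) a b :
  continuous F -> (forall v, F v != 0) ->
  (forall s, dir (F (s, one)) = k * dir (F (s, zero))) ->
  turns (fun t => F (zero, t)) a -> turns (fun t => F (one, t)) b -> a = b.
Proof.
move=> cF F0 Fk ta tb.
have cII : compact [set: I * I].
  by rewrite -setXTT; apply: compact_setX; exact: unitI_compact.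
have cG : continuous (fun v : (I * I) * R =>
    F (v.1.1, clamp (v.2 * unitI_val v.1.2))).
  apply: comp_cts => //; apply: pair_cts.
    by apply: comp_cts; [exact: fst_cts|exact: fst_cts].
  apply: (comp_cts (g := clamp)); first exact: clamp_continuous.
  apply: mul_cts; first exact: snd_cts.
  apply: (comp_cts (g := unitI_val)); first exact: unitI_val_continuous.
  by apply: comp_cts; [exact: snd_cts|exact: fst_cts].
have [//|T cT TE] := angle_lift cII cG.
have {}TE s t : dir (F (s, t)) = dir (F (s, zero)) * expi (T (s, t)).
  by have := TE (s, t); rewrite /= clamp_mul1 clamp_mul0.
have row s : turns (fun t => F (s, t)) (T (s, one) - T (s, zero)).
  exists (fun t => T (s, t)), (dir (F (s, zero))); split=> //.
  by apply: comp_cts => //; apply: pair_cts; [exact: cst_cts|move=> ?; exact: cvg_id].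
rewrite (turns_uniq _ ta (row zero)) // (turns_uniq _ tb (row one)) //.
have k0 : k != 0.
  by apply/eqP => k0; have := dir_neq0 (F0 (zero, one)); rewrite Fk k0 mul0r eqxx.
have Ek s : expi (T (s, one) - T (s, zero)) = k.
  have d0 := dir_neq0 (F0 (s, zero)).
  have e1 : expi (T (s, one)) = k.
    by apply: (mulfI d0); rewrite -TE Fk mulrC.
  have e0 : expi (T (s, zero)) = 1 :> C.
    by apply: (mulfI d0); rewrite -TE mulr1.
  by rewrite expiD expiN e1 e0 invr1 mulr1.
have := @cst_of_expi_eq1 (fun s => (T (s, one) - T (s, zero)) - (T (zero, one) - T (zero, zero))).
rewrite subrr => H; apply/esym/eqP; rewrite -subr_eq0; apply/eqP; rewrite [RHS]H //.
- have cr z : continuous (fun s => T (s, z)).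
    by apply: comp_cts => //; apply: pair_cts; [move=> ?; exact: cvg_id|exact: cst_cts].
  by apply: sub_cts; [exact: sub_cts|exact: cst_cts].
- by move=> s; rewrite expiD expiN !Ek divff.
Qed.

Section turns_along.
Variables (X : topologicalType) (h : X -> C).
Hypothesis h0 : forall x, h x != 0.
Local Notation pth x y := {path I from x to y in X}.

Lemma turns_concat x y z (p : pth x y) (q : pth y z) a b :
  turns (h \o p) a -> turns (h \o q) b -> turns (h \o concat p q) (a + b).
Proof.
move=> [T [u [cT TE <-]]] [T' [u' [cT' TE' <-]]].
(* The shift that makes the second lift agree with the first at the junction. *)
pose D := T one - T' zero.
have uE : u' = u * expi D.
  have := TE one; have := TE' zero; rewrite /= path_one path_zero => -> E.
  rewrite expiD expiN mulrA -E mulfK //; exact: expi_neq0.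
pose f (t : I) := if unitI_val t <= 2^-1 then T (clamp (2 * unitI_val t))
  else T' (clamp (2 * unitI_val t - 1)) + D.
exists f, u; split=> [|t|].
- apply: if_continuous; first exact: unitI_val_continuous.
  + apply: comp_cts => //; apply: (comp_cts (g := clamp)); first exact: clamp_continuous.
    by apply: mul_cts; [exact: cst_cts|exact: unitI_val_continuous].
  + apply: add_cts; last exact: cst_cts.
    apply: comp_cts => //; apply: (comp_cts (g := clamp)); first exact: clamp_continuous.
    apply: sub_cts; last exact: cst_cts.
    by apply: mul_cts; [exact: cst_cts|exact: unitI_val_continuous].
  + move=> t ->; rewrite mulfV ?pnatr_eq0 // subrr clamp_ge1 // clamp_le0 //.
    by rewrite /D addrC subrK.
- rewrite /f /= /mk_path /concat_fun; case: ifP => _; first exact: TE.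
  by rewrite expiD [expi _ * _]mulrC mulrA -uE -TE'.
- have f0 : f zero = T zero.
    by rewrite /f Defs.val0 invr_ge0 ler0n mulr0 clamp_le0.
  have f1 : f one = T' one + D.
    rewrite /f Defs.val1 ifF; last by apply/negbTE; lra.
    by rewrite clamp_ge1 //; lra.
  by rewrite f0 f1 /D; ring.
Qed.

Lemma turns_reverse x y (p : pth x y) a :
  turns (h \o p) a -> turns (h \o reverse p) (- a).
Proof.
move=> [T [u [cT TE <-]]].
exists (fun t => T (clamp (1 - unitI_val t))), u; split=> [|t|].
- apply: comp_cts => //; apply: (comp_cts (g := clamp)); first exact: clamp_continuous.
  by apply: sub_cts; [exact: cst_cts|exact: unitI_val_continuous].
- exact: TE.
- by rewrite Defs.val0 Defs.val1 subr0 subrr clamp_le0 // clamp_ge1 // opprB.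
Qed.

Hypothesis ch : continuous h.

Lemma turns_homotopic x y (p q : pth x y) a b : homotopic p q ->
  turns (h \o p) a -> turns (h \o q) b -> a = b.
Proof.
move=> [F [cF F0 F1 Fx Fy]] ta tb.
apply: (@turns_homotopy (h \o F) (dir (h y) / dir (h x))) => //.
- by move=> v; apply: continuous_comp; [exact: cF|exact: ch].
- by move=> v; exact: h0.
- by move=> s; rewrite /= Fx Fy mulfVK // dir_neq0.
- by under eq_fun => t do rewrite /= F0.
- by under eq_fun => t do rewrite /= F1.
Qed.

Definition total_turn x y (p : pth x y) : R := get (turns (h \o p)).

Lemma total_turnP x y (p : pth x y) : turns (h \o p) (total_turn p).
Proof.
apply: getPex; apply: turns_exists => [t|t]; last exact: h0.
by apply: continuous_comp; [exact: path_cts|exact: ch].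
Qed.

Lemma total_turnE x y (p : pth x y) a : turns (h \o p) a -> total_turn p = a.
Proof. by apply: turns_uniq (total_turnP p) => t; exact: h0. Qed.

Lemma total_turn_repr x (p : pth x x) : total_turn (repr (pi1_class p)) = total_turn p.
Proof.
by apply: turns_homotopic (total_turnP _) (total_turnP _); apply/pi1_classP/pi1_reprK.
Qed.

Variables (c : R) (x : X).

Lemma turn_character_subproofM :
  {morph (fun a : pi1 R x => expi (c * total_turn (repr a)) : R[i]) :
    a b / (a * b)%g >-> a * b}.
Proof.
move=> a b; rewrite -{1}(pi1_reprK a) -{1}(pi1_reprK b).
rewrite [(_ * _)%g]pi1_class_mul total_turn_repr -expiD -mulrDr.
by rewrite (total_turnE (turns_concat (total_turnP _) (total_turnP _))).
Qed.

(** Turns are measured in radians, so [c = 1/3] gives exp(2 i pi w / 3), with w the winding number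
    of the image of the loop under [h]. *)
Definition turn_character : character R (pi1 R x) :=
  Character turn_character_subproofM (fun a => expi_neq0 _).

Lemma turn_characterE (p : pth x x) a : turns (h \o p) a ->
  turn_character (pi1_class p) = expi (c * a).
Proof. by move=> /total_turnE pa; rewrite /= total_turn_repr pa. Qed.

End turns_along.
End winding.

(** * Meridians determine the characters of the complement *)

Section groupoid.
Variables (R : realType) (X : topologicalType).
Local Notation pth x y := {path (unitI R) from x to y in X}.

#[local] Instance homotopic_Equivalence (x y : X) :
  RelationClasses.Equivalence (@homotopic R X x y).
Proof.
split=> [p|p q|p q r]; first exact: homotopic_refl.
- exact: homotopic_sym.
- exact: homotopic_trans.
Qed.

#[local] Instance concat_Proper (x y z : X) :
  Morphisms.Proper (Morphisms.respectful (@homotopic R X x y)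
    (Morphisms.respectful (@homotopic R X y z) (@homotopic R X x z)))
    (@concat R X x y z).
Proof. by move=> p p' pp' q q' qq'; exact: concat_homotopic. Qed.

(** The return along [t] cancels against the departure along [t]; this makes the extension of a
    character from loops to paths multiplicative. *)
Lemma concat_conj x y z w (s : pth x y) (t : pth x z) (u : pth x w)
    (p : pth y z) (q : pth z w) :
  homotopic (concat (concat (concat s p) (reverse t)) (concat (concat t q) (reverse u)))
            (concat (concat s (concat p q)) (reverse u)).
Proof.
rewrite concatA. rewrite -(concatA _ (reverse t)).
rewrite (concatA (reverse t)). rewrite concatVp. rewrite concat1p. rewrite (concatA s).
reflexivity.
Qed.
End groupoid.

Section lines.
Variables (R : realType) (l : nat).
Local Notation C := (CC R).
Local Notation I := (unitI R).

Definition line (a b : 'rV[C]_l) (s : R) := rc (1 - s) *: a + rc s *: b.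

Lemma line0 a b : line a b 0 = a.
Proof. by rewrite /line subr0 rc1 rc0 scale1r scale0r addr0. Qed.

Lemma line1 a b : line a b 1 = b.
Proof. by rewrite /line subrr rc1 rc0 scale1r scale0r add0r. Qed.

Lemma linexx a s : line a a s = a.
Proof. by rewrite /line -scalerDl -rcD subrK rc1 scale1r. Qed.

Lemma line_cts (Z : topologicalType) (f g : Z -> 'rV[C]_l) (s : Z -> R) :
  continuous f -> continuous g -> continuous s ->
  continuous (fun z => line (f z) (g z) (s z)).
Proof.
move=> cf cg cs; apply: row_cts => j.
have coord (h : Z -> 'rV[C]_l) : continuous h -> continuous (fun z => h z ord0 j).
  by move=> ch; apply: (comp_cts (g := fun x : 'rV[C]_l => x ord0 j)) => //; exact: coord_continuous.
rewrite (_ : (fun _ => _) = fun z => rc (1 - s z) * f z ord0 j + rc (s z) * g z ord0 j).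
  apply: addC_cts; apply: mulC_cts; [|exact: coord| |exact: coord]; apply: rc_cts => //.
  by apply: sub_cts => //; exact: cst_cts.
by apply/funext => z; rewrite !mxE.
Qed.

Lemma affine_cts (Z : topologicalType) (h : Z -> C) (y v : 'rV[C]_l) :
  continuous h -> continuous (fun z => y + h z *: v).
Proof.
move=> ch; apply: row_cts => j.
rewrite (_ : (fun _ => _) = fun z => y ord0 j + h z * v ord0 j).
  by apply: addC_cts; [exact: cst_cts|apply: mulC_cts; [exact: ch|exact: cst_cts]].
by apply/funext => z; rewrite !mxE.
Qed.

End lines.

(** * The cut complement and the values of a character on paths *)

Section local_system.
Variables (R : realType) (l n : nat) (A : arrangement R l n) (x0 : complement A).
Local Notation C := (CC R).
Local Notation I := (unitI R).
Local Notation V := 'rV[C]_l.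
Local Notation M := (complement A).
Local Notation pth x y := {path I from x to y in M}.

Lemma complementE (x : V) : M x <-> forall H, formv A H x != 0.
Proof. by split=> xM H; have := xM H; rewrite memv_ker. Qed.

Lemma formv_neq0 (x : M) H : formv A H (set_val x) != 0.
Proof. by move: H; apply/complementE; exact: set_valP. Qed.

(* Normalised by [g_H(x0) = 1]: the points where no [g_H] lies in ]-oo, 0] then
   form a set that is star-shaped about [x0]. *)
Definition nform H (x : V) : C := formv A H x / formv A H (set_val x0).

Lemma nformD H x y : nform H (x + y) = nform H x + nform H y.
Proof. by rewrite /nform /formv linearD mulrDl. Qed.

Lemma nformZ H c x : nform H (c *: x) = c * nform H x.
Proof. by rewrite /nform /formv linearZ /= -mulrA. Qed.

Lemma nform_base H : nform H (set_val x0) = 1.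
Proof. by rewrite /nform divff // formv_neq0. Qed.

Lemma nform_line H a b s :
  nform H (line a b s) = rc (1 - s) * nform H a + rc s * nform H b.
Proof. by rewrite nformD !nformZ. Qed.

Lemma Re_nform_line H a b s :
  Re (nform H (line a b s)) = (1 - s) * Re (nform H a) + s * Re (nform H b).
Proof. by rewrite nform_line ReD !ReMr. Qed.

Lemma Im_nform_line H a b s :
  Im (nform H (line a b s)) = (1 - s) * Im (nform H a) + s * Im (nform H b).
Proof. by rewrite nform_line ImD !ImMr. Qed.

Lemma nform_continuous H : continuous (nform H).
Proof. by apply: mulC_cts; [exact: formv_continuous|exact: cst_cts]. Qed.

Lemma complementP (x : V) : M x <-> forall H, nform H x != 0.
Proof.
split=> [/complementE xM H|xM].
  by rewrite mulf_neq0 // invr_eq0 formv_neq0.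
by apply/complementE => H; apply: contra_neq (xM H) => xH; rewrite /nform xH mul0r.
Qed.

Definition off_cut (z : C) := Im z <> 0 \/ 0 < Re z.
Definition off (x : V) := forall H, off_cut (nform H x).

Lemma off_cut_neq0 z : off_cut z -> z != 0.
Proof. by case=> [z0|z0]; apply/eqP => zE; move: z0; rewrite zE //= ltxx. Qed.

Lemma off_complement x : off x -> M x.
Proof. by move=> ox; apply/complementP => H; exact: off_cut_neq0. Qed.

Lemma off_base : off (set_val x0).
Proof. by move=> H; rewrite nform_base; right; rewrite /= ltr01. Qed.

(** Along the segment each g_H runs straight from 1 to its value at [x], and the plane cut along
    ]-oo, 0] is star-shaped about 1. *)
Lemma off_star x s : 0 <= s <= 1 -> off x -> off (line (set_val x0) x s).
Proof.
case/andP=> s0 s1 ox H; rewrite /off_cut Re_nform_line Im_nform_line nform_base /=.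
case: (ox H) => [i|r].
- have [->|sn0] := eqVneq s 0; first by right; rewrite subr0 mul0r addr0 mulr1.
  by left; rewrite mulr0 add0r; apply/eqP; rewrite mulf_neq0 //; exact/eqP.
- right; have [->|sn0] := eqVneq s 0; first by rewrite subr0 mul0r addr0 mulr1.
  by rewrite mulr1 ltr_wpDl ?subr_ge0 // mulr_gt0 // lt0r sn0.
Qed.

Definition point (x : V) (xM : M x) : M := exist (fun x => x \in M) x (mem_set xM).

Lemma pointK x (xM : M x) : set_val (point xM) = x. Proof. by []. Qed.

Lemma eq_point (x : M) y (yM : M y) : set_val x = y -> x = point yM.
Proof. by move=> xy; apply: val_inj. Qed.

Lemma lift_cts (f : I -> M) : continuous (fun t => set_val (f t)) -> continuous f.
Proof. by move=> cf; apply: continuous_comp_initial. Qed.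

Section curve.
Variables (f : I -> V) (cf : continuous f) (fM : forall t, M (f t)) (x y : M).
Hypotheses (f0 : f zero = set_val x) (f1 : f one = set_val y).

Lemma curve_cts : continuous (fun t => point (fM t)).
Proof. exact: lift_cts. Qed.
Lemma curve0 : point (fM zero) = x. Proof. exact: val_inj. Qed.
Lemma curve1 : point (fM one) = y. Proof. exact: val_inj. Qed.

Definition curve : pth x y := mk_path curve_cts curve0 curve1.
Lemma curveE t : set_val (curve t) = f t. Proof. by []. Qed.
End curve.

Lemma path_val_cts x y (p : pth x y) : continuous (fun t => set_val (p t) : V).
Proof.
apply: (comp_cts (g := set_val)); last exact: path_cts.
exact: initial_continuous.
Qed.

Lemma straight_homotopic x y (p q : pth x y) :
  (forall t s, 0 <= s <= 1 -> M (line (set_val (p t)) (set_val (q t)) s)) ->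
  homotopic p q.
Proof.
move=> pqM.
have pqI (v : I * I) : M (line (set_val (p v.2)) (set_val (q v.2)) (unitI_val v.1)).
  by apply: pqM; rewrite unitI_ge0 unitI_le1.
exists (fun v => point (pqI v)); split=> [|t|t|s|s].
- apply: continuous_comp_initial; apply: line_cts.
  + by apply: (comp_cts (g := fun t => set_val (p t))); [exact: path_val_cts|exact: snd_cts].
  + by apply: (comp_cts (g := fun t => set_val (q t))); [exact: path_val_cts|exact: snd_cts].
  + by apply: (comp_cts (g := unitI_val)); [exact: unitI_val_continuous|exact: fst_cts].
- by apply: val_inj; rewrite /= Defs.val0 line0.
- by apply: val_inj; rewrite /= Defs.val1 line1.
- by apply: val_inj; rewrite /= !path_zero linexx.
- by apply: val_inj; rewrite /= !path_one linexx.
Qed.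

Definition convex_in_M (K : set V) := K `<=` M /\
  forall a b s, K a -> K b -> 0 <= s <= 1 -> K (line a b s).

Definition within x y (p : pth x y) (K : set V) := forall t, K (set_val (p t)).

Lemma convex_homotopic K x y (p q : pth x y) : convex_in_M K ->
  within p K -> within q K -> homotopic p q.
Proof. by case=> KM Kc pK qK; apply: straight_homotopic => t s s01; apply/KM/Kc. Qed.

Lemma within_concat K x y z (p : pth x y) (q : pth y z) :
  within p K -> within q K -> within (concat p q) K.
Proof. by move=> pK qK t; rewrite /= /mk_path /concat_fun; case: ifP => _; [exact: pK|exact: qK]. Qed.

Lemma within_reverse K x y (p : pth x y) : within p K -> within (reverse p) K.
Proof. by move=> pK t; exact: pK. Qed.

Section segment.
Variables x y : M.
Hypothesis xyM : forall s, 0 <= s <= 1 -> M (line (set_val x) (set_val y) s).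

Lemma seg_subproof (t : I) : M (line (set_val x) (set_val y) (unitI_val t)).
Proof. by apply: xyM; rewrite unitI_ge0 unitI_le1. Qed.

Lemma seg_cts : continuous (fun t : I => line (set_val x) (set_val y) (unitI_val t) : V).
Proof.
by apply: line_cts; [exact: cst_cts|exact: cst_cts|exact: unitI_val_continuous].
Qed.

Lemma seg0 : line (set_val x) (set_val y) (unitI_val (zero : I)) = set_val x.
Proof. by rewrite Defs.val0 line0. Qed.
Lemma seg1 : line (set_val x) (set_val y) (unitI_val (one : I)) = set_val y.
Proof. by rewrite Defs.val1 line1. Qed.

Definition seg : pth x y := curve seg_cts seg_subproof seg0 seg1.

Lemma segE t : set_val (seg t) = line (set_val x) (set_val y) (unitI_val t).
Proof. by []. Qed.

Lemma within_seg (K : set V) :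
  (forall s, 0 <= s <= 1 -> K (line (set_val x) (set_val y) s)) -> within seg K.
Proof. by move=> xyK t; apply: xyK; rewrite unitI_ge0 unitI_le1. Qed.
End segment.

Lemma exists_seg K (x y : M) : convex_in_M K -> K (set_val x) -> K (set_val y) ->
  exists p : pth x y, within p K /\ forall t, set_val (p t) = line (set_val x) (set_val y) (unitI_val t).
Proof.
move=> [KM Kc] Kx Ky.
have xyM s : 0 <= s <= 1 -> M (line (set_val x) (set_val y) s).
  by move=> s01; apply/KM/Kc.
by exists (seg xyM); split=> // t; rewrite segE; apply: Kc => //; rewrite unitI_ge0 unitI_le1.
Qed.

Definition tail (x : M) (ox : off (set_val x)) : pth x0 x :=
  seg (fun s s01 => off_complement (off_star s01 ox)).

Lemma within_tail x ox : within (@tail x ox) off.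
Proof. by apply: within_seg => s s01; exact: off_star. Qed.

Variable lambda : character R (pi1 R x0).

Lemma lambda1 : lambda (pi1_class (const_path R x0)) = 1.
Proof.
apply: (mulfI (character_neq0 lambda (pi1_class (const_path R x0)))).
by rewrite mulr1 -characterM [(_ * _)%g]pi1_class_mul (iffRL (pi1_classP _ _) (concatp1 _)).
Qed.

(* Well defined on paths and not only on loops, because [off] is star-shaped
   about the base point. *)
Definition lam (x y : M) (ox : off (set_val x)) (oy : off (set_val y)) (p : pth x y) : R[i] :=
  lambda (pi1_class (concat (concat (tail ox) p) (reverse (tail oy)))).

Lemma lam_homotopic x y ox oy (p q : pth x y) : homotopic p q ->
  lam ox oy p = lam ox oy q.
Proof.
move=> pq; congr (lambda _); apply/pi1_classP; apply: concat_homotopic (homotopic_refl _).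
by apply: concat_homotopic pq; exact: homotopic_refl.
Qed.

Lemma lam_concat x y z ox oy oz (p : pth x y) (q : pth y z) :
  lam ox oz (concat p q) = lam ox oy p * lam oy oz q.
Proof.
rewrite /lam -characterM [(_ * _)%g]pi1_class_mul; congr (lambda _).
by apply/pi1_classP/homotopic_sym/concat_conj.
Qed.

(** Closed up by the two tails, the path is a loop in a set star-shaped about [x0], and contracts
    radially to [x0]. *)
Lemma lam_off x y ox oy (p : pth x y) : within p off -> lam ox oy p = 1.
Proof.
move=> po; rewrite -lambda1; congr (lambda _); apply/pi1_classP.
apply: homotopic_sym; apply: straight_homotopic => t s s01; apply: off_complement.
apply: off_star => //.
apply: within_concat; last by apply: within_reverse; exact: within_tail.
by apply: within_concat => //; exact: within_tail.
Qed.

Lemma lam_convex K x y ox oy (p q : pth x y) : convex_in_M K ->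
  within p K -> within q K -> lam ox oy p = lam ox oy q.
Proof. by move=> cK pK qK; apply: lam_homotopic; exact: convex_homotopic cK pK qK. Qed.

Lemma lam_reverse x y ox oy (p : pth x y) : lam oy ox (reverse p) = (lam ox oy p)^-1.
Proof.
apply: (mulfI (character_neq0 lambda (pi1_class (concat (concat (tail ox) p) (reverse (tail oy)))))).
rewrite divff; last exact: character_neq0.
rewrite -/(lam ox oy p) -lam_concat (lam_homotopic _ _ (concatpV p)).
by apply: lam_off => t; exact: ox.
Qed.

(** Serves where the end point is only propositionally the expected one, such as [p one] instead of
    [y]. *)
Lemma lam_eq x y y' ox oy oy' (p : pth x y) (p' : pth x y') : y = y' -> p =1 p' ->
  lam ox oy p = lam ox oy' p'.
Proof.
move=> yy'; case: _ / yy' in p' oy' *; move=> /path_eqP ->.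
by rewrite (Prop_irrelevance oy oy').
Qed.

Lemma lam_base (p : pth x0 x0) : lam off_base off_base p = lambda (pi1_class p).
Proof.
congr (lambda _); apply/pi1_classP.
have tE : tail off_base = const_path R x0.
  by apply/path_eqP => t; apply: val_inj; exact: linexx.
rewrite tE; have rE : reverse (const_path R x0) = const_path R x0 by apply/path_eqP.
rewrite rE; apply: homotopic_trans (concatp1 _) _; exact: concat1p.
Qed.

End local_system.

Section local_to_global.
Variable R : realType.
Local Notation I := (unitI R).

(** Connectedness of the interval: the 0/1 indicator of the failure of [P] would be continuous, yet
    skip the value 1/2. *)
Lemma locally_constant_I (P : I -> Prop) :
  (forall t, exists2 d : R, 0 < d &
    forall u, `|unitI_val u - unitI_val t| < d -> (P u <-> P t)) ->
  P zero -> P one.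
Proof.
move=> Ploc P0; apply: contrapT => P1.
pose f (t : R) : R := if `[< P (clamp t) >] then 0 else 1.
have cf : continuous f.
  move=> t; have [d d0 Hd] := Ploc (clamp t).
  have ct : continuous (fun t => unitI_val (clamp t) : R).
    by apply: (comp_cts (g := unitI_val)); [exact: unitI_val_continuous|exact: clamp_continuous].
  have near_t : \forall u \near t, f u = f t.
    have Hn := ct t _ (nbhsx_ballx (unitI_val (clamp t) : R) d d0).
    apply: (@filterS _ (nbhs t) _ _ _ _ Hn) => u; rewrite /ball /= distrC => /Hd ut.
    by rewrite /f (propext ut).
  apply: cvg_near_cst; exact: near_t.
have f0 : f 0 = 0 by rewrite /f asboolT.
have f1 : f 1 = 1 by rewrite /f asboolF.
have half : Num.min (f 0) (f 1) <= 2^-1 <= Num.max (f 0) (f 1).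
  by rewrite f0 f1 min_l ?ler01 // max_r ?ler01 //; apply/andP; split; lra.
have [c _] := IVT ler01 (continuous_subspaceT cf) half.
by rewrite /f; case: asboolP => _ H; lra.
Qed.

Lemma lt_conv (a b e s : R) : a < e -> b < e -> 0 <= s <= 1 -> (1 - s) * a + s * b < e.
Proof.
(* Strictness comes from whichever of [1 - s] and [s] is at least 1/2. *)
move=> ae be /andP[s0 s1]; case: (leP s 2^-1) => hs.
- have : (1 - s) * (e - a) > 0 by apply: mulr_gt0; lra.
  have : s * (e - b) >= 0 by apply: mulr_ge0; lra.
  by nra.
- have : (1 - s) * (e - a) >= 0 by apply: mulr_ge0; lra.
  have : s * (e - b) > 0 by apply: mulr_gt0; lra.
  by nra.
Qed.

Lemma gt_conv (a b e s : R) : e < a -> e < b -> 0 <= s <= 1 -> e < (1 - s) * a + s * b.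
Proof.
move=> ea eb s01; have : (1 - s) * - a + s * - b < - e by apply: lt_conv => //; lra.
lra.
Qed.

Lemma le_conv (a b e s : R) : a <= e -> b <= e -> 0 <= s <= 1 -> (1 - s) * a + s * b <= e.
Proof.
move=> ae be /andP[s0 s1].
have : (1 - s) * (e - a) >= 0 by apply: mulr_ge0; lra.
have : s * (e - b) >= 0 by apply: mulr_ge0; lra.
by nra.
Qed.

Lemma ge_conv (a b e s : R) : e <= a -> e <= b -> 0 <= s <= 1 -> e <= (1 - s) * a + s * b.
Proof.
move=> ea eb s01; have : (1 - s) * - a + s * - b <= - e by apply: le_conv => //; lra.
lra.
Qed.

Lemma finite_min (J : finType) (m : J -> R) : (forall j, 0 < m j) ->
  exists2 e, 0 < e & forall j, e <= m j.
Proof.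
move=> m0; suff [e e0 He] : exists2 e, 0 < e & forall j, j \in enum J -> e <= m j.
  by exists e => // j; apply: He; rewrite mem_enum.
elim: (enum J) => [|j r [e e0 He]]; first by exists 1.
exists (Num.min (m j) e); first by rewrite lt_min m0.
move=> k; rewrite inE ge_min => /orP[/eqP ->|kr]; first by rewrite lexx.
by rewrite (He _ kr) orbT.
Qed.

End local_to_global.

(** * Convex boxes in the complement *)

Section arrangement_complement.
Variables (R : realType) (l n : nat) (A : arrangement R l n) (x0 : complement A).
Local Notation C := (CC R).
Local Notation I := (unitI R).
Local Notation V := 'rV[C]_l.
Local Notation M := (complement A).
Local Notation pth x y := {path I from x to y in M}.
Local Notation g := (nform x0).
Local Notation off := (off x0).

(* Boxes and not balls: they are convex, and defined by the values of the
   [g_H], so that no norm on [C^l] is needed. *)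
Definition box (y : V) (e : R) : set V := [set x | forall H,
  `|Re (g H x) - Re (g H y)| < e /\ `|Im (g H x) - Im (g H y)| < e].

Lemma box_center y e : 0 < e -> box y e y.
Proof. by move=> e0 H; rewrite !subrr normr0. Qed.

Lemma box_le y e e' : e <= e' -> box y e `<=` box y e'.
Proof. by move=> ee x xb H; have [a b] := xb H; split; apply: lt_le_trans ee. Qed.

Lemma box_convex y e a b s : box y e a -> box y e b -> 0 <= s <= 1 ->
  box y e (line a b s).
Proof.
move=> ya yb s01 H; have [a1 a2] := ya H; have [b1 b2] := yb H.
move: a1 a2 b1 b2; rewrite Re_nform_line Im_nform_line !ltr_norml.
move=> /andP[a1 a1'] /andP[a2 a2'] /andP[b1 b1'] /andP[b2 b2'].
have conv (u v w : R) : - e < u - w -> u - w < e -> - e < v - w -> v - w < e ->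
    - e < (1 - s) * u + s * v - w /\ (1 - s) * u + s * v - w < e.
  move=> h1 h2 h3 h4; have -> : (1 - s) * u + s * v - w = (1 - s) * (u - w) + s * (v - w) by ring.
  by split; [exact: gt_conv|exact: lt_conv].
have [-> ->] := conv _ _ _ a1 a1' b1 b1'.
by have [-> ->] := conv _ _ _ a2 a2' b2 b2'.
Qed.

Lemma box_trans y z e e' x : box y e z -> box z e' x -> box y (e + e') x.
Proof.
move=> yz zx H; have [a1 a2] := yz H; have [b1 b2] := zx H.
split.
- rewrite (_ : _ - _ = (Re (g H x) - Re (g H z)) + (Re (g H z) - Re (g H y))); last by ring.
  by apply: le_lt_trans (ler_normD _ _) _; rewrite addrC ltrD.
- rewrite (_ : _ - _ = (Im (g H x) - Im (g H z)) + (Im (g H z) - Im (g H y))); last by ring.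
  by apply: le_lt_trans (ler_normD _ _) _; rewrite addrC ltrD.
Qed.

(** The part of g_H(y) that is bounded from below is the one that decides its position relative to
    the cut: the imaginary part if it is nonzero, and the real part otherwise. Weak inequalities
    suffice since boxes are open. *)
Definition margin (y : V) (e : R) := 0 < e /\ forall H,
  (Im (g H y) <> 0 -> e <= `|Im (g H y)|) /\
  (Im (g H y) = 0 -> e <= `|Re (g H y)|).

Lemma margin_exists y : M y -> exists e, margin y e.
Proof.
move=> /(complementP x0) My.
have [] := @finite_min R 'I_n (fun H => if Im (g H y) == 0 then `|Re (g H y)| else `|Im (g H y)|).
  move=> H; case: eqP => [i0|/eqP i0]; rewrite normr_gt0 //.
  by apply/eqP => r0; have := My H; rewrite (_ : g H y = 0) ?eqxx //; exact: eqC.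
move=> e e0 He; exists e; split=> // H; have := He H.
by case: eqP.
Qed.

Lemma margin_box_off y e x H : margin y e -> box y e x ->
  off_cut (g H y) -> off_cut (g H x).
Proof.
move=> [e0 m] yx; have [r i] := yx H; have [a b] := m H.
case: (pselect (Im (g H y) = 0)) => [i0|i0] oy.
- right; case: oy => // oy; have := b i0; rewrite gtr0_norm // => er.
  by move: r; rewrite ltr_norml => /andP[]; lra.
- left => ix; have := a i0; move: i; rewrite ix sub0r normrN; lra.
Qed.

Lemma margin_box_cut y e x H : M y -> margin y e -> box y e x ->
  ~ off_cut (g H y) -> Re (g H x) < 0.
Proof.
move=> /(complementP x0)/(_ H) My [e0 m] yx ny; have [r _] := yx H.
have i0 : Im (g H y) = 0 by apply: contrapT => i0; apply: ny; left.
have r0 : Re (g H y) <= 0 by rewrite leNgt; apply/negP => r0; apply: ny; right.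
have r1 : Re (g H y) < 0.
  rewrite lt_neqAle r0 andbT; apply: contra_neq My => r1; exact: eqC.
have := (m H).2 i0; rewrite ltr0_norm // => er.
by move: r; rewrite ltr_norml => /andP[]; lra.
Qed.

(** A g_H off its cut at [y] remains off it in the box, and a g_H on its cut at [y] keeps a negative
    real part; in neither case can it vanish. *)
Lemma margin_box y e : M y -> margin y e -> convex_in_M A (box y e).
Proof.
move=> My m; split; last by move=> a b s; exact: box_convex.
move=> x yx; apply/(complementP x0) => H.
case: (pselect (off_cut (g H y))) => oy.
- exact/off_cut_neq0/(margin_box_off m yx oy).
- by apply/eqP => x0'; have := margin_box_cut My m yx oy; rewrite x0' ltxx.
Qed.

(** Since g_H(x0) = 1 for every H, adding i [d] x0 adds [d] to all imaginary parts at once; for [d]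
    below the margin none of the results is 0. *)
Lemma off_dense y e : M y -> 0 < e -> exists2 x, off x & box y e x.
Proof.
move=> My e0; have [e1 m1] := margin_exists My; have e10 := m1.1.
pose d := Num.min e e1 / 2.
have d0 : 0 < d by rewrite divr_gt0 // lt_min e0.
have me : Num.min e e1 <= e by rewrite ge_min lexx.
have me1 : Num.min e e1 <= e1 by rewrite ge_min lexx orbT.
have de : d < e by rewrite /d; lra.
have de1 : d < e1 by rewrite /d; lra.
exists (y + (0 +i* d)%C *: set_val x0).
- move=> H; rewrite /off_cut nformD nformZ nform_base mulr1 ReD ImD /= addr0; left => i0.
  have [a _] := m1.2 H.
  have [iy|iy] := pselect (Im (g H y) = 0); first by move: i0; rewrite iy; lra.
  have := a iy; have -> : Im (g H y) = - d by lra.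
  by rewrite normrN gtr0_norm //; lra.
- move=> H; rewrite nformD nformZ nform_base mulr1 ReD ImD /= addr0.
  by rewrite subrr normr0 addrAC subrr add0r gtr0_norm.
Qed.

End arrangement_complement.

(** * Continuation of local triviality along a path *)

Section continuation.
Variables (R : realType) (l n : nat) (A : arrangement R l n) (x0 : complement A).
Local Notation C := (CC R).
Local Notation I := (unitI R).
Local Notation V := 'rV[C]_l.
Local Notation M := (complement A).
Local Notation pth x y := {path I from x to y in M}.
Local Notation off := (off x0).
Variable lambda : character R (pi1 R x0).
Local Notation lam := (lam lambda).
Local Notation box := (box x0).

Definition locally_trivial (y : M) := exists e, [/\ 0 < e,
  convex_in_M A (box (set_val y) e) &
  forall x x' ox ox' (p : pth x x'),
    within p (box (set_val y) e) -> lam ox ox' p = 1].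

Section along_path.
Variables (x y : M) (p : pth x y).

Definition prefix_fun (t u : I) : M := p (clamp (unitI_val t * unitI_val u)).

Lemma prefix_cts t : continuous (prefix_fun t).
Proof.
apply: (comp_cts (g := p)); first exact: path_cts.
apply: (comp_cts (g := clamp)); first exact: clamp_continuous.
by apply: mul_cts; [exact: cst_cts|exact: unitI_val_continuous].
Qed.

Lemma prefix0 t : prefix_fun t zero = x.
Proof. by rewrite /prefix_fun Defs.val0 mulr0 clamp_le0 // path_zero. Qed.

Lemma prefix1 t : prefix_fun t one = p t.
Proof. by rewrite /prefix_fun Defs.val1 mulr1 clampK. Qed.

Definition prefix t : pth x (p t) := mk_path (@prefix_cts t) (prefix0 t) (prefix1 t).

(** By convexity [q] and [q'] may be taken to be segments. The parameter [th] then slides from [t]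
    to [t']: at each stage [p] is followed up to the parameter [th], and then the segment from there
    to [m] inside [K]. *)
Lemma prefix_slide (K : set V) (t t' : I) (m : M) (q : pth (p t) m) (q' : pth (p t') m) :
  convex_in_M A K ->
  (forall u : I, `|unitI_val u - unitI_val t| <= `|unitI_val t' - unitI_val t| ->
     K (set_val (p u))) ->
  within q K -> within q' K ->
  homotopic (concat (prefix t) q) (concat (prefix t') q').
Proof.
move=> Kc Kp qK q'K.
have Km : K (set_val m) by have := qK one; rewrite path_one.
have Kt : K (set_val (p t)) by have := qK zero; rewrite path_zero.
have Kt' : K (set_val (p t')) by have := q'K zero; rewrite path_zero.
have [r [rK rE]] := exists_seg Kc Kt Km.
have [r' [r'K r'E]] := exists_seg Kc Kt' Km.
apply: (@homotopic_trans _ _ _ _ _ (concat (prefix t) r)).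
  by apply: concat_homotopic; [exact: homotopic_refl|exact: convex_homotopic Kc qK rK].
apply: homotopic_sym; apply: (@homotopic_trans _ _ _ _ _ (concat (prefix t') r')).
  by apply: concat_homotopic; [exact: homotopic_refl|exact: convex_homotopic Kc q'K r'K].
apply: homotopic_sym.
pose th (s : I) := (1 - unitI_val s) * unitI_val t + unitI_val s * unitI_val t'.
have th01 s : 0 <= th s <= 1.
  rewrite ge_conv ?le_conv //; by rewrite ?unitI_ge0 ?unitI_le1.
have cth : continuous th.
  apply: add_cts; apply: mul_cts; try exact: cst_cts; last exact: unitI_val_continuous.
  by apply: sub_cts; [exact: cst_cts|exact: unitI_val_continuous].
have Kth s : K (set_val (p (clamp (th s)))).
  apply: Kp; rewrite clampE // (_ : th s - _ = unitI_val s * (unitI_val t' - unitI_val t)).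
    by rewrite normrM ler_piMl // ger0_norm ?unitI_ge0 ?unitI_le1.
  by rewrite /th; ring.
have FM (v : I * I) : M (line (set_val (p (clamp (th v.1)))) (set_val m)
    (unitI_val (clamp (2 * unitI_val v.2 - 1)))).
  by apply/Kc.1/Kc.2 => //; rewrite unitI_ge0 unitI_le1.
pose F (v : I * I) : M := if unitI_val v.2 <= 2^-1
  then p (clamp (th v.1 * unitI_val (clamp (2 * unitI_val v.2)))) else point (FM v).
have c2 : continuous (fun v : I * I => unitI_val v.2).
  by apply: (comp_cts (g := unitI_val)); [exact: unitI_val_continuous|exact: snd_cts].
have c1 : continuous (fun v : I * I => th v.1).
  by apply: (comp_cts (g := th)) => //; exact: fst_cts.
have cp : continuous p by exact: path_cts.
have cvc (Z : topologicalType) (f : Z -> R) : continuous f ->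
    continuous (fun z => unitI_val (clamp (f z))).
  move=> cf; apply: (comp_cts (g := unitI_val)); first exact: unitI_val_continuous.
  by apply: (comp_cts (g := clamp)) => //; exact: clamp_continuous.
exists F; split=> [|u|u|s|s].
- apply: if_continuous => //.
  + apply: (comp_cts (g := p)) => //; apply: (comp_cts (g := clamp)); first exact: clamp_continuous.
    by apply: mul_cts => //; apply: cvc; apply: mul_cts => //; exact: cst_cts.
  + apply: continuous_comp_initial; apply: line_cts.
    * apply: (comp_cts (g := fun t => set_val (p t))); first exact: path_val_cts.
      by apply: (comp_cts (g := clamp)) => //; exact: clamp_continuous.
    * exact: cst_cts.
    * by apply: cvc; apply: sub_cts; [apply: mul_cts => //; exact: cst_cts|exact: cst_cts].
  + move=> v vE; apply: eq_point; rewrite vE mulfV ?pnatr_eq0 // subrr.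
    by rewrite [clamp 0]clamp_le0 // [clamp 1]clamp_ge1 // Defs.val0 Defs.val1 line0 mulr1.
- have th0 : th zero = unitI_val t by rewrite /th Defs.val0 subr0 mul1r mul0r addr0.
  rewrite /F /= /mk_path /concat_fun; case: ifP => _; first by rewrite th0.
  by apply/esym/eq_point; rewrite rE th0 clampK.
- have th1 : th one = unitI_val t' by rewrite /th Defs.val1 subrr mul0r add0r mul1r.
  rewrite /F /= /mk_path /concat_fun; case: ifP => _; first by rewrite th1.
  by apply/esym/eq_point; rewrite r'E th1 clampK.
- have h0 : unitI_val (zero : I) <= 2^-1 = true by rewrite Defs.val0 invr_ge0 ler0n.
  rewrite /F /= h0 Defs.val0 mulr0 [clamp 0]clamp_le0 // Defs.val0 mulr0.
  by rewrite clamp_le0 // path_zero.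
- have h1 : unitI_val (one : I) <= 2^-1 = false.
    by rewrite Defs.val1; apply/negbTE; rewrite -ltNge; lra.
  rewrite /F (h1 : unitI_val (s, one).2 <= 2^-1 = false); apply/esym/eq_point.
  rewrite (Defs.val1 R : unitI_val (s, one).2 = 1) [clamp (2 * 1 - 1)]clamp_ge1; last lra.
  by rewrite Defs.val1 line1.
Qed.

Hypothesis pL : forall t, locally_trivial (p t).
Variables (ox : off (set_val x)) (oy : off (set_val y)).

(** The point [p t] may lie on a cut, where [lam] of the prefix makes no sense; hence the short
    detour [q] to a point off the cuts. *)
Let good (t : I) := forall e, 0 < e -> exists m (om : off (set_val m)) (q : pth (p t) m),
  within q (box (set_val (p t)) e) /\ lam ox om (concat (prefix t) q) = 1.

Lemma box_nbhs (t : I) e : 0 < e -> exists2 d : R, 0 < d & forall u : I,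
  `|unitI_val u - unitI_val t| < d -> box (set_val (p t)) e (set_val (p u)).
Proof.
move=> e0.
pose h H (u : R) := nform x0 H (set_val (p (clamp u))).
pose Q H : set R := [set u | `|Re (h H u) - Re (h H (unitI_val t))| < e /\
    `|Im (h H u) - Im (h H (unitI_val t))| < e].
have near_t : \forall u \near (unitI_val t : R), forall H : 'I_n, Q H u.
  apply: (@filter_forall R 'I_n Q (nbhs (unitI_val t))) => H.
  have ch : continuous (h H).
    apply: (comp_cts (g := nform x0 H)); first exact: nform_continuous.
    apply: (comp_cts (g := fun t => set_val (p t))); first exact: path_val_cts.
    exact: clamp_continuous.
  have nR := Re_cts ch (nbhsx_ballx (Re (h H (unitI_val t))) e e0).
  have nI := Im_cts ch (nbhsx_ballx (Im (h H (unitI_val t))) e e0).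
  apply: (@filterS2 _ (nbhs (unitI_val t)) _ _ _ _ _ nR nI) => u.
  by rewrite /ball /= => ? ?; split; rewrite distrC.
move: near_t => /nbhs_ballP[d /= d0 Hd]; exists d => // u ut.
have := Hd (unitI_val u); rewrite /Q /h /= !clampK => Hu H.
by apply: Hu; rewrite /ball /= distrC.
Qed.

Lemma exists_off_seg (z : M) e : 0 < e -> convex_in_M A (box (set_val z) e) ->
  exists m (om : off (set_val m)) (q : pth z m), within q (box (set_val z) e).
Proof.
move=> e0 Kc; have Mz : M (set_val z) := set_valP z.
have [m om zm] := off_dense x0 Mz e0.
have [q [qK _]] := @exists_seg _ _ _ _ _ z (point (off_complement om)) Kc (box_center _ _ e0) zm.
by exists (point (off_complement om)), om, q.
Qed.

(* The set of [t] such that [lam] is 1 on [p] restricted to [0, t] and then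
   pushed to a nearby point off the cuts is open and closed. *)
Lemma lam_locally_trivial : lam ox oy p = 1.
Proof.
(* Two detours inside one box on which [lam] is trivial give the same value, even from different
   parameters: join their ends in the box and slide. *)
have key (t : I) e0 t' (m m' : M) om om' (q : pth (p t) m) (q' : pth (p t') m') :
    convex_in_M A (box (set_val (p t)) e0) ->
    (forall x x' ox ox' (p' : pth x x'),
      within p' (box (set_val (p t)) e0) -> lam ox ox' p' = 1) ->
    (forall u : I, `|unitI_val u - unitI_val t| <= `|unitI_val t' - unitI_val t| ->
       box (set_val (p t)) e0 (set_val (p u))) ->
    within q (box (set_val (p t)) e0) -> within q' (box (set_val (p t)) e0) ->
    lam ox om (concat (prefix t) q) = lam ox om' (concat (prefix t') q').
  move=> Kc K1 Kp qK q'K.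
  have Km : box (set_val (p t)) e0 (set_val m) by have := qK one; rewrite path_one.
  have Km' : box (set_val (p t)) e0 (set_val m') by have := q'K one; rewrite path_one.
  have [r [rK _]] := exists_seg Kc Km Km'.
  rewrite -[LHS]mulr1 -(K1 _ _ om om' _ rK) -lam_concat.
  rewrite -(lam_homotopic lambda _ _ (concatA _ _ _)); apply: lam_homotopic.
  by apply: prefix_slide Kc Kp _ q'K; exact: within_concat.
have gone : good one.
  apply: (@locally_constant_I R good) => [t|].
    have [e [e0 Kc K1]] := pL t.
    (* Half the radius, so that a box of radius [e / 2] about [p t'] still lies in the box of radius
       [e] about [p t]. *)
    have e20 : 0 < e / 2 by rewrite divr_gt0.
    have [d d0 Hd] := box_nbhs t e20.
    exists d => // t' tt'.
    have e2e : e / 2 <= e by lra.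
    have Kp u : `|unitI_val u - unitI_val t| <= `|unitI_val t' - unitI_val t| ->
        box (set_val (p t)) e (set_val (p u)).
      by move=> ut; apply: (box_le e2e); apply: Hd; exact: le_lt_trans tt'.
    have sub z : box (set_val (p t')) (e / 2) z -> box (set_val (p t)) e z.
      by move=> /(box_trans (Hd _ tt')); rewrite -splitr.
    split=> [g' e' e'0|gt e' e'0].
    - have [m' [om' [q' [q'K q'1]]]] := g' _ e20.
      have m0 : 0 < Num.min e e' by rewrite lt_min e0.
      have le_e : Num.min e e' <= e by rewrite ge_min lexx.
      have le_e' : Num.min e e' <= e' by rewrite ge_min lexx orbT.
      have Kc' : convex_in_M A (box (set_val (p t)) (Num.min e e')).
        by split=> [z /(box_le le_e)/Kc.1//|a b s]; exact: box_convex.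
      have [m [om [q qK]]] := exists_off_seg m0 Kc'.
      exists m, om, q; split; first by move=> u; exact: (box_le le_e').
      rewrite (key t e t' m m' om om' q q') //.
      + by move=> u; exact: (box_le le_e).
      + by move=> u; exact: sub.
    - have [m [om [q [qK q1]]]] := gt _ e0.
      have m0 : 0 < Num.min (e / 2) e' by rewrite lt_min e20.
      have le_e : Num.min (e / 2) e' <= e / 2 by rewrite ge_min lexx.
      have le_e' : Num.min (e / 2) e' <= e' by rewrite ge_min lexx orbT.
      have Kc' : convex_in_M A (box (set_val (p t')) (Num.min (e / 2) e')).
        split=> [z /(box_le le_e)/sub/Kc.1//|a b s]; exact: box_convex.
      have [m' [om' [q' q'K]]] := exists_off_seg m0 Kc'.
      exists m', om', q'; split; first by move=> u; exact: (box_le le_e').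
      rewrite -(key t e t' m m' om om' q q') //.
      by move=> u; apply/sub/(box_le le_e).
  move=> e e0; have o0 : off (set_val (p zero)) by rewrite path_zero.
  exists (p zero), o0, (const_path R (p zero)); split; first by move=> u; exact: box_center.
  apply: lam_off; apply: within_concat => u //.
  by rewrite /= /mk_path /prefix_fun Defs.val0 mul0r clamp_le0.
have [e [e0 Kc K1]] := pL one.
have [m [om [q [qK q1]]]] := gone _ e0.
have o1 : off (set_val (p one)) by rewrite path_one.
have <- : lam ox o1 (prefix one) = lam ox oy p.
  apply: lam_eq; first exact: path_one.
  by move=> u; rewrite /= /mk_path /prefix_fun Defs.val1 mul1r clampK.
by rewrite -q1 (lam_concat lambda ox o1 om) (K1 _ _ o1 om q) // mulr1.
Qed.

End along_path.
End continuation.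

(** * A loop around one hyperplane and the crossing of its cut *)

Lemma circle_quarters (R : realType) (t : R) : 0 <= t <= 1 ->
  let c := cos (2 * pi * t) in let s := sin (2 * pi * t) in
  [/\ c ^+ 2 + s ^+ 2 = 1,
      t <= 4^-1 -> 0 <= c /\ 0 <= s,
      4^-1 <= t <= 2^-1 -> c <= 0 /\ 0 <= s,
      2^-1 <= t <= 3 / 4 -> c <= 0 /\ s <= 0 &
      3 / 4 <= t -> 0 <= c /\ s <= 0].
Proof.
move=> /andP[t0 t1] c s; have p0 := pi_gt0 R.
have q1 x : 0 <= x <= pi / 2 -> 0 <= cos x /\ 0 <= sin x :> R.
  move=> /andP[x0' x1]; split; first by apply: cos_ge0_pihalf; apply/andP; split; lra.
  by apply: sin_ge0_pi; apply/andP; split; lra.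
have q2 x : pi / 2 <= x <= pi -> cos x <= 0 /\ 0 <= sin x :> R.
  move=> /andP[x0' x1]; split; last by apply: sin_ge0_pi; apply/andP; split; lra.
  have -> : x = (x - pi) + pi by ring.
  by rewrite cosDpi oppr_le0; apply: cos_ge0_pihalf; apply/andP; split; lra.
have sh : 2 * pi * t = 2 * pi * (t - 2^-1) + pi by field.
split=> [|h|/andP[h1 h2]|/andP[h1 h2]|h].
- exact: cos2Dsin2.
- by apply: q1; apply/andP; split; nra.
- by apply: q2; apply/andP; split; nra.
- have [|u v] := q1 (2 * pi * (t - 2^-1)); first by apply/andP; split; nra.
  by rewrite /c /s sh cosDpi sinDpi !oppr_le0.
- have [|u v] := q2 (2 * pi * (t - 2^-1)); first by apply/andP; split; nra.
  by rewrite /c /s sh cosDpi sinDpi oppr_ge0 oppr_le0.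
Qed.

(** Some real linear form is positive at both points, so the segment between them misses the
    origin. *)
Definition same_side (R : realType) (a b a' b' : R) := exists u v,
  0 < u * a + v * b /\ 0 < u * a' + v * b'.

(* The vertices 1, i, -1 + i, -i avoid the cut ]-oo, 0], and only the third side
   crosses it. *)
Definition polygon (R : realType) (u : R) : R * R :=
  if u <= 2^-1 then
    if 2 * u <= 2^-1 then (1 - 2 * (2 * u), 2 * (2 * u)) else (- (2 * (2 * u) - 1), 1)
  else if 2 * u - 1 <= 2^-1 then
    (2 * (2 * u - 1) - 1, 1 - 2 * (2 * (2 * u - 1)))
  else (2 * (2 * u - 1) - 1, 2 * (2 * u - 1) - 1 - 1).

Lemma polygon_le1 (R : realType) (u : R) : 0 <= u <= 1 ->
  `|(polygon u).1| <= 1 /\ `|(polygon u).2| <= 1.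
Proof.
case/andP=> u0 u1; rewrite /polygon; case: (leP u 2^-1) => h.
- by case: (leP (2 * u) 2^-1) => h2; split; rewrite /= ler_norml; apply/andP; split; lra.
- by case: (leP (2 * u - 1) 2^-1) => h2; split; rewrite /= ler_norml; apply/andP; split; lra.
Qed.

(** Each quarter of the circle shares an open half-plane with the side of the polygon run through at
    the same time. *)
Lemma polygon_circle (R : realType) (u : R) : 0 <= u <= 1 ->
  same_side (cos (2 * pi * u)) (sin (2 * pi * u)) (polygon u).1 (polygon u).2.
Proof.
move=> u01; have [] := circle_quarters u01.
move: (cos _) (sin _) => x z xz q1 q2 q3 q4; case/andP: u01 => u0 u1.
rewrite /polygon; case: (leP u 2^-1) => h;
  [case: (leP (2 * u) 2^-1) => h2 /=|case: (leP (2 * u - 1) 2^-1) => h2 /=].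
- have [|x0 z0] := q1; first lra.
  by exists 1, 1; split; nra.
- have [|x0 z0] := q2; first by apply/andP; split; lra.
  by exists (-1), 1; split; nra.
- have [|x0 z0] := q3; first by apply/andP; split; lra.
  (* The form -x - y suggested by the quadrant vanishes at the vertex -1 + i; -2x - y is positive
     there as well. *)
  by exists (-2), (-1); split; nra.
- have [|x0 z0] := q4; first lra.
  by exists 1, (-1); split; nra.
Qed.

(** * The complex line through a wall point in the direction of the base point *)

Section wall_crossing.
Variables (R : realType) (l n : nat) (A : arrangement R l n) (x0 : complement A).
Local Notation C := (CC R).
Local Notation I := (unitI R).
Local Notation V := 'rV[C]_l.
Local Notation M := (complement A).
Local Notation pth x y := {path I from x to y in M}.
Local Notation off := (off x0).
Local Notation g := (nform x0).

Section circle.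
Variables (y : M) (e : R) (H : 'I_n) (d : R).
Hypotheses (ye : margin x0 (set_val y) e) (Hy : ~ off_cut (g H (set_val y))).
Hypothesis (H'y : forall H', H' <> H -> off_cut (g H' (set_val y))).
Hypotheses (d0 : 0 < d) (de : d < e).

Let r := - Re (g H (set_val y)).

Lemma cut_Im : Im (g H (set_val y)) = 0.
Proof. by apply: contrapT => i0; apply: Hy; left. Qed.

Lemma cut_gt0 : d < r.
Proof.
have := margin_box_cut (set_valP y) ye (box_center _ _ ye.1) Hy.
move=> r0; have := (ye.2 H).2 cut_Im; rewrite ltr0_norm // => er.
exact: lt_le_trans de er.
Qed.

(* The line through [y] in direction [x0], with coordinates in which it meets
   [H] at the origin. *)
Definition slice (a b : R) : V := set_val y + ((r + d * a) +i* (d * b))%C *: set_val x0.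

Lemma nform_slice H' a b : g H' (slice a b) =
  g H' (set_val y) + ((r + d * a) +i* (d * b))%C.
Proof. by rewrite nformD nformZ nform_base mulr1. Qed.

Lemma nform_sliceH a b : g H (slice a b) = ((d * a) +i* (d * b))%C.
Proof.
rewrite nform_slice; apply: eqC; rewrite ?ReD ?ImD /= ?cut_Im ?add0r //.
by rewrite /r; ring.
Qed.

(** The displacement from [y] has real part [r + d * a] and imaginary part [d * b]. A nonnegative
    real part keeps the positive g_{H'}(y) positive, and an imaginary part of size at most [d < e]
    cannot cancel a nonzero imaginary part of g_{H'}(y). *)
Definition strip (a b : R) := 0 <= r + d * a /\ `|b| <= 1.

Lemma slice_off_other H' a b : strip a b -> H' <> H -> off_cut (g H' (slice a b)).
Proof.
move=> [ra b1] HH'; rewrite nform_slice /off_cut ReD ImD /=.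
have [i0|i0] := pselect (Im (g H' (set_val y)) = 0).
- by case: (H'y HH') => // r0; right; rewrite ltr_wpDr.
- left => i1; have := (ye.2 H').1 i0; have -> : Im (g H' (set_val y)) = - (d * b) by lra.
  rewrite normrN normrM gtr0_norm // => ed.
  have bd : d * `|b| <= d by rewrite ler_piMr // ltW.
  by move: (lt_le_trans de (le_trans ed bd)); rewrite ltxx.
Qed.

Lemma slice_M a b : strip a b -> (a <> 0 \/ b <> 0) -> M (slice a b).
Proof.
move=> s ab; apply/(complementP x0) => H'; have [->|/eqP HH'] := eqVneq H' H.
- rewrite nform_sliceH; apply/eqP => /eqP; rewrite eq_complex /= !mulf_eq0.
  by rewrite gt_eqF //= => /andP[/eqP a0 /eqP b0]; case: ab.
- exact/off_cut_neq0/slice_off_other.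
Qed.

Lemma slice_off a b : strip a b -> (0 < a \/ b <> 0) -> off (slice a b).
Proof.
move=> s ab H'; have [->|/eqP HH'] := eqVneq H' H; last exact: slice_off_other.
rewrite nform_sliceH /off_cut /=; case: ab => [a0|b0]; [right|left].
- exact: mulr_gt0.
- by apply/eqP; rewrite mulf_eq0 gt_eqF //=; exact/eqP.
Qed.

Lemma line_slice a b a' b' s : line (slice a b) (slice a' b') s =
  slice ((1 - s) * a + s * a') ((1 - s) * b + s * b').
Proof.
rewrite /line /slice !scalerDr addrACA -scalerDl -rcD subrK rc1 scale1r.
rewrite !scalerA -scalerDl; congr (_ + _ *: _).
by apply: eqC; rewrite ?ReD ?ImD ?ReMr ?ImMr /=; ring.
Qed.

Lemma strip_conv a b a' b' s : strip a b -> strip a' b' -> 0 <= s <= 1 ->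
  strip ((1 - s) * a + s * a') ((1 - s) * b + s * b').
Proof.
move=> [a0 b1] [a'0 b'1] s01; split.
- rewrite (_ : r + _ = (1 - s) * (r + d * a) + s * (r + d * a')); last by ring.
  exact: ge_conv.
- move: b1 b'1; rewrite !ler_norml => /andP[b1 b2] /andP[b'1 b'2].
  by rewrite ge_conv // le_conv.
Qed.

Lemma line_slice_M a b a' b' s : strip a b -> strip a' b' -> same_side a b a' b' ->
  0 <= s <= 1 -> M (line (slice a b) (slice a' b') s).
Proof.
move=> sz sw [u [v [p q]]] s01; rewrite line_slice; apply: slice_M; first exact: strip_conv.
have := gt_conv p q s01.
rewrite (_ : (1 - s) * (u * a + v * b) + s * (u * a' + v * b') =
  u * ((1 - s) * a + s * a') + v * ((1 - s) * b + s * b')); last by ring.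
move: (_ + s * a') (_ + s * b') => a2 b2 pos; apply: contrapT => /not_orP[/contrapT az /contrapT bz].
by move: pos; rewrite az bz !mulr0 addr0 ltxx.
Qed.

Lemma slice_seg a b a' b' (zM : M (slice a b)) (wM : M (slice a' b')) :
  strip a b -> strip a' b' -> same_side a b a' b' ->
  exists p : pth (point zM) (point wM), forall t, set_val (p t) =
    slice ((1 - unitI_val t) * a + unitI_val t * a') ((1 - unitI_val t) * b + unitI_val t * b').
Proof.
move=> sz sw ss.
have zwM s : 0 <= s <= 1 -> M (line (set_val (point zM)) (set_val (point wM)) s).
  exact: line_slice_M.
by exists (seg zwM) => t; rewrite segE !pointK line_slice.
Qed.


Lemma hyperplaneE H' x : (x \in hyperplane A H') = (g H' x == 0).
Proof. by rewrite memv_ker /nform mulf_eq0 invr_eq0 (negbTE (formv_neq0 _ _)) orbF. Qed.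

Lemma slice_disc (z : C) :
  slice 0 0 + z *: (rc d *: set_val x0) = slice (Re z) (Im z).
Proof.
rewrite /slice -addrA scalerA -scalerDl; congr (_ + _ *: _).
by rewrite [z * _]mulrC; apply: eqC; rewrite ?ReD ?ImD ?ReMr ?ImMr /=; ring.
Qed.

Lemma strip_unit a b : `|a| <= 1 -> `|b| <= 1 -> strip a b.
Proof.
move=> a1 b1; split => //; have dr := cut_gt0.
have : d * - a <= d * 1.
  by rewrite ler_pM2l //; move: a1; rewrite ler_norml => /andP[]; lra.
by rewrite mulr1 mulrN; move: dr; rewrite -/r => dr; lra.
Qed.

Variable lambda : character R (pi1 R x0).
Hypothesis lambda_meridian : forall H g, meridian H g -> lambda g = 1.
Local Notation lam := (lam lambda).

Let unit1 : `|1 : R| <= 1. Proof. by rewrite normr1. Qed.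
Let unit0 : `|0 : R| <= 1. Proof. by rewrite normr0. Qed.
Let unitN : `|-1 : R| <= 1. Proof. by rewrite normrN1. Qed.

Definition circle_fun (t : I) : V :=
  slice (Re (expi (2 * pi * unitI_val t))) (Im (expi (2 * pi * unitI_val t))).

Lemma expi_le1 (x : R) : `|Re (expi x)| <= 1 /\ `|Im (expi x)| <= 1.
Proof. by split; rewrite ler_norml ?cos_geN1 ?cos_le1 ?sin_geN1 ?sin_le1. Qed.

Lemma circle_strip x : strip (Re (expi x)) (Im (expi x)).
Proof. by apply: strip_unit; have [] := expi_le1 x. Qed.

Lemma circle_funM t : M (circle_fun t).
Proof.
apply: slice_M; first exact: circle_strip.
have : Re (expi (2 * pi * unitI_val t)) ^+ 2 + Im (expi (2 * pi * unitI_val t)) ^+ 2 = 1.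
  exact: cos2Dsin2.
apply: contraPP => /not_orP[/contrapT -> /contrapT ->].
by rewrite expr0n addr0 => /eqP; rewrite eq_sym oner_eq0.
Qed.

Lemma circle_fun_cts : continuous circle_fun.
Proof.
have ce : continuous (fun t : I => expi (2 * pi * unitI_val t)).
  by apply: expi_cts; apply: mul_cts; [exact: cst_cts|exact: unitI_val_continuous].
apply: affine_cts; apply: cplx_cts; [apply: add_cts; first exact: cst_cts|].
- by apply: mul_cts; [exact: cst_cts|exact: Re_cts ce].
- by apply: mul_cts; [exact: cst_cts|exact: Im_cts ce].
Qed.

Section polygon_loop.
Variables (b1M : M (slice 1 0)) (b2M : M (slice 0 1)) (b3M : M (slice (-1) 1))
   (b4M : M (slice 0 (-1)))
   (p1 : pth (point b1M) (point b2M)) (p2 : pth (point b2M) (point b3M))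
   (p3 : pth (point b3M) (point b4M)) (p4 : pth (point b4M) (point b1M))
   (o1 : off (set_val (point b1M))) (o2 : off (set_val (point b2M)))
   (o3 : off (set_val (point b3M))) (o4 : off (set_val (point b4M))).
Hypotheses
  (p1E : forall t, set_val (p1 t) = slice (1 - unitI_val t) (unitI_val t))
  (p2E : forall t, set_val (p2 t) = slice (- unitI_val t) 1)
  (p3E : forall t, set_val (p3 t) = slice (unitI_val t - 1) (1 - 2 * unitI_val t))
  (p4E : forall t, set_val (p4 t) = slice (unitI_val t) (unitI_val t - 1)).

Lemma circle_fun0 : circle_fun zero = set_val (point b1M).
Proof. by rewrite /circle_fun Defs.val0 mulr0 expi0. Qed.

Lemma circle_fun1 : circle_fun one = set_val (point b1M).
Proof. by rewrite /circle_fun Defs.val1 mulr1 expi_2pi. Qed.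

Definition circle_path : pth (point b1M) (point b1M) :=
  curve circle_fun_cts circle_funM circle_fun0 circle_fun1.

Lemma circle_pathE t : set_val (circle_path t) = circle_fun t.
Proof. by rewrite curveE. Qed.

Lemma slice_eq0 a b H' : strip a b -> slice a b \in hyperplane A H' ->
  H' = H /\ a = 0 /\ b = 0.
Proof.
move=> sab; rewrite hyperplaneE => /eqP zH'.
have HH' : H' = H.
  apply: contrapT => HH'.
  by have /off_cut_neq0 := slice_off_other sab HH'; rewrite zH' eqxx.
split; first exact: HH'.
apply: contrapT => ab0.
have : M (slice a b).
  apply: slice_M; first exact: sab.
  by apply: contrapT => /not_orP[/contrapT a0 /contrapT b0]; apply: ab0.
by move=> /(complementP x0)/(_ H'); rewrite zH' eqxx.
Qed.

(** With the tail of its base point on either side, the circle is literally a meridian: its disc is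
    centred at the point [slice 0 0] of H and, by [slice_eq0], meets the arrangement only there. *)
Lemma lam_circle : lam o1 o1 circle_path = 1.
Proof.
apply: (lambda_meridian (H := H)).
exists (slice 0 0), (rc d *: set_val x0), (point b1M), (tail o1), circle_path; split.
- by rewrite hyperplaneE nform_sliceH mulr0.
- move=> z H' z1; rewrite slice_disc => zH'.
  have Rz : `|Re z| <= 1 by rewrite -lecR; exact: le_trans (normc_ge_Re z) z1.
  have Iz : `|Im z| <= 1 by rewrite -lecR; exact: le_trans (normc_ge_Im z) z1.
  have [HH' [R0 I0]] := slice_eq0 (strip_unit Rz Iz) zH'.
  by split; [exact: HH'|exact: eqC].
- move=> t; rewrite slice_disc; exact: circle_pathE.
- by [].
Qed.

Lemma polygonE t : set_val (concat (concat p1 p2) (concat p3 p4) t) =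
  slice (polygon (unitI_val t)).1 (polygon (unitI_val t)).2.
Proof.
have t0 := unitI_ge0 t; have t1 := unitI_le1 t.
rewrite [concat _ _ t]/(concat_fun _ _ t) /concat_fun /polygon.
move: (unitI_val t) t0 t1 => u u0 u1.
case: (leP u 2^-1) => h.
- rewrite [concat _ _ _]/(concat_fun _ _ _) /concat_fun clampE; last by apply/andP; split; lra.
  case: (leP (2 * u) 2^-1) => h2; rewrite (p1E, p2E) clampE //; by apply/andP; split; lra.
- rewrite [concat _ _ _]/(concat_fun _ _ _) /concat_fun clampE; last by apply/andP; split; lra.
  case: (leP (2 * u - 1) 2^-1) => h2; rewrite (p3E, p4E) clampE //; by apply/andP; split; lra.
Qed.

(** The straight homotopy from the polygon to the circle stays in [strip] and, by [polygon_circle],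
    misses the centre. *)
Lemma lam_polygon :
  lam o1 o2 p1 * lam o2 o3 p2 * (lam o3 o4 p3 * lam o4 o1 p4) = 1.
Proof.
rewrite -lam_circle -!lam_concat.
apply: lam_homotopic; apply: homotopic_sym; apply: straight_homotopic => t s s01.
have t01 : 0 <= unitI_val t <= 1 by rewrite unitI_ge0 unitI_le1.
rewrite circle_pathE polygonE; apply: line_slice_M s01.
- exact: circle_strip.
- by apply: strip_unit; have [] := polygon_le1 t01.
- exact: polygon_circle.
Qed.

End polygon_loop.
(** The first, second and fourth sides of the polygon avoid the cuts, so the third has value 1. The
    path [q], which crosses the cut at [y] itself, is homotopic to [q1], the third side and [q2],
    where [q1] and [q2] also avoid the cuts. *)
Lemma lam_crossing (uM : M (slice (- (r / d)) 1)) (wM : M (slice (- (r / d)) (-1)))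
    (ou : off (set_val (point uM))) (ow : off (set_val (point wM)))
    (q : pth (point uM) (point wM)) :
  (forall t, set_val (q t) = slice (- (r / d)) (1 - 2 * unitI_val t)) ->
  lam ou ow q = 1.
Proof.
move=> qE.
have dr : 1 < r / d by rewrite ltr_pdivlMr // mul1r; exact: cut_gt0.
have su b : `|b| <= 1 -> strip (- (r / d)) b.
  by move=> b1; split=> //; rewrite mulrN mulrC divfK ?gt_eqF // subrr.
have s1 := strip_unit unit1 unit0; have s2 := strip_unit unit0 unit1.
have s3 := strip_unit unitN unit1; have s4 := strip_unit unit0 unitN.
have su1 := su _ unit1; have su2 := su _ unitN.
have n1 : (1 : R) <> 0 by apply/eqP; rewrite oner_eq0.
have nN : (-1 : R) <> 0 by apply/eqP; rewrite oppr_eq0 oner_eq0.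
have o1 : off (slice 1 0) by apply: slice_off s1 _; left; exact: ltr01.
have o2 : off (slice 0 1) by apply: slice_off s2 _; right.
have o3 : off (slice (-1) 1) by apply: slice_off s3 _; right.
have o4 : off (slice 0 (-1)) by apply: slice_off s4 _; right.
have M1 := off_complement o1; have M2 := off_complement o2.
have M3 := off_complement o3; have M4 := off_complement o4.
have [|p1 p1E] := slice_seg M1 M2 s1 s2; first by exists 1, 1; split; lra.
have [|p2 p2E] := slice_seg M2 M3 s2 s3; first by exists 0, 1; split; lra.
have [|p3 p3E] := slice_seg M3 M4 s3 s4; first by exists (-2), (-1); split; lra.
have [|p4 p4E] := slice_seg M4 M1 s4 s1; first by exists 1, (-1); split; lra.
have [|q1 q1E] := slice_seg uM M3 su1 s3; first by exists 0, 1; split; lra.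
have [|q2 q2E] := slice_seg M4 wM s4 su2; first by exists 0, (-1); split; lra.
have strip_line a b a' b' (t : I) : strip a b -> strip a' b' ->
    strip ((1 - unitI_val t) * a + unitI_val t * a') ((1 - unitI_val t) * b + unitI_val t * b').
  by move=> sz sw; apply: strip_conv => //; rewrite unitI_ge0 unitI_le1.
have off1 : within p1 off.
  move=> t; rewrite p1E; apply: slice_off; first exact: strip_line.
  have [->|t0] := eqVneq (unitI_val t) 0; first by left; lra.
  by right; apply/eqP; rewrite mulr0 add0r mulr1.
have off4 : within p4 off.
  move=> t; rewrite p4E; apply: slice_off; first exact: strip_line.
  have [->|t0] := eqVneq (unitI_val t) 1; first by left; lra.
  by right; apply/eqP; rewrite mulr0 addr0 mulrN1 oppr_eq0 subr_eq0 eq_sym.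
have off2 : within p2 off.
  by move=> t; rewrite p2E; apply: slice_off; [exact: strip_line|right; lra].
have offq1 : within q1 off.
  by move=> t; rewrite q1E; apply: slice_off; [exact: strip_line|right; lra].
have offq2 : within q2 off.
  by move=> t; rewrite q2E; apply: slice_off; [exact: strip_line|right; lra].
have lam3 : lam (o3 : off (set_val (point M3))) (o4 : off (set_val (point M4))) p3 = 1.
  have := @lam_polygon M1 M2 M3 M4 p1 p2 p3 p4 o1 o2 o3 o4.
  rewrite (lam_off lambda _ _ off1) (lam_off lambda _ _ off2) (lam_off lambda _ _ off4).
  rewrite !mul1r mulr1; apply=> t.
  - by rewrite p1E; congr slice; ring.
  - by rewrite p2E; congr slice; ring.
  - by rewrite p3E; congr slice; ring.
  - by rewrite p4E; congr slice; ring.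
(* The half-plane -2a - b > 0 excludes the origin; it contains the third side and, as r / d > 1, the
   path through [y]. *)
pose K : set V := [set v | exists a b, [/\ v = slice a b, strip a b & 0 < - 2 * a - b]].
have Kc : convex_in_M A K.
  split=> [v [a [b [-> sab ab]]]|v w s [a [b [-> sab ab]]] [a' [b' [-> sab' ab']]] s01].
    apply: slice_M => //; apply: contrapT => /not_orP[/contrapT a0 /contrapT b0].
    by move: ab; rewrite a0 b0; lra.
  exists ((1 - s) * a + s * a'), ((1 - s) * b + s * b'); split.
  - exact: line_slice.
  - exact: strip_conv.
  - rewrite (_ : _ - _ = (1 - s) * (- 2 * a - b) + s * (- 2 * a' - b')); last by ring.
    exact: gt_conv.
have Kline a b a' b' (t : I) : strip a b -> strip a' b' -> 0 < - 2 * a - b -> 0 < - 2 * a' - b' ->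
    K (slice ((1 - unitI_val t) * a + unitI_val t * a') ((1 - unitI_val t) * b + unitI_val t * b')).
  move=> sab sab' ab ab'; rewrite -line_slice; apply: Kc.2.
  - by exists a, b.
  - by exists a', b'.
  - by rewrite unitI_ge0 unitI_le1.
have Kq : within q K.
  move=> t; rewrite qE (_ : slice _ _ = slice ((1 - unitI_val t) * - (r / d) +
      unitI_val t * - (r / d)) ((1 - unitI_val t) * 1 + unitI_val t * (-1))).
    by apply: Kline => //; lra.
  by congr slice; ring.
have Kq1 : within q1 K by move=> t; rewrite q1E; apply: Kline => //; lra.
have Kp3 : within p3 K by move=> t; rewrite p3E; apply: Kline => //; lra.
have Kq2 : within q2 K by move=> t; rewrite q2E; apply: Kline => //; lra.
rewrite (lam_convex lambda _ _ Kc Kq (within_concat (within_concat Kq1 Kp3) Kq2)).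
rewrite (lam_concat lambda ou (o4 : off (set_val (point M4))) ow).
rewrite (lam_concat lambda ou (o3 : off (set_val (point M3))) (o4 : off (set_val (point M4)))).
by rewrite lam3 (lam_off lambda _ _ offq1) (lam_off lambda _ _ offq2) !mul1r.
Qed.

Lemma slice_wall b : slice (- (r / d)) b = set_val y + (0 +i* (d * b))%C *: set_val x0.
Proof.
rewrite /slice (_ : r + d * - (r / d) = 0) //.
by rewrite mulrN mulrC divfK ?gt_eqF // subrr.
Qed.

End circle.
End wall_crossing.

(** * Generic real perturbations *)

Section perturbation.
Variable R : realType.

Lemma small_avoid (J : finType) (a b : J -> R) : (forall j, a j <> 0 \/ b j <> 0) ->
  exists2 e : R, 0 < e & forall t, 0 < t < e -> forall j, a j + t * b j <> 0.
Proof.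
move=> ab.
(* A zero of [a j + t * b j] has absolute value |a j| / |b j| when [b j] is nonzero; the added 1
   also covers [b j = 0]. If [a j = 0] the only zero is at 0 and any positive bound serves. *)
have [|e e0 He] := @finite_min R J (fun j => if a j == 0 then 1 else `|a j| / (`|b j| + 1)).
  move=> j; case: eqP => [//|/eqP a0].
  by rewrite divr_gt0 ?normr_gt0 // ltr_wpDl.
exists e => // t /andP[t0 te] j; have := He j.
case: eqP => [a0 _|/eqP a0 ej].
  rewrite a0 add0r; case: (ab j) => // b0; apply/eqP; rewrite mulf_eq0 gt_eqF //=.
  exact/eqP.
move=> /eqP; rewrite addr_eq0 => /eqP aE.
have b1 : 0 < `|b j| + 1 by rewrite ltr_wpDl.
have : `|a j| = t * `|b j| by rewrite aE normrN normrM gtr0_norm.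
move: ej; rewrite ler_pdivlMr // => ej aE'.
have : t * `|b j| < e * (`|b j| + 1).
  by apply: (@lt_le_trans _ _ (t * (`|b j| + 1))); [rewrite ltr_pM2l // ltrDl|rewrite ler_pM2r // ltW].
by rewrite -aE' ltNge ej.
Qed.

Lemma small_lt (J : finType) (b : J -> R) (c : R) : 0 < c ->
  exists2 e : R, 0 < e & forall t, 0 < t < e -> forall j, `|t * b j| < c.
Proof.
move=> c0; have [|e e0 He] := @finite_min R J (fun j => c / (`|b j| + 1)).
  by move=> j; rewrite divr_gt0 // ltr_wpDl.
exists e => // t /andP[t0 te] j; rewrite normrM gtr0_norm //.
have b1 : 0 < `|b j| + 1 by rewrite ltr_wpDl.
have := He j; rewrite ler_pdivlMr //; apply: lt_le_trans.
by apply: (@lt_le_trans _ _ (t * (`|b j| + 1))); [rewrite ltr_pM2l // ltrDl|rewrite ler_pM2r // ltW].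
Qed.

Lemma pos_below (a b : R) : 0 < a -> 0 < b -> exists2 t, 0 < t < a & t < b.
Proof.
move=> a0 b0; exists (Num.min a b / 2).
  apply/andP; split; first by rewrite divr_gt0 // lt_min a0.
  by rewrite ltr_pdivrMr // gt_min; apply/orP; left; lra.
by rewrite ltr_pdivrMr // gt_min; apply/orP; right; lra.
Qed.

Variables (l : nat).
Local Notation V := 'rV[CC R]_l.

(** Induction on the list of forms: a short step in a direction where the new form is nonzero makes
    it nonzero without killing the earlier ones. *)
Lemma generic_vector (J : finType) (f : J -> V -> R) :
  (forall j v w t, f j (v + rc t *: w) = f j v + t * f j w) ->
  (forall j, exists v, f j v <> 0) -> exists w, forall j, f j w <> 0.
Proof.
move=> fD fn0.
suff [w Hw] : exists w, forall j, j \in enum J -> f j w <> 0.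
  by exists w => j; apply: Hw; rewrite mem_enum.
elim: (enum J) => [|k r [w Hw]]; first by exists 0.
have [v kv] := fn0 k.
(* The value 1 masks the forms not yet treated. *)
have [|e e0 He] := @small_avoid J
  (fun j => if j \in k :: r then f j w else 1) (fun j => if j \in k :: r then f j v else 1).
  move=> j; rewrite inE; case: eqP => [->|_] /=; first by right.
  case: ifP => jr; first by left; exact: Hw.
  by left; apply/eqP; rewrite oner_eq0.
exists (w + rc (e / 2) *: v) => j jr; have := He (e / 2) _ j.
rewrite jr fD; apply; apply/andP; split; lra.
Qed.

End perturbation.

(** * Characters trivial on meridians are trivial *)

Section meridians_generate.
Variables (R : realType) (l n : nat) (A : arrangement R l n) (x0 : complement A).
Local Notation C := (CC R).
Local Notation I := (unitI R).
Local Notation V := 'rV[C]_l.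
Local Notation M := (complement A).
Local Notation pth x y := {path I from x to y in M}.
Local Notation off := (off x0).
Local Notation g := (nform x0).
Local Notation box := (box x0).
Variable lambda : character R (pi1 R x0).
Hypothesis lambda_meridian : forall H g, meridian H g -> lambda g = 1.
Local Notation lam := (lam lambda).

Lemma box_open y e z : box y e z -> exists2 e', 0 < e' & box z e' `<=` box y e.
Proof.
move=> yz.
have [|e1 e10 He1] := @finite_min R 'I_n (fun H => e - `|Re (g H z) - Re (g H y)|).
  by move=> H; rewrite subr_gt0; have [] := yz H.
have [|e2 e20 He2] := @finite_min R 'I_n (fun H => e - `|Im (g H z) - Im (g H y)|).
  by move=> H; rewrite subr_gt0; have [] := yz H.
exists (Num.min e1 e2); first by rewrite lt_min e10.
move=> x zx H; have [a b] := zx H; move: a b; rewrite !lt_min => /andP[a _] /andP[_ b].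
have {}He1 := He1 H; have {}He2 := He2 H.
split.
- rewrite (_ : _ - _ = (Re (g H x) - Re (g H z)) + (Re (g H z) - Re (g H y))); last by ring.
  by apply: le_lt_trans (ler_normD _ _) _; rewrite -ltrBrDr; exact: lt_le_trans He1.
- rewrite (_ : _ - _ = (Im (g H x) - Im (g H z)) + (Im (g H z) - Im (g H y))); last by ring.
  by apply: le_lt_trans (ler_normD _ _) _; rewrite -ltrBrDr; exact: lt_le_trans He2.
Qed.

(** If no cut passes through [y], the whole box is off the cuts. If one does, the box is off the
    cuts exactly where Im g_H is nonzero: [lam] is trivial on each of the two convex halves, and a
    path from one half to the other can be routed through the path of [lam_crossing]. *)
Lemma locally_trivial_tame (y : M) :
  (forall H H', ~ off_cut (g H (set_val y)) -> ~ off_cut (g H' (set_val y)) -> H = H') ->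
  locally_trivial lambda y.
Proof.
move=> tame; have [e ye] := margin_exists x0 (set_valP y); have e0 := ye.1.
have Kc := margin_box (set_valP y) ye.
exists e; split=> // x x' ox ox' p Kp.
have [allo|/existsNP[H Hy]] := pselect (forall H, off_cut (g H (set_val y))).
  by apply: lam_off => t H; exact: margin_box_off ye (Kp t) (allo H).
have H'y H' : H' <> H -> off_cut (g H' (set_val y)).
  by move=> HH'; apply: contrapT => nH'; apply: HH'; exact: tame.
have e20 : 0 < e / 2 by rewrite divr_gt0.
have e2e : e / 2 < e by lra.
have Hneg z : box (set_val y) e z -> Re (g H z) < 0.
  by move=> Kz; exact: margin_box_cut (set_valP y) ye Kz Hy.
have off_of z : box (set_val y) e z -> Im (g H z) <> 0 -> off z.
  move=> Kz Iz H'; have [->|/eqP HH'] := eqVneq H' H; first by left.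
  exact: margin_box_off ye Kz (H'y _ HH').
have Im_of z : box (set_val y) e z -> off z -> Im (g H z) <> 0.
  by move=> Kz /(_ H)[//|]; have := Hneg _ Kz => r1 r2; have := lt_trans r1 r2; rewrite ltxx.
pose d := e / 2.
have gw H' b : g H' (slice x0 y H d (- (- Re (g H (set_val y)) / d)) b) =
    g H' (set_val y) + (0 +i* (d * b))%C.
  by rewrite (slice_wall x0 y H e20) nformD nformZ nform_base mulr1.
have K_of b : `|b| <= 1 -> box (set_val y) e (slice x0 y H d (- (- Re (g H (set_val y)) / d)) b).
  move=> b1 H'; rewrite gw ReD ImD /= addr0 subrr normr0; split; first exact: e0.
  rewrite addrAC subrr add0r normrM gtr0_norm // (le_lt_trans _ e2e) //.
  by rewrite ler_piMr // ltW.
have IH b : Im (g H (slice x0 y H d (- (- Re (g H (set_val y)) / d)) b)) = d * b.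
  by rewrite gw ImD (cut_Im Hy) add0r.
have n1 : `|1 : R| <= 1 by rewrite normr1.
have nN : `|-1 : R| <= 1 by rewrite normrN1.
have Ku := K_of _ n1; have Kw := K_of _ nN.
have uM := Kc.1 _ Ku; have wM := Kc.1 _ Kw.
have ou : off (set_val (point uM)).
  by apply: (off_of _ Ku); rewrite IH mulr1; apply/eqP; rewrite gt_eqF.
have ow : off (set_val (point wM)).
  by apply: (off_of _ Kw); rewrite IH mulrN1; apply/eqP; rewrite oppr_eq0 gt_eqF.
have [q [Kq qE]] := @exists_seg _ _ _ _ _ (point uM) (point wM) Kc Ku Kw.
have lamq : lam ou ow q = 1.
  apply: (lam_crossing ye Hy H'y e20 e2e lambda_meridian) => t.
  by rewrite qE line_slice; congr slice; ring.
have Iu : 0 < Im (g H (set_val (point uM))) by rewrite [X in 0 < X]IH mulr1.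
have Iw : Im (g H (set_val (point wM))) < 0 by rewrite [X in X < 0]IH mulrN1 oppr_lt0.
have Kx : box (set_val y) e (set_val x) by have := Kp zero; rewrite path_zero.
have Kx' : box (set_val y) e (set_val x') by have := Kp one; rewrite path_one.
have up (a b : M) (oa : off (set_val a)) (ob : off (set_val b)) (s : pth a b) :
    within s (box (set_val y) e) ->
    0 < Im (g H (set_val a)) -> 0 < Im (g H (set_val b)) -> lam oa ob s = 1.
  move=> Ks Ia Ib.
  have Ka : box (set_val y) e (set_val a) by have := Ks zero; rewrite path_zero.
  have Kb : box (set_val y) e (set_val b) by have := Ks one; rewrite path_one.
  have [s' [Ks' s'E]] := exists_seg Kc Ka Kb.
  rewrite (lam_convex lambda _ _ Kc Ks Ks'); apply: lam_off => t; apply: off_of => //.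
  rewrite s'E Im_nform_line; apply/eqP; rewrite gt_eqF //.
  by apply: gt_conv => //; rewrite unitI_ge0 unitI_le1.
have dn (a b : M) (oa : off (set_val a)) (ob : off (set_val b)) (s : pth a b) :
    within s (box (set_val y) e) ->
    Im (g H (set_val a)) < 0 -> Im (g H (set_val b)) < 0 -> lam oa ob s = 1.
  move=> Ks Ia Ib.
  have Ka : box (set_val y) e (set_val a) by have := Ks zero; rewrite path_zero.
  have Kb : box (set_val y) e (set_val b) by have := Ks one; rewrite path_one.
  have [s' [Ks' s'E]] := exists_seg Kc Ka Kb.
  rewrite (lam_convex lambda _ _ Kc Ks Ks'); apply: lam_off => t; apply: off_of => //.
  rewrite s'E Im_nform_line; apply/eqP; rewrite lt_eqF //.
  by apply: lt_conv => //; rewrite unitI_ge0 unitI_le1.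
have := Im_of _ Kx ox; have := Im_of _ Kx' ox'.
move=> /eqP; rewrite neq_lt => /orP[Ix'|Ix'] /eqP; rewrite neq_lt => /orP[Ix|Ix].
- exact: dn.
- have [s1 [Ks1 _]] := exists_seg Kc Kx (Ku : box (set_val y) e (set_val (point uM))).
  have [s2 [Ks2 _]] := exists_seg Kc (Kw : box (set_val y) e (set_val (point wM))) Kx'.
  rewrite (lam_convex lambda _ _ Kc Kp (within_concat (within_concat Ks1 Kq) Ks2)).
  rewrite (lam_concat lambda ox ow ox') (lam_concat lambda ox ou ow) lamq.
  by rewrite (up _ _ ox ou s1 Ks1 Ix Iu) (dn _ _ ow ox' s2 Ks2 Iw Ix') !mul1r.
- have [s1 [Ks1 _]] := exists_seg Kc Kx (Kw : box (set_val y) e (set_val (point wM))).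
  have [s2 [Ks2 _]] := exists_seg Kc (Ku : box (set_val y) e (set_val (point uM))) Kx'.
  rewrite (lam_convex lambda _ _ Kc Kp (within_concat (within_concat Ks1 (within_reverse Kq)) Ks2)).
  rewrite (lam_concat lambda ox ou ox') (lam_concat lambda ox ow ou) lam_reverse lamq.
  by rewrite (dn _ _ ox ow s1 Ks1 Ix Iw) (up _ _ ou ox' s2 Ks2 Iu Ix') invr1 !mul1r.
- exact: up.
Qed.

(** If the two real forms agreed, so would the complex forms a g_{H'} and a' g_H, and then H and H'
    would have the same kernel. *)
Lemma nform_independent H H' (a a' : R) : H <> H' -> a <> 0 -> a' <> 0 ->
  exists v, a * Im (g H' v) - a' * Im (g H v) <> 0.
Proof.
move=> HH' a0 a'0; apply: contrapT => nv; apply: HH'; apply: (hyperplane_inj (a := A)).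
have E v : rc a * g H' v = rc a' * g H v.
  have all0 w : a * Im (g H' w) = a' * Im (g H w).
    by apply: contrapT => w0; apply: nv; exists w => /subr0_eq.
  apply: eqC; last by rewrite !ImMr; exact: all0.
  rewrite !ReMr.
  (* The imaginary part at i v is the real part at v. *)
  have := all0 ((0 +i* 1)%C *: v); rewrite !nformZ.
  by case: (g H' v) => ? ?; case: (g H v) => ? ? /=; rewrite !mul0r !mul1r !add0r.
have rc_neq0 (t : R) : t <> 0 -> rc t != 0.
  by move=> t0; apply/eqP => /(congr1 (@complex.Re R)).
have E0 v : (g H v == 0) = (g H' v == 0).
  have := E v => Ev; apply/eqP/eqP => h; apply/eqP; move: Ev; rewrite h mulr0.
  - by move=> /eqP; rewrite mulf_eq0 (negbTE (rc_neq0 _ a0)).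
  - by move=> /esym/eqP; rewrite mulf_eq0 (negbTE (rc_neq0 _ a'0)).
apply/vspaceP => v; change ((v \in hyperplane A H) = (v \in hyperplane A H')).
exact: (etrans (hyperplaneE x0 H v) (etrans (E0 v) (esym (hyperplaneE x0 H' v)))).
Qed.

(* The real forms [Im g_H] are pairwise independent, so that after a small move
   of one endpoint the segment crosses the cuts one at a time. *)
Lemma locally_trivial_all (y : M) : locally_trivial lambda y.
Proof.
have [e ye] := margin_exists x0 (set_valP y); have e0 := ye.1.
have Kc := margin_box (set_valP y) ye.
exists e; split=> // m m' om om' p Kp.
have Km : box (set_val y) e (set_val m) by have := Kp zero; rewrite path_zero.
have Km' : box (set_val y) e (set_val m') by have := Kp one; rewrite path_one.
(* By [margin_box_off], no other cut can be met inside the box. *)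
pose cut H := `[< ~ off_cut (g H (set_val y)) >].
pose a H := Im (g H (set_val m)).
have a0 H : cut H -> a H <> 0.
  move=> /asboolP Hy; have Hneg := margin_box_cut (set_valP y) ye Km Hy.
  by case: (om H) => // r; have := lt_trans Hneg r; rewrite ltxx.
pose J := {j : 'I_n * 'I_n | [&& cut j.1, cut j.2 & j.1 != j.2]}.
(* If the segment from [m] to [z] met both cuts of [j] at one parameter s, eliminating 1 - s from
   the two equations would give s f_j(z) = 0, and s is nonzero because [m] is off the cuts. *)
pose f (j : J) v := a (val j).1 * Im (g (val j).2 v) - a (val j).2 * Im (g (val j).1 v).
have [||w fw] := @generic_vector R l J f.
- by move=> j v w t; rewrite /f !nformD !nformZ !ImD !ImMr; ring.
- move=> j; have /and3P[c1 c2 /eqP c12] := valP j.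
  exact: nform_independent (a0 _ c1) (a0 _ c2).
have [em m'e] := margin_exists x0 (set_valP m').
have [e3 e30 Ke3] := box_open Km'.
have e40 : 0 < Num.min em e3 by rewrite lt_min m'e.1.
have [|t1 t10 Ht1] := @small_avoid R J (fun j => f j (set_val m')) (fun j => f j w).
  by move=> j; right.
have [t2 t20 Ht2] := @small_lt R 'I_n (fun H => Re (g H w)) _ e40.
have [t3 t30 Ht3] := @small_lt R 'I_n (fun H => Im (g H w)) _ e40.
have [t4 /andP[t40 t42] t43] := pos_below t20 t30.
have [t /andP[t0 tt1] tt4] := pos_below t10 t40.
(* Close enough to [m'] to stay in the box of [y] and in a box about [m'] off the cuts, and chosen
   so that no f_j vanishes at it. *)
pose z := set_val m' + rc t *: w.
have zm : box (set_val m') (Num.min em e3) z.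
  move=> H; rewrite /z nformD nformZ ReD ImD ReMr ImMr ![_ + _ - _]addrAC !subrr !add0r.
  by split; [apply: Ht2|apply: Ht3]; rewrite t0 /=; [exact: lt_trans t42|exact: lt_trans t43].
have le3 : Num.min em e3 <= e3 by rewrite ge_min lexx orbT.
have lem : Num.min em e3 <= em by rewrite ge_min lexx.
have Kz : box (set_val y) e z by apply/Ke3/(box_le le3).
have Kc' := margin_box (set_valP m') m'e.
have zM := Kc.1 _ Kz.
have offm' v : box (set_val m') em v -> off v.
  by move=> mv H; exact: margin_box_off m'e mv (om' H).
have oz : off (set_val (point zM)) by apply/offm'/(box_le lem).
have [r1 [Kr1 r1E]] := exists_seg Kc Km (Kz : box (set_val y) e (set_val (point zM))).
have zm' : box (set_val m') em (set_val (point zM)) by apply: (box_le lem).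
have [r2 [Kr2 r2E]] := exists_seg Kc' zm' (box_center x0 (set_val m') m'e.1).
have Kr2' : within r2 (box (set_val y) e).
  by move=> u; rewrite r2E; apply: box_convex => //; rewrite unitI_ge0 unitI_le1.
(* The path becomes two segments, [m] to [z] and [z] to [m']; the second avoids the cuts and the
   first is handled by continuation. *)
rewrite (lam_convex lambda _ _ Kc Kp (within_concat Kr1 Kr2')).
rewrite (lam_concat lambda om oz om') (lam_off lambda oz om') ?mulr1; last first.
  by move=> u; exact/offm'/Kr2.
apply: lam_locally_trivial => u; apply: locally_trivial_tame => H H' nH nH'.
apply: contrapT => HH'.
have cutH G : ~ off_cut (g G (set_val (r1 u))) -> cut G.
  by move=> nG; apply/asboolP => oG; apply: nG; exact: margin_box_off ye (Kr1 u) oG.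
have cH := cutH _ nH; have cH' := cutH _ nH'.
have jP : [&& cut (H, H').1, cut (H, H').2 & (H, H').1 != (H, H').2].
  by rewrite /= cH cH' /=; exact/eqP.
have I0 G : ~ off_cut (g G (set_val (r1 u))) ->
    (1 - unitI_val u) * a G + unitI_val u * Im (g G z) = 0.
  move=> nG; have : Im (g G (set_val (r1 u))) = 0 by apply: contrapT => i0; apply: nG; left.
  by rewrite r1E Im_nform_line.
have := I0 _ nH; have := I0 _ nH'; set s := unitI_val u => E' E.
have : s * f (exist _ (H, H') jP) z = 0.
  rewrite /f /=.
  have -> : s * (a H * Im (g H' z) - a H' * Im (g H z)) =
    a H * ((1 - s) * a H' + s * Im (g H' z)) - a H' * ((1 - s) * a H + s * Im (g H z)) by ring.
  by rewrite E E' !mulr0 subrr.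
move=> /eqP; rewrite mulf_eq0 => /orP[/eqP s0|/eqP f0].
  by apply: (a0 _ cH); move: E; rewrite s0 subr0 mul1r mul0r addr0.
apply: (Ht1 t _ (exist _ (H, H') jP)); first by rewrite t0.
by rewrite -f0 /f /z !nformD !nformZ !ImD !ImMr; ring.
Qed.

Lemma character_trivial (c : pi1 R x0) : lambda c = 1.
Proof.
rewrite -(pi1_reprK c) -lam_base; apply: lam_locally_trivial => t.
exact: locally_trivial_all.
Qed.

End meridians_generate.

(** The quotient of the two characters is trivial on meridians, hence trivial. *)
Lemma characters_eq (R : realType) (l n : nat) (A : arrangement R l n)
    (x0 : complement A) (f g : character R (pi1 R x0)) :
  (forall H c, meridian H c -> f c = g c) -> f =1 g.
Proof.
move=> fg c.
have qM : {morph (fun a => f a / g a) : a b / (a * b)%g >-> a * b}.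
  by move=> a b; rewrite /= !characterM invfM mulrACA.
have q0 a : f a / g a != 0 by rewrite mulf_neq0 ?invr_eq0 ?character_neq0.
have := @character_trivial _ _ _ _ _ (Character qM q0) _ c.
move=> /(_ _)/= E; apply/eqP; rewrite -subr_eq0; apply/eqP.
have {}E : f c / g c = 1.
  by apply: E => H a /fg /= ->; rewrite divff // character_neq0.
by apply/eqP; rewrite subr_eq0 -(divfK (character_neq0 g c) (f c)) E mul1r.
Qed.

(** * The third class of a reduced multinet lies in the pencil of the others *)

Section polynomial_along_lines.
Variables (F : numFieldType) (V : lmodType F).

(** A coordinate-free substitute for polynomial functions on [V], sufficient for finding points
    where finitely many of them are nonzero. *)
Definition polyline (f : V -> F) :=
  forall x v, exists p : {poly F}, forall t, f (x + t *: v) = p.[t].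

Lemma polylineM f g : polyline f -> polyline g -> polyline (fun x => f x * g x).
Proof.
move=> pf pg x v; have [p pE] := pf x v; have [q qE] := pg x v.
by exists (p * q) => t; rewrite hornerM pE qE.
Qed.

Lemma polylineB f g : polyline f -> polyline g -> polyline (fun x => f x - g x).
Proof.
move=> pf pg x v; have [p pE] := pf x v; have [q qE] := pg x v.
by exists (p - q) => t; rewrite hornerD hornerN pE qE.
Qed.

Lemma polyline_cst c : polyline (fun=> c).
Proof. by move=> x v; exists c%:P => t; rewrite hornerC. Qed.

Lemma polyline_prod (J : Type) (r : seq J) (P : pred J) (f : J -> V -> F) :
  (forall j, polyline (f j)) -> polyline (fun x => \prod_(j <- r | P j) f j x).
Proof.
move=> pf x v; elim: r => [|j r [q qE]].
  by exists 1 => t; rewrite big_nil hornerC.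
have [p pE] := pf j x v; exists (if P j then p * q else q) => t.
by rewrite big_cons; case: (P j); rewrite ?hornerM ?pE qE.
Qed.

Lemma exists_nonroot (p : {poly F}) : p != 0 -> exists t, p.[t] != 0.
Proof.
move=> p0; apply: contrapT => np.
(* The integers below [size p]: distinct in characteristic 0, and one more than the degree allows as
   roots. *)
have allr : all (root p) [seq k%:R | k <- iota 0 (size p)].
  apply/allP => t _; rewrite /root; apply: contrapT => /negP t0; apply: np.
  by exists t.
have := max_poly_roots p0 allr; rewrite size_map size_iota ltnn => H.
by have : false; [apply: H; rewrite map_inj_uniq ?iota_uniq // => a b /eqP; rewrite eqr_nat => /eqP|].
Qed.

(** On the line joining a point that is good for [r] to a point that is good for [j], the product of
    all the functions is a nonzero polynomial, so some point of that line is good for both. *)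
Lemma polyline_avoid (W : V -> Prop) (J : eqType) (r : seq J) (f : J -> V -> F) :
  (exists x, W x) ->
  (forall x v t, W x -> W v -> W (x + t *: (v - x))) ->
  (forall j, polyline (f j)) -> (forall j, j \in r -> exists2 x, W x & f j x != 0) ->
  exists2 x, W x & forall j, j \in r -> f j x != 0.
Proof.
move=> [w0 Ww0] WD pf; elim: r => [|j r IH] fn; first by exists w0.
have [w Ww wr] : exists2 x, W x & forall j, j \in r -> f j x != 0.
  by apply: IH => k kr; apply: fn; rewrite inE kr orbT.
have [v Wv vj] : exists2 x, W x & f j x != 0 by apply: fn; rewrite inE eqxx.
have [p pE] := pf j w (v - w).
have [q qE] := polyline_prod r xpredT pf w (v - w).
have [|t] := @exists_nonroot (p * q).
  rewrite mulf_neq0 //; apply/eqP => z0.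
  - by move: vj; rewrite -(subrK w v) addrC -[v - w]scale1r pE z0 horner0 eqxx.
  - have /eqP := qE 0; rewrite z0 horner0 scale0r addr0 prodf_seq_eq0 => /hasP[k kr].
    by rewrite /= (negbTE (wr _ kr)).
rewrite hornerM -pE -qE mulf_eq0 negb_or => /andP[tj tr].
exists (w + t *: (v - w)); first exact: WD.
move=> k; rewrite inE => /orP[/eqP ->//|kr].
by move: tr; rewrite (big_rem k) //= mulf_eq0 negb_or => /andP[].
Qed.

End polynomial_along_lines.

(** * Linear relation between the class products *)

Section pencil.
Variables (K : numFieldType) (V : vectType K) (n : nat).
Variables (form : 'I_n -> 'Hom(V, K^o)).
Hypotheses (formN0 : forall H, form H != 0%VF)
  (ker_inj : injective (fun H => lker (form H))).
Local Notation F H x := (form H x : K).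
Local Notation hyp H := (lker (form H)).

Lemma formD H x y : F H (x + y) = F H x + F H y.
Proof. exact: linearD. Qed.

Lemma formZ H c x : F H (c *: x) = c * F H x.
Proof. exact: linearZ. Qed.

Lemma ker_formE H x : (x \in hyp H) = (F H x == 0).
Proof. exact: memv_ker. Qed.

Lemma form_polyline H : polyline (fun x => F H x).
Proof.
move=> x v; exists ((F H x)%:P + (F H v) *: 'X) => t.
by rewrite formD formZ hornerD hornerC hornerZ hornerX mulrC.
Qed.

Lemma form_neq0_ex H : exists x, F H x != 0.
Proof.
apply: contrapT => nx; have /eqP := formN0 H; apply.
by apply/lfunP => x; rewrite lfunE /=; apply: contrapT => /eqP x0; apply: nx; exists x.
Qed.

Lemma dim_hyperplane H : (\dim (hyp H)).+1 = \dim {:V}.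
Proof.
rewrite -(limg_ker_dim (form H) fullv) capfv.
suff -> : \dim (limg (form H)) = 1%N by rewrite addn1.
apply/eqP; rewrite eqn_leq; apply/andP; split.
  by have := dimvS (subvf (limg (form H))); rewrite dimvf /dim /= ?mul1n.
rewrite lt0n dimv_eq0; apply/eqP => l0; have [x] := form_neq0_ex H.
have := memv_img (form H) (memvf x); rewrite l0 memv0 => /eqP E0.
by rewrite E0 eqxx.
Qed.

Lemma hyperplane_nsub H H' : H <> H' -> exists2 x, x \in hyp H & F H' x != 0.
Proof.
move=> HH'; case: (boolP (hyp H <= hyp H')%VS) => [sub|/subvPn[x xH xH']].
- case: HH'; apply: ker_inj.
  have e : \dim (hyp H) = \dim (hyp H').
    exact: succn_inj (etrans (dim_hyperplane H) (esym (dim_hyperplane H'))).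
  by case: (dimv_leqif_eq sub) => _; rewrite e eqxx => /esym/eqP.
- by exists x => //; rewrite -ker_formE.
Qed.

Lemma restr_proportional H0 H1 H2 :
  (hyp H1 :&: hyp H0 = hyp H2 :&: hyp H0)%VS ->
  exists2 k : K, k != 0 & forall x, x \in hyp H0 -> F H1 x = k * F H2 x.
Proof.
move=> E; have Ex x : x \in hyp H0 -> (F H1 x == 0) = (F H2 x == 0).
  move=> xH0; rewrite -!ker_formE.
  have cap H : (x \in (hyp H :&: hyp H0)%VS) = (x \in hyp H) by rewrite memv_cap xH0 andbT.
  by rewrite -cap E cap.
have [[x1 x1H0 x1n]|no] := pselect (exists2 x, x \in hyp H0 & F H2 x != 0).
  exists (F H1 x1 / F H2 x1) => [|x xH0].
    by rewrite mulf_neq0 ?invr_eq0 // Ex.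
  have : F H1 (x - (F H2 x / F H2 x1) *: x1) == 0.
    rewrite Ex; first by rewrite formD -scaleNr formZ mulNr divfK // subrr.
    by rewrite rpredB // rpredZ.
  rewrite formD -scaleNr formZ mulNr subr_eq0 => /eqP ->.
  by rewrite mulrAC [in RHS]mulrAC [F H2 x * _]mulrC.
exists 1 => [|x xH0]; first exact: oner_neq0.
have x0 : F H2 x = 0 by apply: contrapT => /eqP xn; apply: no; exists x.
by rewrite x0 mulr0; apply/eqP; rewrite Ex // x0.
Qed.

Variables (T : finType) (cls : 'I_n -> T) (base : set {vspace V}).
Hypothesis base_dim : forall X, base X -> (\dim X + 2 = \dim {:V})%N.
Hypothesis baseI : forall H H', cls H != cls H' -> base (hyp H :&: hyp H')%VS.
Hypothesis base_count : forall X, base X -> forall i j,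
  (\sum_(H | (cls H == i) && (X <= hyp H)%VS) 1 =
   \sum_(H | (cls H == j) && (X <= hyp H)%VS) 1)%N.
Hypothesis class_inhabited : forall i, exists H, cls H = i.
Hypothesis class_linked : forall H H', cls H = cls H' ->
  connect (fun H1 H2 => [&& cls H1 == cls H, cls H2 == cls H &
    (hyp H1 :&: hyp H2)%VS \notin base]) H H'.
Variable d : nat.
Hypothesis class_size : forall i, (\sum_(H | cls H == i) 1 = d)%N.

Definition class_form (i : T) (x : V) : K := \prod_(H | cls H == i) F H x.
Local Notation Q := class_form.

(* By the multinet axioms both restrictions have the same zeros, with the same
   multiplicities. *)
Lemma restr_member H0 i j : i != cls H0 -> j != cls H0 ->
  exists2 c : K, c != 0 & forall x, x \in hyp H0 -> Q i x = c * Q j x.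
Proof.
move=> i0 j0.
(* One representative for each trace on H0: [pick] sees only the trace, so equal traces give equal
   representatives. For H outside the class of H0 the default is not reached, since H itself
   qualifies. *)
pose rep H := odflt H [pick H' | (cls H' != cls H0) &&
  ((hyp H' :&: hyp H0)%VS == (hyp H :&: hyp H0)%VS)].
have repP H : cls H != cls H0 -> cls (rep H) != cls H0 /\
    (hyp (rep H) :&: hyp H0)%VS = (hyp H :&: hyp H0)%VS.
  move=> cH; rewrite /rep; case: pickP => [H' /andP[? /eqP ?]//|/(_ H)].
  by rewrite cH eqxx.
have rep_eq H H' : cls H != cls H0 -> (hyp H :&: hyp H0)%VS = (hyp H' :&: hyp H0)%VS ->
    rep H = rep H'.
  move=> cH E; rewrite /rep E; case: pickP => [//|/(_ H)].
  by rewrite cH E eqxx.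
have /choice[k kP] : forall H, exists k : K, cls H != cls H0 -> k != 0 /\
    forall x, x \in hyp H0 -> F H x = k * F (rep H) x.
  move=> H; have [cH|cH] := boolP (cls H != cls H0); last by exists 0.
  have [k k0 kE] := restr_proportional (esym (repP _ cH).2).
  by exists k.
pose m (q : T) (r : 'I_n) := #|[pred H | (cls H == q) && (rep H == r)]|.
have QE q x : q != cls H0 -> x \in hyp H0 ->
    Q q x = (\prod_(H | cls H == q) k H) * \prod_r F r x ^+ m q r.
  move=> q0 xH0; rewrite /Q.
  rewrite (eq_bigr (fun H => k H * F (rep H) x)); last first.
    by move=> H /eqP cH; apply: (kP H _).2 => //; rewrite cH.
  rewrite big_split /=; congr (_ * _).
  rewrite (partition_big rep xpredT) //=; apply: eq_bigr => r _.
  rewrite (eq_bigr (fun=> F r x)); last by move=> H /andP[_ /eqP ->].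
  by rewrite prodr_const.
have mE r : m i r = m j r.
  have [[H1 c1 r1]|no] := pselect (exists2 H, cls H != cls H0 & rep H = r).
    have X1 : base (hyp H1 :&: hyp H0)%VS by exact: baseI.
    (* Both intersections with H0 are flats of the base locus, of codimension 2, so inclusion is
       equality; the multiplicity of a trace is thus the count in the third multinet axiom. *)
    have repX H : cls H != cls H0 -> (rep H == r) = ((hyp H1 :&: hyp H0) <= hyp H)%VS.
      move=> cH; apply/eqP/idP => [rH|sub].
        have <- : (hyp H :&: hyp H0 = hyp H1 :&: hyp H0)%VS.
          by rewrite -(repP _ cH).2 rH -r1 (repP _ c1).2.
        exact: capvSl.
      rewrite -r1; apply: rep_eq => //; apply/esym/eqP.
      have sub' : (hyp H1 :&: hyp H0 <= hyp H :&: hyp H0)%VS by rewrite subv_cap sub capvSr.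
      have XH : base (hyp H :&: hyp H0)%VS by exact: baseI.
      by rewrite -(dimv_leqif_eq sub').2 -(eqn_add2r 2) (base_dim X1) (base_dim XH).
    have mS q : q != cls H0 -> m q r =
        (\sum_(H | (cls H == q) && ((hyp H1 :&: hyp H0) <= hyp H)%VS) 1)%N.
      move=> q0; rewrite /m -sum1_card; apply: eq_bigl => H.
      by rewrite inE; case: eqP => //= cH; rewrite repX // cH.
    by rewrite !mS //; exact: base_count.
  have m0 q : q != cls H0 -> m q r = 0%N.
    move=> q0; apply: eq_card0 => H; rewrite !inE; apply/negP => /andP[/eqP cH /eqP rH].
    by apply: no; exists H; rewrite ?cH.
  by rewrite !m0.
have kn0 q : q != cls H0 -> \prod_(H | cls H == q) k H != 0.
  by move=> q0; apply/prodf_neq0 => H /eqP cH; apply: (kP H _).1; rewrite cH.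
exists ((\prod_(H | cls H == i) k H) / (\prod_(H | cls H == j) k H)) => [|x xH0].
  by rewrite mulf_neq0 ?invr_eq0 ?kn0.
rewrite !QE // mulrA divfK ?kn0 //; congr (_ * _).
by apply: eq_bigr => r _; rewrite mE.
Qed.

Lemma avoid_class (W : {vspace V}) i :
  (forall H, cls H == i -> exists2 x, x \in W & F H x != 0) ->
  exists2 x, x \in W & Q i x != 0.
Proof.
move=> Wn.
have [||H|H|x xW xn] := @polyline_avoid _ _ (fun x => x \in W) _
  [seq H <- enum 'I_n | cls H == i] (fun H x => F H x).
- by exists 0; exact: mem0v.
- by move=> x v t xW vW; rewrite rpredD // rpredZ // rpredB.
- exact: form_polyline.
- by rewrite mem_filter => /andP[/Wn].
exists x => //; apply/prodf_neq0 => H cH.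
by apply: xn; rewrite mem_filter cH mem_enum.
Qed.

(** On each hyperplane of class [k] the ratio is a constant by [restr_member]. For two hyperplanes
    meeting outside the base locus the constants agree, being compared at a common point where Q_j
    is nonzero; the connectedness axiom spreads the equality over the class. *)
Lemma class_coefficient (i j k : T) : i != k -> j != k ->
  exists c : K, forall H x, cls H = k -> x \in hyp H -> Q i x = c * Q j x.
Proof.
move=> ik jk; have [H0 c0] := class_inhabited k.
have coef H : cls H = k -> exists2 c : K, c != 0 & forall x, x \in hyp H -> Q i x = c * Q j x.
  by move=> cH; apply: restr_member; rewrite cH.
have [c cn0 cE] := coef _ c0; exists c => H x cH; move: x.
have := class_linked (etrans c0 (esym cH)).
move=> /connectP[p]; rewrite c0; move: cE c0.
elim: p H0 => [|H2 p IH] H1 cE c1 /=; first by move=> _ ->.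
move=> /andP[/and3P[_ /eqP c2 nb] pp] lastp.
apply: (IH H2) => // {IH pp lastp}.
have [c' c'n0 c'E] := coef _ c2.
suff -> : c = c' by [].
(* If some H3 of class [j] contained this intersection, whose codimension is at most 2, the
   intersection would equal that of H3 and H1, which belongs to the base locus. *)
have [|x] := @avoid_class (hyp H1 :&: hyp H2)%VS j.
  move=> H3 cH3; apply: contrapT => nx.
  have sub : (hyp H1 :&: hyp H2 <= hyp H3 :&: hyp H1)%VS.
    rewrite subv_cap capvSl andbT; apply/subvP => x xW; rewrite ker_formE.
    by apply: contrapT => /negP xn; apply: nx; exists x.
  have b : base (hyp H3 :&: hyp H1)%VS.
    by apply: baseI; rewrite (eqP cH3) c1.
  have /negP := nb; apply; apply/mem_set.
  suff -> : (hyp H1 :&: hyp H2 = hyp H3 :&: hyp H1)%VS by [].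
  apply/eqP; rewrite -(dimv_leqif_eq sub).2 eqn_leq (dimv_leqif_eq sub).1 /=.
  have := dimv_sum_cap (hyp H1) (hyp H2); have := base_dim b.
  have := dim_hyperplane H1; have := dim_hyperplane H2.
  have := dimvS (subvf (hyp H1 + hyp H2)%VS).
  by lia.
rewrite memv_cap => /andP[x1 x2] xn; apply: (mulIf xn).
by rewrite -cE // c'E.
Qed.

Lemma prod_linear (r : seq 'I_n) (P : pred 'I_n) (a b : 'I_n -> K) :
  let p := \prod_(H <- r | P H) ((a H)%:P + b H *: 'X) in
  let m := (\sum_(H <- r | P H) 1)%N in
  (size p <= m.+1)%N /\ p`_m = \prod_(H <- r | P H) b H.
Proof.
elim: r => [|H r [IHs IHc]] /=; first by rewrite !big_nil size_poly1 coefC.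
rewrite !big_cons; case: (P H) => //.
set p := \prod_(j <- r | P j) _ in IHs IHc *; set m := (\sum_(j <- r | P j) 1)%N in IHs IHc *.
have l2 : (size ((a H)%:P + b H *: 'X)%R <= 2)%N.
  apply: (leq_trans (size_polyD _ _)); rewrite geq_max.
  rewrite (leq_trans (size_polyC_leq1 _)) //=.
  by rewrite (leq_trans (size_scale_leq _ _)) // size_polyX.
split.
  apply: (leq_trans (size_polyMleq _ _)).
  by move: l2 IHs; lia.
rewrite mulrDl coefD mul_polyC coefZ -scalerAl coefZ coefXM add1n /= -IHc.
by rewrite (nth_default 0 IHs) mulr0 add0r.
Qed.

(* [Q i - c Q j] has the degree of [Q k] and vanishes on its linear factors: on a
   generic line these give [d] distinct roots. *)
Lemma class_pencil (i j k : T) : i != j -> i != k -> j != k ->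
  exists c c' : K, c' != 0 /\ forall x, Q i x - c * Q j x = c' * Q k x.
Proof.
move=> ij ik jk; have [c cE] := class_coefficient ik jk.
have Qn0 q : exists x, Q q x != 0.
  have [|x _ xn] := @avoid_class fullv q; last by exists x.
  by move=> H _; have [x xn] := form_neq0_ex H; exists x => //; exact: memvf.
have [v vn] := Qn0 k.
have vF H : cls H == k -> F H v != 0 by move: vn => /prodf_neq0; apply.
(* On a line of direction [v] the coefficients of degree [d] are the values at [v], which forces
   this [c']. *)
pose G x := Q i x - c * Q j x; pose c' := G v / Q k v.
pose L x q := \prod_(H | cls H == q) ((F H x)%:P + F H v *: 'X).
have LE x q t : (L x q).[t] = Q q (x + t *: v).
  rewrite /L horner_prod; apply: eq_bigr => H _.
  by rewrite linearD linearZ hornerD hornerC hornerZ hornerX mulrC.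
have Ls x q : (size (L x q) <= d.+1)%N /\ (L x q)`_d = Q q v.
  by have := prod_linear (index_enum 'I_n) (fun H => cls H == q) (fun H => F H x) (fun H => F H v); rewrite /= class_size.
(* For hyperplanes of class [k], nonvanishing means that the line through [x] of direction [v] meets
   H and H' at different parameters. *)
pose D (H H' : 'I_n) x := F H x * F H' v - F H' x * F H v.
have good x : (forall H H', cls H == k -> cls H' == k -> H <> H' -> D H H' x != 0) ->
    G x = c' * Q k x.
  (* The coefficient of degree [d] cancels, so [p] has degree less than [d], while it vanishes at
     the [d] distinct parameters where the line meets class [k]. *)
  move=> Dx; pose p := L x i - c *: L x j - c' *: L x k.
  pose rs := [seq - (F H x / F H v) | H <- enum 'I_n & cls H == k].
  suff p0 : p = 0.
    have : p.[0] = 0 by rewrite p0 horner0.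
    by rewrite !hornerD !hornerN !hornerZ !LE scale0r addr0 => /eqP; rewrite subr_eq0 => /eqP.
  have sz_rs : size rs = d.
    by rewrite size_map size_filter -sum1_count big_enum_cond class_size.
  apply: (@roots_geq_poly_eq0 _ _ rs).
  - apply/allP => t /mapP[H]; rewrite mem_filter => /andP[cH _] ->.
    set t0 := - _.
    have xH : x + t0 *: v \in hyp H.
      rewrite ker_formE linearD linearZ /= /t0 scaleNr.
      by rewrite (divfK (vF _ cH) _ : _ *: _ = form H x) subrr.
    rewrite /root !hornerD !hornerN !hornerZ !LE (cE H) ?(eqP cH) // subrr sub0r.
    move: xH; rewrite ker_formE => /eqP xH.
    by rewrite oppr_eq0 /class_form (bigD1 H) //= xH mul0r mulr0.
  - rewrite map_inj_in_uniq => [|H H']; first by apply: filter_uniq; exact: enum_uniq.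
    rewrite !mem_filter => /andP[cH _] /andP[cH' _] /oppr_inj E.
    apply: contrapT => HH'; have := Dx _ _ cH cH' HH'.
    rewrite /D subr_eq0 -(divfK (vF _ cH) (F H x)) E => /eqP; apply.
    by rewrite mulrAC divfK ?vF.
  - rewrite sz_rs; apply/leq_sizeP => m dm.
    have [<-|dm'] := eqVneq d m.
      rewrite !coefB !coefZ !(Ls _ _).2 /c' divfK // subrr //.
    have hi q : (L x q)`_m = 0.
      by apply: nth_default; apply: (leq_trans (Ls x q).1); rewrite ltn_neqAle dm' dm.
    by rewrite !coefB !coefZ !hi !mulr0 !subr0.
have all_x x : G x = c' * Q k x.
  apply: contrapT => xn.
  (* [None] stands for the failure of the identity: a counterexample would yield one that is also
     generic, contradicting [good]. *)
  pose f (o : option ('I_n * 'I_n)) x := if o is Some (H, H') then D H H' x else G x - c' * Q k x.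
  have Fp H : polyline (fun x => F H x) by exact: form_polyline.
  have Qp q : polyline (Q q) by exact: polyline_prod.
  have [||[[H H']|]||u _ uf] := @polyline_avoid _ _ (fun x => x \in fullv) _
    (None :: [seq Some h | h <- enum {: 'I_n * 'I_n} &
      [&& cls h.1 == k, cls h.2 == k & h.1 != h.2]]) f.
  - by exists 0; exact: mem0v.
  - by move=> *; exact: memvf.
  - by apply: polylineB; apply: polylineM => //; exact: polyline_cst.
  - apply: polylineB; first apply: polylineB => //; apply: polylineM => //; exact: polyline_cst.
  - move=> o; rewrite inE => /orP[/eqP ->|/mapP[[H H']]].
      by exists x; [exact: memvf|rewrite /= subr_eq0; apply/eqP].
    rewrite mem_filter /= => /andP[/and3P[cH cH' /eqP HH'] _] ->.
    have [w wH wH'] := hyperplane_nsub HH'; exists w; first exact: memvf.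
    move: wH; rewrite ker_formE /= /D => /eqP ->.
    by rewrite mul0r sub0r oppr_eq0 mulf_neq0 // vF.
  have := uf None; rewrite inE eqxx /= => /(_ isT); rewrite good ?subrr ?eqxx // => H H' cH cH' HH'.
  apply: (uf (Some (H, H'))); rewrite inE /=; apply: map_f.
  by rewrite mem_filter mem_enum /= cH cH' /= andbT; apply/eqP.
(* If [c'] were 0, then Q_i = c Q_j; a point on a hyperplane of class [i] but off class [j] gives c
   = 0, and Q_i would vanish identically. *)
exists c, c'; split=> //; apply/eqP => c'0.
have Gx x : Q i x = c * Q j x.
  by apply/eqP; rewrite -subr_eq0; apply/eqP; have := all_x x; rewrite c'0 mul0r.
have [H0 c0] := class_inhabited i.
have [H cH|x xH0 xn] := @avoid_class (hyp H0) j.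
  apply: hyperplane_nsub => HH0; move: ij; rewrite -c0 HH0 (eqP cH) eqxx //.
have : Q i x = 0.
  rewrite /class_form (bigD1 H0) ?c0 //= .
  by move: xH0; rewrite ker_formE => /eqP ->; rewrite mul0r.
rewrite Gx => /eqP; rewrite mulf_eq0 (negbTE xn) orbF => /eqP cc0.
by have [y] := Qn0 i; rewrite Gx cc0 mul0r eqxx.
Qed.

End pencil.

(** * The character of the target *)

Section pencil_relation.
Variables (R : realType) (l n : nat) (A : arrangement R l n).
Variables (N : multinet A 3) (hN : reduced N).
Local Notation C := (CC R).

Lemma reduced_memberE i x : pencil_member N i x = class_form (Defs.form A) (mclass N) i x.
Proof. by apply: eq_bigr => H _; rewrite hN expr1. Qed.

Lemma reduced_sum (P : pred 'I_n) : (\sum_(H | P H) mult N H = \sum_(H | P H) 1)%N.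
Proof. by apply: eq_bigr => H _; rewrite hN. Qed.

Lemma member_pencil : exists c c' : C, c' != 0 /\ forall x,
  pencil_member N 0 x - c * pencil_member N 1 x = c' * pencil_member N ord_max x.
Proof.
have bd X : base_locus N X -> (\dim X + 2 = \dim {: 'rV[C]_l})%N.
  by move=> /(base_locus_sub (m := N))[_ ->]; rewrite dimvf /dim /= mul1n.
have bc X : base_locus N X -> forall i j,
    (\sum_(H | (mclass N H == i) && (X <= lker (Defs.form A H))%VS) 1 =
     \sum_(H | (mclass N H == j) && (X <= lker (Defs.form A H))%VS) 1)%N.
  by move=> bX i j; rewrite -!reduced_sum; exact: base_multE.
have cs i : (\sum_(H | mclass N H == i) 1 = degree N)%N.
  by rewrite -reduced_sum degreeE.
have [//|//|//|c [c' [c'0 E]]] := @class_pencil _ _ _ (Defs.form A) (@Defs.form_neq0 _ _ _ A)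
  (@hyperplane_inj _ _ _ A) _ (mclass N) (base_locus N) bd (@base_locusI _ _ _ _ _ N) bc
  (class_nonempty N) (@class_connected _ _ _ _ _ N) (degree N) cs 0 1 ord_max.
by exists c, c'; split=> // x; rewrite !reduced_memberE; exact: E.
Qed.

Lemma reduced_size : (n = 3 * degree N)%N.
Proof.
rewrite -[LHS]card_ord -sum1_card (partition_big (mclass N) xpredT) //=.
rewrite (eq_bigr (fun=> degree N)) ?sum_nat_const ?card_ord // => i _.
by rewrite -(degreeE N i) reduced_sum.
Qed.

Lemma degree_gt0 : (0 < degree N)%N.
Proof.
have [H cH] := class_nonempty N 0; rewrite -(degreeE N 0) (bigD1 H) ?cH //=.
by rewrite hN.
Qed.

End pencil_relation.

(** * A section of the projectivization *)

Section section_of_projection.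
Variables (R : realType) (l n : nat) (A : arrangement R l n) (x0 : complement A) (H : 'I_n).
Local Notation C := (CC R).
Local Notation M := (complement A).
Local Notation U := (proj_complement A).

Lemma formvZ H' c x : formv A H' (c *: x) = c * formv A H' x.
Proof. exact: linearZ. Qed.

(* x |-> (f_H(x0) / f_H(x)) x descends to a section of M -> U through x0. *)
Definition rescale (x : M) : 'rV[C]_l :=
  (formv A H (set_val x0) / formv A H (set_val x)) *: set_val x.

Lemma rescaleM x : M (rescale x).
Proof.
apply/complementE => H'; rewrite /rescale formvZ mulf_neq0 ?formv_neq0 //.
by rewrite mulf_neq0 ?invr_eq0 ?formv_neq0.
Qed.

Lemma rescale_base : rescale x0 = set_val x0.
Proof. by rewrite /rescale divff ?scale1r // formv_neq0. Qed.

Lemma rescale_proj x : to_Proj (point (rescaleM x)) = to_Proj x.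
Proof.
apply/esym/projP; exists (formv A H (set_val x0) / formv A H (set_val x)) => //.
by rewrite mulf_neq0 ?invr_eq0 ?formv_neq0.
Qed.

Lemma rescale_collinear (x y : M) : to_Proj x = to_Proj y -> rescale x = rescale y.
Proof.
move=> /projP[c c0 yE]; rewrite /rescale yE formvZ scalerA invfM; congr (_ *: _).
by rewrite [c^-1 * _]mulrC mulrA divfK.
Qed.

Lemma rescale_cts : continuous rescale.
Proof.
have cv : continuous (fun x : M => set_val x : 'rV[C]_l) by exact: initial_continuous.
rewrite (_ : rescale = fun x => 0 + (formv A H (set_val x0) / formv A H (set_val x)) *: set_val x).
  apply: row_cts => j.
  rewrite (_ : (fun _ => _) = fun x : M => (formv A H (set_val x0) / formv A H (set_val x)) * set_val x ord0 j).
    apply: mulC_cts.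
      apply: mulC_cts; first exact: cst_cts.
      apply: inv_cts => [x|]; first exact: formv_neq0.
      by apply: (comp_cts (g := formv A H)) => //; exact: formv_continuous.
    by apply: (comp_cts (g := fun x : 'rV[C]_l => x ord0 j)) => //; exact: coord_continuous.
  by apply/funext => x; rewrite add0r !mxE.
by apply/funext => x; rewrite add0r.
Qed.

Definition proj_section (u : U) : M := point (rescaleM (Proj_repr u)).

Lemma proj_sectionE (x : M) : proj_section (to_Proj x) = point (rescaleM x).
Proof.
apply: eq_point; apply: rescale_collinear; exact: Proj_reprK.
Qed.

Lemma proj_sectionK u : to_Proj (proj_section u) = u.
Proof. by rewrite /proj_section rescale_proj Proj_reprK. Qed.

Lemma proj_section_cts : continuous proj_section.
Proof.
apply/quotient_continuous.
rewrite (_ : _ \o _ = fun x : M => point (rescaleM x)).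
  by apply: continuous_comp_initial; exact: rescale_cts.
by apply/funext => x; exact: proj_sectionE.
Qed.

(** Composing a loop with the section lifts it to M; the lift closes up at [x0], through which the
    section passes. *)
Lemma pi1_to_Proj_surj (a : pi1 R (to_Proj x0 : U)) :
  exists c : pi1 R x0, pi1_map (@to_Proj R l (complement A)) c = a.
Proof.
pose p := repr a.
have q0 : proj_section (p zero) = x0.
  by rewrite path_zero proj_sectionE; apply/esym/eq_point; rewrite rescale_base.
have q1 : proj_section (p one) = x0.
  by rewrite path_one proj_sectionE; apply/esym/eq_point; rewrite rescale_base.
have cq : continuous (fun t => proj_section (p t)).
  by apply: (comp_cts (g := proj_section)); [exact: proj_section_cts|exact: path_cts].
exists (pi1_class (mk_path cq q0 q1)); rewrite pi1_map_class -[RHS]pi1_reprK.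
by congr pi1_class; apply/path_eqP => t /=; exact: proj_sectionK.
Qed.

End section_of_projection.

(** * A function on the projective line with prescribed winding *)

Section pencil_function.
Variables (R : realType) (c : CC R).
Local Notation C := (CC R).
Local Notation Y := [set y : 'rV[C]_2 | y != 0].

Lemma subC_cts (Z : topologicalType) (f g : Z -> C) :
  continuous f -> continuous g -> continuous (fun z => f z - g z).
Proof. by move=> cf cg z; apply: cvgB; [exact: cf|exact: cg]. Qed.

Definition third_form (y : 'rV[C]_2) : C := y ord0 0 - c * y ord0 1.

Definition sqnorm (y : 'rV[C]_2) : C := `|y ord0 0| ^+ 2 + `|y ord0 1| ^+ 2.

Lemma sqnorm_gt0 (y : 'rV[C]_2) : y != 0 -> 0 < sqnorm y.
Proof.
move=> y0; rewrite lt0r addr_ge0 ?exprn_ge0 // andbT paddr_eq0 ?exprn_ge0 //.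
rewrite !sqrf_eq0 !normr_eq0; apply: contra y0 => /andP[/eqP a /eqP b].
apply/eqP/rowP => j; rewrite mxE; case: j => -[|[|//]] i.
- by rewrite -[RHS]a; congr (y _ _); exact: val_inj.
- by rewrite -[RHS]b; congr (y _ _); exact: val_inj.
Qed.

(* [y0 y1 / L^2] for L = [third_form], up to a positive factor that makes it
   continuous across [L = 0]. *)
Definition pencil_fun (y : 'rV[C]_2) : C :=
  y ord0 0 * y ord0 1 * (conjc (third_form y) * conjc (third_form y)) / sqnorm y ^+ 2.

(** The numerator scales by k^2 times the square of the conjugate of k, which is |k|^4, as does the
    denominator. *)
Lemma pencil_funZ (k : C) (y : 'rV[C]_2) : k != 0 -> pencil_fun (k *: y) = pencil_fun y.
Proof.
move=> k0; rewrite /pencil_fun; have -> : third_form (k *: y) = k * third_form y by rewrite /third_form !mxE; ring.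
have -> : sqnorm (k *: y) = (k * conjc k) * sqnorm y.
  by rewrite /sqnorm !mxE !normrM !exprMn -mulrDr (@sqr_normc R k).
have kc0 : conjc k != 0 by rewrite conjc_eq0.
rewrite !mxE exprMn invfM [conjc (k * _)]rmorphM.
have key (a b T kc s : C) : kc != 0 ->
    k * a * (k * b) * (kc * T * (kc * T)) * ((k * kc) ^- 2 * s) = a * b * (T * T) * s.
  by move=> kcn; field; rewrite k0 kcn.
exact: (key _ _ (conjc (third_form y)) (conjc k)).
Qed.

Lemma pencil_fun_neq0 (y : 'rV[C]_2) : y ord0 0 != 0 -> y ord0 1 != 0 -> third_form y != 0 ->
  pencil_fun y != 0.
Proof.
move=> y0 y1 yt; rewrite /pencil_fun.
have yn : y != 0 by apply: contra_neq y0 => ->; rewrite mxE.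
have s0 : sqnorm y != 0 by rewrite gt_eqF // sqnorm_gt0.
by rewrite !mulf_neq0 ?invr_eq0 ?expf_neq0 // conjc_eq0.
Qed.

Lemma pencil_fun_cts : continuous (fun y : Y => pencil_fun (set_val y)).
Proof.
have cy j : continuous (fun y : Y => set_val y ord0 j : C).
  apply: (comp_cts (g := fun y : 'rV[C]_2 => y ord0 j)); first exact: coord_continuous.
  exact: initial_continuous.
have ct : continuous (fun y : Y => conjc (third_form (set_val y)) : C).
  apply: conj_cts; apply: subC_cts; first exact: cy.
  by apply: mulC_cts; [exact: cst_cts|exact: cy].
have cn j : continuous (fun y : Y => `|set_val y ord0 j| ^+ 2 : C).
  rewrite (_ : (fun _ => _) = fun y : Y => set_val y ord0 j * (conjc (set_val y ord0 j) : C)).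
    by apply: mulC_cts; [exact: cy|apply: conj_cts; exact: cy].
  by apply/funext => y; rewrite (@sqr_normc R).
have cs : continuous (fun y : Y => sqnorm (set_val y)).
  by apply: addC_cts; exact: cn.
apply: mulC_cts.
  by apply: mulC_cts; apply: mulC_cts; [exact: cy|exact: cy|exact: ct|exact: ct].
apply: inv_cts => [y|].
  by rewrite expf_neq0 // gt_eqF // sqnorm_gt0 //; have := set_valP y.
rewrite (_ : (fun _ => _) = fun y : Y => sqnorm (set_val y) * sqnorm (set_val y)).
  by apply: mulC_cts; exact: cs.
by apply/funext => y; rewrite expr2.
Qed.

Definition CP1_fun (p : CP1 R) : C := pencil_fun (hcoord p).

Lemma CP1_fun_proj y : CP1_fun (to_Proj y) = pencil_fun (set_val y).
Proof.
have /projP[k k0 yE] := Proj_reprK (to_Proj y : CP1 R).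
by rewrite yE pencil_funZ.
Qed.

Lemma CP1_fun_cts : continuous CP1_fun.
Proof.
apply/quotient_continuous; rewrite (_ : _ \o _ = fun y : Y => pencil_fun (set_val y)).
  exact: pencil_fun_cts.
by apply/funext => y; exact: CP1_fun_proj.
Qed.

End pencil_function.

(** * Winding of the pulled-back function on meridians *)

Section pencil_turns.
Variables (R : realType) (l n : nat) (A : arrangement R l n) (N : multinet A 3).
Hypothesis hN : reduced N.
Local Notation C := (CC R).
Local Notation I := (unitI R).
Local Notation M := (complement A).
Variables (c c' : C).
Hypotheses (c'0 : c' != 0) (rel : forall x,
  pencil_member N 0 x - c * pencil_member N 1 x = c' * pencil_member N ord_max x).

Definition target_fun (p : pencil_target N) : C := CP1_fun c (set_val p).

Lemma target_fun_cts : continuous target_fun.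
Proof.
apply: (comp_cts (g := CP1_fun c)); first exact: CP1_fun_cts.
exact: initial_continuous.
Qed.

(** Where y_0, y_1 or the third form vanishes, the corresponding member of the pencil is a multiple
    of C_1, C_2 or C_3 respectively, so the point is one of those removed. *)
Lemma target_fun_neq0 p : target_fun p != 0.
Proof.
have np : ~ (\bigcup_i member_point N i) (set_val p) := set_valP p.
have yn : hcoord (set_val p) != 0 by exact: (set_valP (Proj_repr (set_val p))).
have y_eq0 : hcoord (set_val p) ord0 0 = 0 -> hcoord (set_val p) ord0 1 = 0 -> False.
  move=> y0 y1; have := sqnorm_gt0 yn.
  by rewrite /sqnorm y0 y1 normr0 expr0n addr0 ltxx.
rewrite /target_fun /CP1_fun.
have y0 : hcoord (set_val p) ord0 0 != 0.
  apply/eqP => y0; apply: np; exists 0 => //; exists (hcoord (set_val p) ord0 1).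
    by apply/eqP => y1; exact: y_eq0.
  by move=> x; rewrite y0 mul0r subr0.
have y1 : hcoord (set_val p) ord0 1 != 0.
  apply/eqP => y1; apply: np; exists 1 => //; exists (- hcoord (set_val p) ord0 0).
    by rewrite oppr_eq0.
  by move=> x; rewrite y1 mul0r sub0r mulNr.
apply: pencil_fun_neq0 => //; apply/eqP => yt; apply: np.
exists ord_max => //; exists (hcoord (set_val p) ord0 1 * c'); first by rewrite mulf_neq0.
move=> x; rewrite -mulrA -rel.
move: yt; rewrite /third_form => /eqP; rewrite subr_eq0 => /eqP ->.
by ring.
Qed.

Lemma target_fun_pencil (x : M) : target_fun (pencil_map N (to_Proj x)) =
  pencil_member N 0 (set_val x) * pencil_member N 1 (set_val x) *
  ((conjc (c' * pencil_member N ord_max (set_val x)) : C) *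
   (conjc (c' * pencil_member N ord_max (set_val x)) : C)) *
  (sqnorm (pencil_row N (set_val x)) ^+ 2)^-1.
Proof.
rewrite pencil_map_proj /target_fun [set_val _]/(to_Proj (pencil_vec N x)) CP1_fun_proj.
rewrite [set_val _]/(pencil_row N (set_val x)) /pencil_fun /third_form.
have r0 : pencil_row N (set_val x) ord0 0 = pencil_member N 0 (set_val x) by rewrite mxE.
have r1 : pencil_row N (set_val x) ord0 1 = pencil_member N 1 (set_val x) by rewrite mxE.
by rewrite r0 r1 rel.
Qed.

Section meridian_circle.
Variables (H : 'I_n) (y v : 'rV[C]_l).
Hypothesis yH : y \in hyperplane A H.
Hypothesis disc : forall (z : C) (H' : 'I_n), `|z| <= 1 ->
  y + z *: v \in hyperplane A H' -> H' = H /\ z = 0.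
Local Notation circ t := (y + expi (2 * pi * unitI_val t) *: v).

Lemma formv_affine H' z : formv A H' (y + z *: v) = formv A H' y + z * formv A H' v.
Proof. by rewrite -formvZ; exact: linearD. Qed.

Lemma formv_disc_neq0 H' z : `|z| <= 1 -> H' != H -> formv A H' (y + z *: v) != 0.
Proof.
move=> z1; apply: contra_neq => z0.
suff /(disc z1)[] : y + z *: v \in hyperplane A H' by [].
by rewrite memv_ker; apply/eqP.
Qed.

(** On the circle f_H is exp(2 i pi t) f_H(v). Any other form has no zero on the disc, so shrinking
    the circle to its centre shows that it does not turn. *)
Lemma turns_formv H' :
  turns (fun t : I => formv A H' (circ t)) (if H' == H then 2 * pi else 0).
Proof.
have [->|HH'] := eqVneq H' H.
  have y0 : formv A H y = 0 by apply/eqP; move: yH; rewrite memv_ker.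
  rewrite (_ : (fun t => _) = fun t : I => expi (2 * pi * unitI_val t) * formv A H v).
    exact: turns_circle.
  by apply/funext => t; rewrite formv_affine y0 add0r.
pose k (s t : I) : C := rc (unitI_val s) * expi (2 * pi * unitI_val t).
have k1 s t : `|k s t| <= 1.
  rewrite normrM norm_expi mulr1 normc_def /= expr0n addr0 sqrtr_sqr lecR.
  by rewrite ger0_norm ?unitI_ge0 ?unitI_le1.
pose G (w : I * I) : C := formv A H' y + k w.1 w.2 * formv A H' v.
have GE s t : G (s, t) = formv A H' (y + k s t *: v) by rewrite formv_affine.
have cI (Z : topologicalType) (f : Z -> I) : continuous f -> continuous (fun z => unitI_val (f z)).
  by move=> cf; apply: (comp_cts (g := unitI_val)) => //; exact: unitI_val_continuous.
have cG : continuous G.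
  apply: addC_cts; first exact: cst_cts.
  apply: mulC_cts; last exact: cst_cts.
  apply: mulC_cts; first by apply: rc_cts; apply: cI; exact: fst_cts.
  apply: expi_cts; apply: mul_cts; first exact: cst_cts.
  by apply: cI; exact: snd_cts.
have G0 w : G w != 0 by case: w => s t; rewrite GE; exact: formv_disc_neq0.
have G1 t : G (one, t) = formv A H' (circ t).
  by rewrite GE /k Defs.val1 rc1 mul1r.
have [a ta] : exists a, turns (fun t => G (one, t)) a.
  apply: turns_exists => // t; apply: continuous_comp; last exact: cG.
  by move: t; apply: pair_cts; [exact: cst_cts|move=> ?; exact: cvg_id].
suff a0 : 0 = a by rewrite a0; move: ta; under eq_fun => t do rewrite G1.
apply: (@turns_homotopy _ G 1) => //.
- by move=> s; rewrite mul1r /G /k /= Defs.val1 Defs.val0 mulr0 mulr1 expi0 expi_2pi.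
- rewrite (_ : (fun t => _) = fun=> formv A H' y); first exact: turns_cst.
  by apply/funext => t; rewrite /G /k /= Defs.val0 rc0 !mul0r addr0.
Qed.

Lemma turns_member i :
  turns (fun t : I => pencil_member N i (circ t)) (if mclass N H == i then 2 * pi else 0).
Proof.
rewrite (_ : (fun t => _) = fun t : I => \prod_(H' | mclass N H' == i) formv A H' (circ t)).
  rewrite (_ : (if _ then _ else _) =
    \sum_(H' | mclass N H' == i) (if H' == H then 2 * pi else 0 : R)).
    by apply: turns_prod => H'; exact: turns_formv.
  have [cH|cH] := boolP (mclass N H == i).
    rewrite (bigD1 H) //= eqxx big1 ?addr0 // => H' /andP[_ /negbTE -> //].
  by rewrite big1 // => H' cH'; case: eqP => // HH'; rewrite -HH' cH' in cH.
by apply/funext => t; apply: eq_bigr => H' _; rewrite hN expr1.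
Qed.

(** The turn is 2 pi when H belongs to one of the first two classes, and -4 pi when it belongs to
    the third, whose member enters as the square of a conjugate. The constant [c'] and the positive
    norm factor contribute 0. *)
Lemma turns_target (b : M) (q : {path I from b to b in M}) :
  (forall t, set_val (q t) = circ t) -> exists2 w : R,
  turns (fun t => target_fun (pencil_map N (to_Proj (q t)))) w &
  expi (3^-1 * w) = expi (2 * pi / 3) :> C.
Proof.
move=> qE.
have tm i := turns_member i.
pose a i : R := if mclass N H == i then 2 * pi else 0.
exists (a 0 + a 1 + (- (0 + a ord_max) + - (0 + a ord_max)) + 0).
  rewrite (_ : (fun t => _) = fun t => pencil_member N 0 (circ t) * pencil_member N 1 (circ t) *
    ((conjc (c' * pencil_member N ord_max (circ t)) : C) *
     (conjc (c' * pencil_member N ord_max (circ t)) : C)) *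
    (sqnorm (pencil_row N (circ t)) ^+ 2)^-1); last first.
    by apply/funext => t; rewrite target_fun_pencil qE.
  have tc : turns (fun t : I => conjc (c' * pencil_member N ord_max (circ t)) : C) (- (0 + a ord_max)).
    apply: turns_conj; last exact: turnsM (turns_cst _) (tm _).
    by move=> t; rewrite mulf_neq0 // -qE; exact: member_neq0.
  apply: turnsM; first exact: turnsM (turnsM (tm _) (tm _)) (turnsM tc tc).
  apply: turns_pos => t; rewrite invr_gt0 exprn_gt0 // sqnorm_gt0 //.
  by rewrite -qE; have /set_mem := pencil_row_neq0 N (q t).
have e3 : expi (3^-1 * (2 * pi)) = expi (2 * pi / 3) :> C by rewrite mulrC.
rewrite /a; case: (mclass N H) => -[|[|[|//]]] i /=; rewrite -e3.
- by congr expi; ring.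
- by congr expi; ring.
(* The angles -4 pi / 3 and 2 pi / 3 differ by a full turn. *)
- by rewrite -[LHS]mulr1 -expi_2pi -expiD; congr expi; field.
Qed.

End meridian_circle.
End pencil_turns.

Lemma character_eqP (R : realType) (G : groupType) (f g : character R G) :
  f =1 g -> f = g.
Proof.
case: f g => [f fM f0] [g gM g0] /= /funext fg; rewrite fg in fM f0 *.
by rewrite (Prop_irrelevance fM gM) (Prop_irrelevance f0 g0).
Qed.

Theorem lemma4p3 (R : realType) (l n : nat) (A : arrangement R l n)
    (N : multinet A 3) (hN : reduced N) (x0 : complement A)
    (rho : character R (pi1 R (to_Proj x0 : proj_complement A)))
    (hrho : is_diagonal rho) :
  pencil_component N (to_Proj x0 : proj_complement A) (character_exp rho (n %/ 3)).
Proof.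
have [c [c' [c'0 rel]]] := member_pencil hN.
have h0 := target_fun_neq0 c'0 rel; have ch := @target_fun_cts R l n A N c.
pose psi := turn_character h0 ch 3^-1 (pencil_map N (to_Proj x0 : proj_complement A)).
exists psi => //; apply: character_eqP => a.
have [H0 _] := class_nonempty N 0.
have [g <-] := pi1_to_Proj_surj H0 a.
have nE := reduced_size hN; have d0 := degree_gt0 hN.
(* As every class of pi_1(U) lifts to M, the comparison takes place on pi_1(M), where meridians
   suffice. *)
apply: (@characters_eq _ _ _ _ _
  (pullback (f := @to_Proj R l (complement A)) (x := x0) (pullback (f := pencil_map N) psi))
  (pullback (f := @to_Proj R l (complement A)) (x := x0) (character_exp rho (n %/ 3)))).
move=> H m Hm.
change (psi (pi1_map (pencil_map N) (pi1_map (@to_Proj R l (complement A)) m)) =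
  rho (pi1_map (@to_Proj R l (complement A)) m) ^+ (n %/ 3)).
rewrite (hrho H m Hm) -expiMn.
have -> : 2 * pi / n%:R *+ (n %/ 3) = 2 * pi / 3 :> R.
  rewrite nE mulKn // natrM -mulr_natr; field.
  by rewrite !pnatr_eq0 -lt0n d0.
case: Hm => y [v [b [s [q [yH disc qE ->]]]]].
rewrite (pi1_map_class (@to_Proj R l (complement A)) (concat (concat s q) (reverse s))).
rewrite (pi1_map_class (pencil_map N)).
have [w tw <-] := turns_target hN c'0 rel yH disc qE.
pose f x := target_fun c (pencil_map N (to_Proj (x : complement A))).
have f0 x : f x != 0 by exact: h0.
have cf : continuous f.
  apply: (comp_cts (g := target_fun c)) => //.
  apply: (comp_cts (g := pencil_map N)); first exact: pencil_map_continuous.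
  exact: to_Proj_continuous.
have [u tu] : exists u, turns (f \o s) u.
  apply: turns_exists => t; last exact: f0.
  by apply: continuous_comp; [exact: path_cts|exact: cf].
(* The turn [u] along the approach path cancels on the way back, leaving that of the circle. *)
have tq := turns_concat (turns_concat tu (tw : turns (f \o q) w)) (turns_reverse tu).
rewrite (turn_characterE h0 ch 3^-1 (a := u + w - u)); last exact: tq.
by rewrite addrAC subrr add0r.
Qed.
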